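(* Let $P,D\in\mathbb Z$ with $3\nmid P$ or $27\mid P$, where $D$ is not a perfect square. Suppose $Q=P^2+27D=2^{q_1}q_0^3$ with $q_0\in\mathbb Z$ and $q_1\in\{0,1,2\}$, and assume $DQ\neq0$. For $[a,2b,c]\in H(4D)$ with $(a,3DQ)=1$ define $$\chi([a,2b,c])=\Big(\frac{P-3b(1+2\omega)}a\Big)_3.$$ Then $\chi$ is a (well-defined) character on $H(4D)$, and so $$G(P,D)=\Big\{[a,2b,c]\in H(4D)\ \Big|\ (a,3DQ)=1,\ \Big(\frac{P-3b(1+2\omega)}a\Big)_3=1\Big\}$$ is a subgroup of $H(4D)$, where $a>0$ when $D<0$. Moreover, if the congruence $Dx^3-Qx-2Q\equiv0\pmod{p_0}$ is insolvable for some odd prime $p_0$ with $p_0\nmid 3DPQ$, then $G(P,D)$ is a subgroup of index $3$ in $H(4D)$.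
   Context: $(m,n)$ for integers $m,n$ denotes the greatest common divisor. Binary quadratic forms. For integers $A,B,C$, $(A,B,C)$ denotes the form $Ax^2+Bxy+Cy^2$, of discriminant $B^2-4AC$; it is primitive if $\gcd(A,B,C)=1$. Two forms are equivalent if they are related by a substitution in $SL_2(\mathbb Z)$, and $[A,B,C]$ is the equivalence class of $(A,B,C)$. For a nonsquare integer $\Delta\equiv0,1\pmod4$, $H(\Delta)$ is the form class group (under Gauss composition) of classes of primitive integral binary quadratic forms of discriminant $\Delta$ (positive definite forms if $\Delta<0$). Every class of $H(4D)$ contains a form $(a,2b,c)$ with $b^2-ac=D$ and $a$ prime to any given positive integer; the value of $\chi$ on a class is computed from any such form with $(a,3DQ)=1$ in the class. A class belongs to the set $G$ if it contains a form $(a,2b,c)$ satisfying the stated conditions. Cubic Jacobi symbol. Let $\omega=(-1+\sqrt{-3})/2$ and $N(a+b\omega)=a^2-ab+b^2$. An element $a+b\omega\in\mathbb Z[\omega]$ is primary if $a\equiv2\pmod3$ and $3\mid b$. For a primary prime $\pi\in\mathbb Z[\omega]$ and $\alpha\in\mathbb Z[\omega]$, $\big(\frac{\alpha}{\pi}\big)_3=0$ if $\pi\mid\alpha$, and otherwise $\big(\frac{\alpha}{\pi}\big)_3=\omega^i$ where $\alpha^{(N(\pi)-1)/3}\equiv\omega^i\pmod\pi$. If $\beta=a+b\omega$ with $3\nmid a$, $3\mid b$ and $N(\beta)>1$, write $\beta=\pm\pi_1\cdots\pi_r$ with primary primes $\pi_j$ and put $\big(\frac{\alpha}{\beta}\big)_3=\prod_j\big(\frac{\alpha}{\pi_j}\big)_3$;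 also $\big(\frac{\alpha}{\pm1}\big)_3=1$. *)

(* Defs.v *)
From HB Require Import structures.
From mathcomp Require Import all_boot all_order all_algebra algC.
From mathcomp Require Import boolp classical_sets functions cardinality.
From mathcomp Require Import generic_quotient ring zify.

Set Implicit Arguments.
Unset Strict Implicit.
Unset Printing Implicit Defensive.

Import Order.TTheory GRing.Theory Num.Theory.
Local Open Scope ring_scope.
Local Open Scope quotient_scope.
Local Open Scope classical_set_scope.

Record bqf := Bqf { qa : int; qb : int; qc : int }.

Definition bqf_tuple (f : bqf) : int * int * int := (qa f, qb f, qc f).
Definition tuple_bqf (t : int * int * int) : bqf := Bqf t.1.1 t.1.2 t.2.
Lemma bqf_tupleK : cancel bqf_tuple tuple_bqf. Proof. by case. Qed.
HB.instance Definition _ := Choice.copy bqf (can_type bqf_tupleK).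

Definition bqf_eval (f : bqf) (x y : int) : int :=
  qa f * x ^+ 2 + qb f * x * y + qc f * y ^+ 2.

Definition bqf_disc (f : bqf) : int := qb f ^+ 2 - 4 * qa f * qc f.

Definition bqf_primitive (f : bqf) : bool :=
  gcdz (qa f) (gcdz (qb f) (qc f)) == 1.

(* When d < 0, a form of discriminant d is positive definite iff its first
   coefficient is positive. *)
Definition bqf_in (d : int) (f : bqf) : bool :=
  [&& bqf_disc f == d, bqf_primitive f & (d < 0) ==> (0 < qa f)].

Record qform (d : int) := QForm { fval :> bqf; _ : bqf_in d fval }.
HB.instance Definition _ d := [isSub for @fval d].
HB.instance Definition _ d := [Choice of qform d by <:].

Definition bqf_equiv (f g : bqf) : Prop :=
  exists p q r s : int, p * s - q * r = 1 /\
    forall x y, bqf_eval g x y = bqf_eval f (p * x + q * y) (r * x + s * y).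

Lemma bqf_equiv_refl f : bqf_equiv f f.
Proof.
exists 1, 0, 0, 1; split=> [|x y]; first by ring.
by rewrite /bqf_eval; ring.
Qed.

Lemma bqf_equiv_sym f g : bqf_equiv f g -> bqf_equiv g f.
Proof.
move=> [p [q [r [s [det fg]]]]]; exists s, (- q), (- r), p.
split=> [|x y]; first by rewrite -det; ring.
rewrite fg; congr bqf_eval.
  by rewrite -[LHS]mul1r -det; ring.
by rewrite -[LHS]mul1r -det; ring.
Qed.

Lemma bqf_equiv_trans g f h : bqf_equiv f g -> bqf_equiv g h -> bqf_equiv f h.
Proof.
move=> [p [q [r [s [det fg]]]]] [p' [q' [r' [s' [det' gh]]]]].
exists (p * p' + q * r'), (p * q' + q * s'), (r * p' + s * r'), (r * q' + s * s').
split=> [|x y].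
  by transitivity ((p * s - q * r) * (p' * s' - q' * r')); [ring|rewrite det det'].
by rewrite gh fg; congr bqf_eval; ring.
Qed.

Section FormClass.
Variable d : int.

Definition form_equiv (f g : qform d) : bool := `[< bqf_equiv f g >].

Lemma form_equiv_refl : reflexive form_equiv.
Proof. by move=> f; apply/asboolP/bqf_equiv_refl. Qed.

Lemma form_equiv_sym : symmetric form_equiv.
Proof. by move=> f g; apply/asboolP/asboolP => /bqf_equiv_sym. Qed.

Lemma form_equiv_trans : transitive form_equiv.
Proof.
by move=> g f h /asboolP fg /asboolP gh; apply/asboolP/(bqf_equiv_trans fg).
Qed.

Canonical form_equiv_rel :=
  EquivRel form_equiv form_equiv_refl form_equiv_sym form_equiv_trans.

Definition form_class := {eq_quot form_equiv_rel}.
HB.instance Definition _ := Choice.on form_class.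
HB.instance Definition _ := EqQuotient.on form_class.

Definition cls (f : qform d) : form_class := \pi_form_class f.

Lemma clsP (f g : qform d) : cls f = cls g <-> bqf_equiv f g.
Proof.
split=> [/eqP|fg]; last by apply/eqquotP/asboolP.
by rewrite /cls eqmodE => /asboolP.
Qed.

Lemma cls_repr (x : form_class) : cls (repr x) = x.
Proof. exact: reprK. Qed.

Definition contains (x : form_class) (F : bqf) : Prop :=
  exists2 f : qform d, cls f = x & fval f = F.

End FormClass.

Lemma dvdzD (k m n : int) : (k %| m)%Z -> (k %| n)%Z -> (k %| m + n)%Z.
Proof. exact: rpredD. Qed.
Lemma dvdz_addr (k m n : int) : (k %| n)%Z -> (k %| m + n)%Z = (k %| m)%Z.
Proof. exact: rpredDr. Qed.
Lemma dvdz_addl (k m n : int) : (k %| m)%Z -> (k %| m + n)%Z = (k %| n)%Z.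
Proof. exact: rpredDl. Qed.

Lemma bqf_primitiveP f :
  reflect (exists u v w, u * qa f + v * qb f + w * qc f = 1) (bqf_primitive f).
Proof.
apply: (iffP eqP) => [prim|[u [v [w uvw]]]].
  have [u [v uv]] := Bezoutz (qa f) (gcdz (qb f) (qc f)).
  have [s [t st]] := Bezoutz (qb f) (qc f).
  exists u, (v * s), (v * t); rewrite -prim -uv -st; ring.
set g := gcdz _ _.
have ga : (g %| qa f)%Z by exact: dvdz_gcdl.
have gbc : (g %| gcdz (qb f) (qc f))%Z by exact: dvdz_gcdr.
have gb := dvdz_trans gbc (dvdz_gcdl _ _).
have gc := dvdz_trans gbc (dvdz_gcdr _ _).
have: (g %| 1%R)%Z by rewrite -uvw; apply: dvdzD; [apply: dvdzD|]; exact: dvdz_mull.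
by rewrite dvdzE dvdn1 => /eqP g1; rewrite -[g]gez0_abs ?g1.
Qed.

Lemma bqf_equiv_coef f p q r s :
  p * s - q * r = 1 ->
  bqf_equiv f (Bqf (bqf_eval f p r)
    (2 * qa f * p * q + qb f * (p * s + q * r) + 2 * qc f * r * s)
    (bqf_eval f q s)).
Proof.
by move=> det; exists p, q, r, s; split=> // x y; rewrite /bqf_eval /=; ring.
Qed.

Lemma bqf_evalI f g : (forall x y, bqf_eval f x y = bqf_eval g x y) -> f = g.
Proof.
case: f g => [a b c] [a' b' c'] e.
have := e 1 0; have := e 0 1; have := e 1 1; rewrite /bqf_eval /=.
rewrite !expr1n !mulr1 !expr0n !mulr0 !addr0 !add0r => e1 e2 e3.
by congr Bqf; lia.
Qed.

Lemma bqf_equiv_coefE f g : bqf_equiv f g ->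
  exists p q r s, p * s - q * r = 1 /\
  g = Bqf (bqf_eval f p r)
    (2 * qa f * p * q + qb f * (p * s + q * r) + 2 * qc f * r * s)
    (bqf_eval f q s).
Proof.
move=> [p [q [r [s [det fg]]]]]; exists p, q, r, s; split=> //.
by apply: bqf_evalI => x y; rewrite fg /bqf_eval /=; ring.
Qed.

Lemma bqf_equiv_disc f g : bqf_equiv f g -> bqf_disc g = bqf_disc f.
Proof.
move=> /bqf_equiv_coefE[p [q [r [s [det ->]]]]].
transitivity ((p * s - q * r) ^+ 2 * bqf_disc f); last by rewrite det; ring.
by rewrite /bqf_disc /bqf_eval /=; ring.
Qed.

Lemma bqf_equiv_primitive f g :
  bqf_equiv f g -> bqf_primitive f -> bqf_primitive g.
Proof.
move=> /bqf_equiv_sym /bqf_equiv_coefE[p [q [r [s [_ ->]]]]].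
move=> /bqf_primitiveP/=[u [v [w uvw]]]; apply/bqf_primitiveP.
exists (u * p ^+ 2 + 2 * v * p * q + w * q ^+ 2).
exists (u * p * r + v * (p * s + q * r) + w * q * s).
exists (u * r ^+ 2 + 2 * v * r * s + w * s ^+ 2).
by rewrite -[RHS]uvw /bqf_eval; ring.
Qed.

Lemma bqf_eval_gt0 f (x y : int) : bqf_disc f < 0 -> 0 < qa f -> (x, y) != (0, 0) ->
  0 < bqf_eval f x y.
Proof.
move=> dlt0 agt0 xy0; rewrite -(pmulr_rgt0 _ (_ : 0 < 4 * qa f)) //; last first.
  by rewrite mulr_gt0.
rewrite (_ : _ * bqf_eval f x y = (2 * qa f * x + qb f * y) ^+ 2 + (- bqf_disc f) * y ^+ 2);
  last by rewrite /bqf_eval /bqf_disc; ring.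
have [y0|y0] := eqVneq y 0.
  rewrite y0 in xy0 *; rewrite mulr0 addr0 expr0n mulr0 addr0.
  move: xy0; rewrite xpair_eqE eqxx andbT => x0.
  by rewrite exprn_even_gt0 //= mulf_neq0 // mulf_neq0 // gt_eqF.
by rewrite ltr_wpDl ?sqr_ge0 // mulr_gt0 ?oppr_gt0 // exprn_even_gt0.
Qed.

Lemma bqf_equiv_in d f g : bqf_equiv f g -> bqf_in d f -> bqf_in d g.
Proof.
move=> fg /and3P[/eqP fd fprim fpos]; apply/and3P; split.
- by rewrite (bqf_equiv_disc fg) fd.
- exact: bqf_equiv_primitive fg fprim.
apply/implyP => d0; move/implyP/(_ d0): fpos => fpos.
have [p [q [r [s [det ->]]]]] := bqf_equiv_coefE fg => /=.
apply: bqf_eval_gt0; rewrite ?fd //.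
apply/eqP => -[p0 r0]; move: det; rewrite p0 r0; lia.
Qed.

Lemma bqf_equiv_shift a b c k :
  bqf_equiv (Bqf a b c) (Bqf a (b + 2 * a * k) (a * k ^+ 2 + b * k + c)).
Proof.
exists 1, k, 0, 1; split=> [|x y]; first by ring.
by rewrite /bqf_eval /=; ring.
Qed.

Lemma bqf_primitive_coprime f (N : int) : bqf_primitive f -> N != 0 ->
  exists x y, coprimez x y /\ coprimez (bqf_eval f x y) N.
Proof.
move=> prim N0; set n := `|N|%N; have n0 : (0 < n)%N by rewrite absz_gt0.
pose A : nat_pred := [pred p : nat | (Posz p %| qa f)%Z].
pose C : nat_pred := [pred p : nat | (Posz p %| qc f)%Z].
pose X := (n`_[pred p : nat | (p \in A) && (p \notin C)])%N.
pose Y := (n`_[pred p : nat | p \notin A])%N.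
have inX p : p \in primes n -> (Posz p %| X%:Z)%Z = (p \in A) && (p \notin C).
  move=> pn; have : (p \in primes X) = (p \in A) && (p \notin C).
    by rewrite primes_part mem_filter pn andbT.
  by rewrite mem_primes part_gt0; move: pn; rewrite mem_primes => /and3P[->].
have inY p : p \in primes n -> (Posz p %| Y%:Z)%Z = (p \notin A).
  move=> pn; have : (p \in primes Y) = (p \notin A).
    by rewrite primes_part mem_filter pn andbT.
  by rewrite mem_primes part_gt0; move: pn; rewrite mem_primes => /and3P[->].
exists X, Y; split.
  rewrite coprimezE /= coprime_has_primes ?part_gt0 //; apply/hasPn => p.
  rewrite /= !primes_part !mem_filter => /andP[pA pn] /=.
  by rewrite pn andbT negb_and; apply/orP; left.
rewrite coprimezE -[`|N|%N]/n; apply/negPn/negP => ncop.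
set g := gcdn `|bqf_eval f X Y| n.
have g1 : (1 < g)%N.
  by rewrite ltn_neqAle eq_sym ncop gcdn_gt0 n0 orbT.
pose p := pdiv g; have pp : prime p := pdiv_prime g1.
have pg : (p %| g)%N := pdiv_dvd g.
have pf : (Posz p %| bqf_eval f X Y)%Z.
  by rewrite dvdzE /=; apply: dvdn_trans pg (dvdn_gcdl _ _).
have pn : p \in primes n.
  by rewrite mem_primes pp n0 (dvdn_trans pg (dvdn_gcdr _ _)).
have pX := inX _ pn; have pY := inY _ pn.
have sq (z : int) : (Posz p %| z ^+ 2)%Z -> (Posz p %| z)%Z.
  by rewrite !dvdzE abszX /= Euclid_dvdX // andbT.
have Eu (z t : int) : (Posz p %| z * t)%Z -> (Posz p %| z)%Z || (Posz p %| t)%Z.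
  by rewrite !dvdzE abszM Euclid_dvdM.
have [pA|pA] := boolP (p \in A); rewrite pA /= in pX pY; last first.
  move: pf; rewrite /bqf_eval -addrA dvdz_addr; last first.
    by apply: dvdzD; rewrite ?expr2; do !apply: dvdz_mull; rewrite pY.
  move=> /Eu/orP[]; first by move=> h; case/negP: pA; rewrite inE.
  by move=> /sq; rewrite pX (negbTE pA).
have [pC|pC] := boolP (p \in C); rewrite pC /= in pX; last first.
  move: pf; rewrite /bqf_eval dvdz_addl; last first.
    apply: dvdzD; last by apply/dvdz_mulr/dvdz_mull; rewrite pX.
    by rewrite expr2; apply/dvdz_mull/dvdz_mull; rewrite pX.
  move=> /Eu/orP[]; first by move=> h; case/negP: pC; rewrite inE.
  by move=> /sq; rewrite pY.
have {}pA : (Posz p %| qa f)%Z by move: pA; rewrite inE.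
have {}pC : (Posz p %| qc f)%Z by move: pC; rewrite inE.
have pB : (Posz p %| qb f)%Z.
  move: pf; rewrite /bqf_eval dvdz_addr; last by rewrite dvdz_mulr.
  rewrite dvdz_addl; last by rewrite dvdz_mulr.
  by move=> /Eu/orP[/Eu/orP[//|]|]; rewrite ?pX ?pY.
have /bqf_primitiveP[u [v [w uvw]]] := prim.
have : (Posz p %| 1%R)%Z by rewrite -uvw; apply: dvdzD; [apply: dvdzD|]; exact: dvdz_mull.
by rewrite dvdzE dvdn1 /= => /eqP p1; rewrite p1 in pp.
Qed.

(* Gauss's direct composition: h(X, Y) = f(x, y) g(z, w) for integral bilinear
   X, Y, where the determinant of (X, Y) in the variables (z, w) is f(x, y) and
   the determinant in the variables (x, y) is g(z, w). The usual definition asks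
   for the last two identities at (1, 0) only; given the first identity and equal
   nonzero discriminants this is the same as soon as f(1, 0) and g(1, 0) are
   nonzero, in particular for nonsquare discriminants. *)
Definition direct_composite (f g h : bqf) : Prop :=
  exists p0 p1 p2 p3 q0 q1 q2 q3 : int,
  [/\ forall x y z w, bqf_eval f x y * bqf_eval g z w =
        bqf_eval h (p0 * (x * z) + p1 * (x * w) + p2 * (y * z) + p3 * (y * w))
                   (q0 * (x * z) + q1 * (x * w) + q2 * (y * z) + q3 * (y * w)),
      forall x y, (p0 * x + p2 * y) * (q1 * x + q3 * y)
                - (p1 * x + p3 * y) * (q0 * x + q2 * y) = bqf_eval f x y
    & forall z w, (p0 * z + p1 * w) * (q2 * z + q3 * w)
                - (p2 * z + p3 * w) * (q0 * z + q1 * w) = bqf_eval g z w].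

Lemma united_composite a1 a2 b c :
  direct_composite (Bqf a1 b (a2 * c)) (Bqf a2 b (a1 * c)) (Bqf (a1 * a2) b c).
Proof.
exists 1, 0, 0, (- c), 0, a1, a2, b.
by split=> *; rewrite /bqf_eval /=; ring.
Qed.

Lemma direct_composite_equiv f g f' g' h :
  bqf_equiv f f' -> bqf_equiv g g' ->
  direct_composite f g h -> direct_composite f' g' h.
Proof.
move=> [p [q [r [s [det ff']]]]] [t [u [v [w [det' gg']]]]].
move=> [p0 [p1 [p2 [p3 [q0 [q1 [q2 [q3 [fgh hf hg]]]]]]]]].
exists (p0 * p * t + p1 * p * v + p2 * r * t + p3 * r * v).
exists (p0 * p * u + p1 * p * w + p2 * r * u + p3 * r * w).
exists (p0 * q * t + p1 * q * v + p2 * s * t + p3 * s * v).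
exists (p0 * q * u + p1 * q * w + p2 * s * u + p3 * s * w).
exists (q0 * p * t + q1 * p * v + q2 * r * t + q3 * r * v).
exists (q0 * p * u + q1 * p * w + q2 * r * u + q3 * r * w).
exists (q0 * q * t + q1 * q * v + q2 * s * t + q3 * s * v).
exists (q0 * q * u + q1 * q * w + q2 * s * u + q3 * s * w).
split=> [x y z k|x y|z k].
- by rewrite ff' gg' fgh; congr bqf_eval; ring.
- have e k : (t * w - u * v) * k = k by rewrite det' mul1r.
  by rewrite ff' -hf -[RHS]e; ring.
- have e l : (p * s - q * r) * l = l by rewrite det mul1r.
  by rewrite gg' -hg -[RHS]e; ring.
Qed.

Lemma bqf_primitive_neq0 f : bqf_primitive f ->
  exists x y, bqf_eval f x y != 0.
Proof.
move=> /bqf_primitiveP[u [v [w uvw]]].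
have [a0|?] := eqVneq (bqf_eval f 1 0) 0; last by exists 1, 0.
have [c0|?] := eqVneq (bqf_eval f 0 1) 0; last by exists 0, 1.
exists 1, 1; apply/eqP => b0; move: a0 c0 b0 uvw; rewrite /bqf_eval.
rewrite !(expr1n, expr0n) /= !(mulr0, mulr1, addr0, add0r) => -> -> /=.
rewrite add0r addr0 => ->; rewrite !mulr0; lia.
Qed.

Lemma direct_composite_unique f g h h' : bqf_primitive f ->
  direct_composite f g h -> direct_composite f g h' -> bqf_equiv h' h.
Proof.
move=> prim [p0 [p1 [p2 [p3 [q0 [q1 [q2 [q3 [fgh hf hg]]]]]]]]].
move=> [r0 [r1 [r2 [r3 [s0 [s1 [s2 [s3 [fgh' hf' hg']]]]]]]]].
have minors a b c a' b' c' : (forall x y : int,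
    a * x ^+ 2 + b * (x * y) + c * y ^+ 2 =
    a' * x ^+ 2 + b' * (x * y) + c' * y ^+ 2 :> int) ->
    [/\ a = a', b = b' & c = c'].
  move=> e; have := e 1 0; have := e 0 1; have := e 1 1.
  rewrite !(expr1n, expr0n) /= !(mulr0, mulr1, addr0, add0r).
  by move=> + e2 e1; rewrite e1 e2 => /addIr/addrI.
have [e01 e03 e23] : [/\ r0 * s1 - r1 * s0 = p0 * q1 - p1 * q0,
    (r0 * s3 - r3 * s0) - (r1 * s2 - r2 * s1) =
    (p0 * q3 - p3 * q0) - (p1 * q2 - p2 * q1)
    & r2 * s3 - r3 * s2 = p2 * q3 - p3 * q2].
  apply: minors => x y; move: (etrans (hf x y) (esym (hf' x y))) => e.
  by transitivity ((r0 * x + r2 * y) * (s1 * x + s3 * y)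
                - (r1 * x + r3 * y) * (s0 * x + s2 * y)); [|rewrite -e]; ring.
have [e02 e03' e13] : [/\ r0 * s2 - r2 * s0 = p0 * q2 - p2 * q0,
    (r0 * s3 - r3 * s0) + (r1 * s2 - r2 * s1) =
    (p0 * q3 - p3 * q0) + (p1 * q2 - p2 * q1)
    & r1 * s3 - r3 * s1 = p1 * q3 - p3 * q1].
  apply: minors => x y; move: (etrans (hg x y) (esym (hg' x y))) => e.
  by transitivity ((r0 * x + r1 * y) * (s2 * x + s3 * y)
                - (r2 * x + r3 * y) * (s0 * x + s1 * y)); [|rewrite -e]; ring.
have e12 : r1 * s2 - r2 * s1 = p1 * q2 - p2 * q1.
  by move: e03 e03'; clear; lia.
have {e03 e03'} e03 : r0 * s3 - r3 * s0 = p0 * q3 - p3 * q0.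
  by move: e03'; rewrite e12 => /addIr.
have [fa fb fc] : [/\ p0 * q1 - p1 * q0 = qa f,
   (p0 * q3 - p3 * q0) - (p1 * q2 - p2 * q1) = qb f & p2 * q3 - p3 * q2 = qc f].
  apply: minors => x y; rewrite -[RHS]/(_ + _ + _).
  by transitivity (bqf_eval f x y); [rewrite -hf|rewrite /bqf_eval]; ring.
have /bqf_primitiveP[u [v [w]]] := prim.
rewrite -fa -fb -fc => bez.
pose t00 := u * (r0 * q1 - r1 * q0) + v * (r0 * q3 - r3 * q0)
          - v * (r1 * q2 - r2 * q1) + w * (r2 * q3 - r3 * q2).
pose t01 := u * (r1 * p0 - r0 * p1) + v * (r3 * p0 - r0 * p3)
          - v * (r2 * p1 - r1 * p2) + w * (r3 * p2 - r2 * p3).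
pose t10 := u * (s0 * q1 - s1 * q0) + v * (s0 * q3 - s3 * q0)
          - v * (s1 * q2 - s2 * q1) + w * (s2 * q3 - s3 * q2).
pose t11 := u * (s1 * p0 - s0 * p1) + v * (s3 * p0 - s0 * p3)
          - v * (s2 * p1 - s1 * p2) + w * (s3 * p2 - s2 * p3).
have T pk qk rk sk :
    r0 * sk - rk * s0 = p0 * qk - pk * q0 -> r1 * sk - rk * s1 = p1 * qk - pk * q1 ->
    r2 * sk - rk * s2 = p2 * qk - pk * q2 -> r3 * sk - rk * s3 = p3 * qk - pk * q3 ->
    rk = t00 * pk + t01 * qk /\ sk = t10 * pk + t11 * qk.
  move=> e0k e1k e2k e3k; split.
    have -> : t00 * pk + t01 * qk =
      u * (r1 * (p0 * qk - pk * q0) - r0 * (p1 * qk - pk * q1))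
      + v * (r3 * (p0 * qk - pk * q0) - r0 * (p3 * qk - pk * q3)
           - r2 * (p1 * qk - pk * q1) + r1 * (p2 * qk - pk * q2))
      + w * (r3 * (p2 * qk - pk * q2) - r2 * (p3 * qk - pk * q3)).
      by rewrite /t00 /t01; ring.
    by rewrite -e0k -e1k -e2k -e3k -[LHS]mulr1 -bez -e01 -e12 -e03 -e23; ring.
  have -> : t10 * pk + t11 * qk =
    u * (s1 * (p0 * qk - pk * q0) - s0 * (p1 * qk - pk * q1))
    + v * (s3 * (p0 * qk - pk * q0) - s0 * (p3 * qk - pk * q3)
         - s2 * (p1 * qk - pk * q1) + s1 * (p2 * qk - pk * q2))
    + w * (s3 * (p2 * qk - pk * q2) - s2 * (p3 * qk - pk * q3)).
    by rewrite /t10 /t11; ring.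
  by rewrite -e0k -e1k -e2k -e3k -[LHS]mulr1 -bez -e01 -e12 -e03 -e23; ring.
have swap (a b c d : int) : a - b = c - d -> b - a = d - c.
  by move=> e; rewrite -[b - a]opprB e opprB.
have [E0 F0] : r0 = t00 * p0 + t01 * q0 /\ s0 = t10 * p0 + t11 * q0.
  by apply: T; [ring|exact: swap|exact: swap|exact: swap].
have [E1 F1] : r1 = t00 * p1 + t01 * q1 /\ s1 = t10 * p1 + t11 * q1.
  by apply: T; [|ring|exact: swap|exact: swap].
have [E2 F2] : r2 = t00 * p2 + t01 * q2 /\ s2 = t10 * p2 + t11 * q2.
  by apply: T; [| |ring|exact: swap].
have [E3 F3] : r3 = t00 * p3 + t01 * q3 /\ s3 = t10 * p3 + t11 * q3.
  by apply: T; [| | |ring].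
clearbody t00 t01 t10 t11.
exists t00, t01, t10, t11; split.
  have: (t00 * t11 - t01 * t10) * (u * (p0 * q1 - p1 * q0)
      + v * (p0 * q3 - p3 * q0 - (p1 * q2 - p2 * q1)) + w * (p2 * q3 - p3 * q2))
    = u * (r0 * s1 - r1 * s0) + v * (r0 * s3 - r3 * s0 - (r1 * s2 - r2 * s1))
      + w * (r2 * s3 - r3 * s2).
    by rewrite E0 E1 E2 E3 F0 F1 F2 F3; ring.
  by rewrite e01 e03 e12 e23 bez mulr1.
move=> X Y; have [x [y n0]] := bqf_primitive_neq0 prim.
set n := bqf_eval f x y in n0.
have scal k a b : bqf_eval k (n * a) (n * b) = n ^+ 2 * bqf_eval k a b.
  by rewrite /bqf_eval; ring.
apply: (mulfI (_ : n ^+ 2 != 0)); first by rewrite expf_neq0.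
rewrite -!scal.
set z := (q1 * x + q3 * y) * X - (p1 * x + p3 * y) * Y.
set k := (p0 * x + p2 * y) * Y - (q0 * x + q2 * y) * X.
have eX : n * X = p0 * (x * z) + p1 * (x * k) + p2 * (y * z) + p3 * (y * k).
  by rewrite /n -hf /z /k; ring.
have eY : n * Y = q0 * (x * z) + q1 * (x * k) + q2 * (y * z) + q3 * (y * k).
  by rewrite /n -hf /z /k; ring.
rewrite eX eY -fgh fgh'; congr bqf_eval.
  by transitivity (t00 * (n * X) + t01 * (n * Y)); [rewrite eX eY E0 E1 E2 E3|]; ring.
by transitivity (t10 * (n * X) + t11 * (n * Y)); [rewrite eX eY F0 F1 F2 F3|]; ring.
Qed.

Section Composition.
Variable d : int.
Implicit Types (x y z : form_class d).

Definition gauss_comp x y z : Prop := exists f g h : qform d,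
  [/\ cls f = x, cls g = y, cls h = z & direct_composite f g h].

(* The default value x of xget is never used: see class_mulP. *)
Definition class_mul x y : form_class d := xget x [set z | gauss_comp x y z].

Lemma contains_inj x y F : contains x F -> contains y F -> x = y.
Proof. by move=> [f <- fF] [g <- gF]; congr cls; apply: val_inj; rewrite /= fF. Qed.

Lemma contains_equiv x F G : bqf_equiv F G -> contains x F -> contains x G.
Proof.
move=> FG [f <- fF]; have Gd : bqf_in d G.
  by apply: bqf_equiv_in FG _; rewrite -fF; case: (f).
exists (QForm Gd) => //; apply/clsP/bqf_equiv_sym; rewrite fF; exact: FG.
Qed.

Lemma contains_in x F : contains x F -> bqf_in d F.
Proof. by move=> [f _ <-]; case: f. Qed.

Lemma in_contains F : bqf_in d F -> exists x, contains x F.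
Proof. by move=> Fd; exists (cls (QForm Fd)); exists (QForm Fd). Qed.

Lemma gauss_comp_unique x y z z' :
  gauss_comp x y z -> gauss_comp x y z' -> z = z'.
Proof.
move=> [f [g [h [<- <- <- fgh]]]] [f' [g' [h' [/clsP ff' /clsP gg' <- fgh']]]].
have prim : bqf_primitive f by case: (f) => ? /= /and3P[].
apply/clsP; apply: (direct_composite_unique prim) fgh.
exact: direct_composite_equiv fgh'.
Qed.

Lemma class_mulE x y z : gauss_comp x y z -> class_mul x y = z.
Proof.
by move=> xyz; apply: xget_unique => // z' xyz'; apply: gauss_comp_unique xyz' xyz.
Qed.

Lemma gauss_comp_united x y a1 a2 b c :
  contains x (Bqf a1 b (a2 * c)) -> contains y (Bqf a2 b (a1 * c)) ->
  exists2 z, contains z (Bqf (a1 * a2) b c) & gauss_comp x y z.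
Proof.
move=> xF yG; have /and3P[/eqP dF pF posF] := contains_in xF.
have /and3P[_ pG posG] := contains_in yG.
have Hd : bqf_in d (Bqf (a1 * a2) b c).
  apply/and3P; split.
  - by rewrite -dF /bqf_disc /=; apply/eqP; ring.
  - move/bqf_primitiveP: pF => /= [u [v [w e1]]].
    move/bqf_primitiveP: pG => /= [u' [v' [w' e2]]].
    have e : (u * a1 + v * b + w * (a2 * c)) * (u' * a2 + v' * b + w' * (a1 * c)) = 1.
      by rewrite e1 e2 mulr1.
    apply/bqf_primitiveP => /=.
    exists (u * u' + w * w' * c ^+ 2).
    exists (u * v' * a1 + v * u' * a2 + v * v' * b + v * w' * a1 * c + w * v' * a2 * c).
    exists (u * w' * a1 ^+ 2 + w * u' * a2 ^+ 2).
    by rewrite -[RHS]e; ring.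
  - apply/implyP => d0; move: posF posG; rewrite d0 /= => *; exact: mulr_gt0.
have [f xf fF] := xF; have [g yg gG] := yG.
exists (cls (QForm Hd)); first by exists (QForm Hd).
exists f, g, (QForm Hd); split=> //.
by rewrite fF gG; apply: united_composite.
Qed.

Lemma class_mul_united x y a1 a2 b c :
  contains x (Bqf a1 b (a2 * c)) -> contains y (Bqf a2 b (a1 * c)) ->
  contains (class_mul x y) (Bqf (a1 * a2) b c).
Proof.
by move=> xF yG; have [z zH /class_mulE->] := gauss_comp_united xF yG.
Qed.

Lemma contains_coprime x (N : int) : N != 0 ->
  exists a b c, contains x (Bqf a b c) /\ coprimez a N.
Proof.
move=> N0; have prim : bqf_primitive (repr x) by case: (repr x) => ? /= /and3P[].
have [p [r [cop copN]]] := bqf_primitive_coprime prim N0.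
have /coprimezP[[s q] /= det] := cop.
have det' : p * s - (- q) * r = 1 by rewrite -det; ring.
have := bqf_equiv_coef (repr x) det'; set G := Bqf _ _ _ => FG.
exists (qa G), (qb G), (qc G); split=> //.
by apply: (contains_equiv FG); exists (repr x) => //; exact: cls_repr.
Qed.

Lemma contains_shift x a b c b' : contains x (Bqf a b c) ->
  (2 * a %| b' - b)%Z ->
  exists c', contains x (Bqf a b' c').
Proof.
move=> xF /dvdzP[k e]; exists (a * k ^+ 2 + b * k + c).
have -> : b' = b + 2 * a * k by rewrite -[b'](subrK b) e; ring.
exact: contains_equiv (bqf_equiv_shift _ _ _ _) xF.
Qed.

Lemma contains_disc x a b c : contains x (Bqf a b c) -> b ^+ 2 - 4 * a * c = d.
Proof. by move=> /contains_in/and3P[/eqP]. Qed.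

Lemma contains_parity x y a b c a' b' c' :
  contains x (Bqf a b c) -> contains y (Bqf a' b' c') -> (2 %| b - b')%Z.
Proof.
move=> /contains_disc e /contains_disc e'.
have : (2 %| (b - b') ^+ 2)%Z.
  apply/dvdzP; exists (2 * a * c - 2 * a' * c' + b' ^+ 2 - b * b').
  apply/eqP; rewrite -subr_eq0; apply/eqP.
  transitivity ((b ^+ 2 - 4 * a * c) - (b' ^+ 2 - 4 * a' * c')); first by ring.
  by rewrite e e' subrr.
by rewrite !dvdzE abszX /= Euclid_dvdX // andbT.
Qed.

Lemma coprimez_neq0 (a : int) : coprimez a 2 -> a != 0.
Proof. by apply: contraTneq => ->. Qed.

Lemma contains_united3 x y z : exists a1 a2 a3 b c,
  [/\ contains x (Bqf a1 b (a2 * a3 * c)), contains y (Bqf a2 b (a1 * a3 * c))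
    & contains z (Bqf a3 b (a1 * a2 * c))].
Proof.
have [a1 [b1 [c1 [xF co1]]]] := contains_coprime x (isT : 2 != 0 :> int).
have n1 := coprimez_neq0 co1.
have [|a2 [b2 [c2 [yG]]]] := contains_coprime y (_ : 2 * a1 != 0).
  by rewrite mulf_neq0.
rewrite coprimezMr => /andP[co2 co21]; have n2 := coprimez_neq0 co2.
have [|a3 [b3 [c3 [zH]]]] := contains_coprime z (_ : 2 * a1 * a2 != 0).
  by rewrite !mulf_neq0.
rewrite !coprimezMr => /andP[/andP[co3 co31] co32]; have n3 := coprimez_neq0 co3.
pose b12 := zchinese (2 * a1) a2 b1 b2.
pose b := zchinese (2 * a1 * a2) a3 b12 b3.
have co12' : coprimez (2 * a1) a2.
  by rewrite coprimez_sym coprimezMr co2 co21.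
have co123 : coprimez (2 * a1 * a2) a3.
  by rewrite coprimez_sym !coprimezMr co3 co31 co32.
have e12 : (2 * a1 * a2 %| b - b12)%Z.
  by rewrite -eqz_mod_dvd; apply/eqP; exact: zchinese_modl.
have e3 : (a3 %| b - b3)%Z.
  by rewrite -eqz_mod_dvd; apply/eqP; exact: zchinese_modr.
have e1 : (2 * a1 %| b - b1)%Z.
  rewrite -(subrKA b12); apply: dvdzD.
    by apply: dvdz_trans e12; apply: dvdz_mulr.
  by rewrite -eqz_mod_dvd; apply/eqP; exact: zchinese_modl.
have e2 : (a2 %| b - b2)%Z.
  rewrite -(subrKA b12); apply: dvdzD.
    by apply: dvdz_trans e12; apply: dvdz_mull.
  by rewrite -eqz_mod_dvd; apply/eqP; exact: zchinese_modr.
have two : (2 %| b - b1)%Z by apply: dvdz_trans e1; apply: dvdz_mulr.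
have e2' : (2 * a2 %| b - b2)%Z.
  rewrite Gauss_dvdz 1?coprimez_sym // e2 andbT -(subrKA b1).
  by apply: dvdzD => //; exact: contains_parity xF yG.
have e3' : (2 * a3 %| b - b3)%Z.
  rewrite Gauss_dvdz 1?coprimez_sym // e3 andbT -(subrKA b1).
  by apply: dvdzD => //; exact: contains_parity xF zH.
have [c1' xF'] := contains_shift xF e1.
have [c2' yG'] := contains_shift yG e2'.
have [c3' zH'] := contains_shift zH e3'.
have d1 := contains_disc xF'; have d2 := contains_disc yG'.
have d3 := contains_disc zH'.
have m12 : a1 * c1' = a2 * c2'.
  apply: (mulfI (_ : 4 != 0 :> int)) => //; rewrite !mulrA.
  by apply/oppr_inj/(addrI (b ^+ 2)); rewrite d1 d2.
have m13 : a1 * c1' = a3 * c3'.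
  apply: (mulfI (_ : 4 != 0 :> int)) => //; rewrite !mulrA.
  by apply/oppr_inj/(addrI (b ^+ 2)); rewrite d1 d3.
have : (a1 * a2 * a3 %| a1 * c1')%Z.
  rewrite !Gauss_dvdz ?coprimezMl.
  - by rewrite dvdz_mulr //= m12 dvdz_mulr //= -m12 m13 dvdz_mulr.
  - by rewrite coprimez_sym.
  - by rewrite !(coprimez_sym _ a3) co31.
move=> /dvdzP[c e].
exists a1, a2, a3, b, c; split.
- suff <- : c1' = a2 * a3 * c by [].
  by apply: (mulfI n1); rewrite e; ring.
- suff <- : c2' = a1 * a3 * c by [].
  by apply: (mulfI n2); rewrite -m12 e; ring.
- suff <- : c3' = a1 * a2 * c by [].
  by apply: (mulfI n3); rewrite -m13 e; ring.
Qed.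

Lemma class_mulA : associative class_mul.
Proof.
move=> x y z; have [a1 [a2 [a3 [b [c [xF yG zH]]]]]] := contains_united3 x y z.
apply: (@contains_inj _ _ (Bqf (a1 * a2 * a3) b c)).
  rewrite -mulrA; apply: class_mul_united => //.
  by apply: class_mul_united; rewrite ?(mulrCA a3) ?(mulrCA a2) ?mulrA.
apply: class_mul_united => //.
by apply: class_mul_united; rewrite ?mulrA.
Qed.

Lemma class_mulP x y : gauss_comp x y (class_mul x y).
Proof.
have [a1 [a2 [a3 [b [c [xF yG _]]]]]] := contains_united3 x y x.
have [||z _ xyz] := @gauss_comp_united x y a1 a2 b (a3 * c); rewrite ?mulrA //.
by rewrite (class_mulE xyz).
Qed.

Lemma class_mulC : commutative class_mul.
Proof.
move=> x y; have [a1 [a2 [a3 [b [c [xF yG _]]]]]] := contains_united3 x y x.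
apply: (@contains_inj _ _ (Bqf (a1 * a2) b (a3 * c))).
  by apply: class_mul_united; rewrite ?mulrA.
by rewrite mulrC; apply: class_mul_united; rewrite ?mulrA.
Qed.

End Composition.

Section ClassGroup.
Variable D : int.

(* H(4D), the class group of the forms (a, 2b, c) with b^2 - ac = D. *)
Definition class_group := form_class (4 * D).
HB.instance Definition _ := Choice.on class_group.

Lemma principal_in : bqf_in (4 * D) (Bqf 1 0 (- D)).
Proof.
apply/and3P; split; last by apply/implyP.
  by apply/eqP; rewrite /bqf_disc /=; ring.
by rewrite /bqf_primitive /gcdz /= gcd1n.
Qed.

Definition class_one : class_group := cls (QForm principal_in).

Lemma opposite_in (f : qform (4 * D)) :
  bqf_in (4 * D) (Bqf (qa f) (- qb f) (qc f)).
Proof.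
case: f => -[a b c] /= /and3P[/eqP disc prim pos]; apply/and3P; split=> //.
  by rewrite -disc; apply/eqP; rewrite /bqf_disc /=; ring.
by move: prim; rewrite /bqf_primitive /gcdz /= abszN.
Qed.

Definition class_inv (x : class_group) : class_group :=
  cls (QForm (opposite_in (repr x))).

Lemma contains_one b c : contains class_one (Bqf 1 (2 * b) c) <-> b ^+ 2 - c = D.
Proof.
split=> [/contains_disc e|e].
  by apply: (mulfI (_ : 4 != 0 :> int)) => //; rewrite -e; ring.
have := bqf_equiv_shift 1 0 (- D) b.
rewrite (_ : 0 + _ = 2 * b); last by ring.
rewrite (_ : _ + - D = c); last by rewrite -e; ring.
by move/contains_equiv; apply; exists (QForm principal_in).
Qed.

Lemma contains_even (x : class_group) a b c : contains x (Bqf a b c) ->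
  exists b', b = 2 * b'.
Proof.
have one1 : contains class_one (Bqf 1 (2 * 0) (- D)) by apply/contains_one; ring.
move=> /contains_parity/(_ one1)/dvdzP[k e]; exists k.
by move: e; rewrite mulr0 subr0 mulrC.
Qed.

Lemma class_mul1x : left_id class_one (@class_mul (4 * D)).
Proof.
move=> x; have [a [b0 [c [xF _]]]] := contains_coprime x (isT : 1 != 0 :> int).
have [b eb] := contains_even xF; rewrite eb in xF.
apply: (@contains_inj _ _ _ (Bqf a (2 * b) c)) => //.
rewrite -[a]mul1r; apply: class_mul_united; last by rewrite mul1r.
apply/contains_one; apply: (mulfI (_ : 4 != 0 :> int)) => //.
by rewrite -(contains_disc xF); ring.
Qed.

Lemma class_mulVx : left_inverse class_one class_inv (@class_mul (4 * D)).
Proof.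
move=> x; case E : (val (repr x)) => [a b0 c].
have xF : contains x (Bqf a b0 c) by exists (repr x) => //; exact: cls_repr.
have [b eb] := contains_even xF.
have vF : contains (class_inv x) (Bqf a (- b0) c).
  by exists (QForm (opposite_in (repr x))) => //=; rewrite [fval _]E.
have {}vF : contains (class_inv x) (Bqf c b0 a).
  apply: contains_equiv vF; exists 0, (-1), 1, 0; split=> [|y z]; first by ring.
  by rewrite /bqf_eval /=; ring.
have one_ac : contains (class_mul (class_inv x) x) (Bqf (c * a) b0 1).
  by apply: class_mul_united; rewrite mulr1.
apply: (@contains_inj _ _ _ (Bqf (c * a) b0 1)) => //.
apply: (@contains_equiv _ _ (Bqf 1 (- b0) (c * a))).
  exists 0, (-1), 1, 0; split=> [|y z]; first by ring.
  by rewrite /bqf_eval /=; ring.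
rewrite eb -mulrN; apply/contains_one; apply: (mulfI (_ : 4 != 0 :> int)) => //.
by rewrite -(contains_disc xF) eb; ring.
Qed.

Lemma class_mulx1 : right_id class_one (@class_mul (4 * D)).
Proof. by move=> x; rewrite class_mulC class_mul1x. Qed.

Lemma class_mulxV : right_inverse class_one class_inv (@class_mul (4 * D)).
Proof. by move=> x; rewrite class_mulC class_mulVx. Qed.

HB.instance Definition _ := isGroup.Build class_group
  (@class_mulA (4 * D)) class_mul1x class_mulx1 class_mulVx class_mulxV.

End ClassGroup.

Lemma class_group_mulE (D : int) (x y : class_group D) :
  (x * y)%g = class_mul x y.
Proof. by []. Qed.

(* Eis a b is a + b * omega. *)
Record eis := Eis { ea : int; eb : int }.

Definition eis_pair (x : eis) : int * int := (ea x, eb x).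
Definition pair_eis (t : int * int) : eis := Eis t.1 t.2.
Lemma eis_pairK : cancel eis_pair pair_eis. Proof. by case. Qed.
HB.instance Definition _ := Choice.copy eis (can_type eis_pairK).

Definition eis_add x y := Eis (ea x + ea y) (eb x + eb y).
Definition eis_opp x := Eis (- ea x) (- eb x).
Definition eis_mul x y :=
  Eis (ea x * ea y - eb x * eb y) (ea x * eb y + eb x * ea y - eb x * eb y).

Lemma eis_addA : associative eis_add.
Proof. by move=> x y z; congr Eis; apply: addrA. Qed.
Lemma eis_addC : commutative eis_add.
Proof. by move=> x y; congr Eis; apply: addrC. Qed.
Lemma eis_add0 : left_id (Eis 0 0) eis_add.
Proof. by case=> a b; rewrite /eis_add /= !add0r. Qed.
Lemma eis_addN : left_inverse (Eis 0 0) eis_opp eis_add.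
Proof. by case=> a b; rewrite /eis_add /= !addNr. Qed.
HB.instance Definition _ :=
  GRing.isZmodule.Build eis eis_addA eis_addC eis_add0 eis_addN.

Lemma eis_mulA : associative eis_mul.
Proof. by move=> x y z; congr Eis => /=; ring. Qed.
Lemma eis_mulC : commutative eis_mul.
Proof. by move=> x y; congr Eis => /=; ring. Qed.
Lemma eis_mul1 : left_id (Eis 1 0) eis_mul.
Proof. by case=> a b; congr Eis => /=; ring. Qed.
Lemma eis_mulD : left_distributive eis_mul eis_add.
Proof. by move=> x y z; congr Eis => /=; ring. Qed.
Lemma eis_1neq0 : Eis 1 0 != 0. Proof. by []. Qed.
HB.instance Definition _ := GRing.Zmodule_isComNzRing.Build eis
  eis_mulA eis_mulC eis_mul1 eis_mulD eis_1neq0.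

Definition omega : eis := Eis 0 1.

Lemma omega_root : omega ^+ 2 + omega + 1 = 0. Proof. by []. Qed.

Lemma eisE (x : eis) : x = (ea x)%:~R + (eb x)%:~R * omega.
Proof.
have nE (n : nat) : n%:R = Eis n 0 :> eis.
  elim: n => // n IH; rewrite -addn1 natrD IH.
  by congr Eis; rewrite //= -natz; lia.
have zE (m : int) : m%:~R = Eis m 0 :> eis.
  case: m => n; first exact: nE.
  by rewrite NegzE mulrNz -pmulrn nE; congr Eis.
by case: x => a b; rewrite !zE; congr Eis => /=; ring.
Qed.

Definition eis_norm (x : eis) : int := ea x ^+ 2 - ea x * eb x + eb x ^+ 2.

Definition eis_dvd (x y : eis) : Prop := exists z, y = z * x.
Definition eis_eqmod (p x y : eis) : Prop := eis_dvd p (x - y).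
Definition eis_unit (x : eis) : Prop := exists y, x * y = 1.

Definition eis_prime (p : eis) : Prop :=
  [/\ p <> 0, ~ eis_unit p
    & forall x y, eis_dvd p (x * y) -> eis_dvd p x \/ eis_dvd p y].

Definition eis_primary (x : eis) : Prop :=
  (ea x = 2 %[mod 3])%Z /\ (3 %| eb x)%Z.

(* For a primary prime p not dividing x, N(p) - 1 is a multiple of 3 and exactly
   one i < 3 satisfies the congruence: the branch None is then not reached. *)
Definition cubic_residue_symbol (x p : eis) : eis :=
  if `[< eis_dvd p x >] then 0 else
  if [pick i : 'I_3 |
        `[< eis_eqmod p (x ^+ ((`|eis_norm p|%N - 1) %/ 3)) (omega ^+ i) >]]
  is Some i then omega ^+ i else 0.

Definition primary_factorization (y : eis) (s : seq eis) : Prop :=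
  (forall p, p \in s -> eis_prime p /\ eis_primary p) /\
  (y = \prod_(p <- s) p \/ y = - \prod_(p <- s) p).

(* The factorization is unique up to order when y = a + b * omega with a prime
   to 3 and b divisible by 3; it is empty when y is 1 or -1. *)
Definition cubic_jacobi (x y : eis) : eis :=
  \prod_(p <- xget [::] [set s | primary_factorization y s])
    cubic_residue_symbol x p.

Definition omegaC : algC := (-1 + sqrtC (-3)) / 2.
Definition eisC (x : eis) : algC := (ea x)%:~R + (eb x)%:~R * omegaC.

Definition chi_symbol (P a b : int) : eis :=
  cubic_jacobi (P%:~R - 3 * b%:~R * (1 + 2 * omega)) a%:~R.

Definition chi_formula (P D Q : int) (chi : class_group D -> algC) : Prop :=
  forall (x : class_group D) (a b c : int), contains x (Bqf a (2 * b) c) ->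
    gcdz a (3 * D * Q) = 1 -> chi x = eisC (chi_symbol P a b).

Arguments chi_formula : clear implicits.

Definition group_character (gT : groupType) (chi : gT -> algC) : Prop :=
  chi 1%g = 1 /\ forall x y : gT, chi (x * y)%g = chi x * chi y.

Definition G_set (P D Q : int) : set (class_group D) :=
  [set x | exists a b c : int, [/\ contains x (Bqf a (2 * b) c),
     gcdz a (3 * D * Q) = 1 & chi_symbol P a b = 1]].

Arguments G_set : clear implicits.

Definition left_coset (gT : groupType) (A : set gT) (x : gT) : set gT :=
  [set (x * y)%g | y in A].

Definition has_index (gT : groupType) (A : set gT) (n : nat) : Prop :=
  (range (left_coset A) #= `I_n)%card.

(* Main.v *)
Require Import Defs.
From HB Require Import structures.
From mathcomp Require Import all_boot all_order all_algebra algC closed_field finfield.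
From mathcomp Require Import boolp classical_sets functions cardinality.
From mathcomp Require Import ring zify.

Set Implicit Arguments.
Unset Strict Implicit.
Unset Printing Implicit Defensive.

Import Order.TTheory GRing.Theory Num.Theory.
Local Open Scope ring_scope.

(** Let theta = sqrt(-3) = 1 + 2 omega. The top argument P - 3 b theta attached
    to a form (a, 2b, c) with b^2 - a c = D has norm P^2 + 27 b^2, which is
    Q + 27 a c; so it is prime to a, and the symbol is a cube root of unity.

    Well-definedness. Let a' = a p^2 + 2 b p r + c r^2 be the first coefficient
    of an equivalent form (a', 2b', c'), and put u = a p + b r. Then
    a a' = u^2 - D r^2 =: n, while r (P - 3 b theta) is congruent to
    beta = P r - 3 u theta modulo a and r (P - 3 b' theta) to the conjugate of
    beta modulo a'. The symbol of two coprime rational integers is 1, and over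
    a rational integer conjugating the top argument inverts the symbol. So the
    two values agree as soon as (beta / n) = 1. Now beta has norm
    Q r^2 + 27 n; cubic reciprocity turns (beta / n) into (n / beta), which is
    (Q r^2 / beta) because 27 is a cube, hence (2 / beta)^q1 (r / beta)^2
    because Q = 2^q1 q0^3. Reciprocity again makes these (beta / 2)^q1 and
    (beta / r)^2, and both are 1: beta is a rational integer modulo 2 and
    a rational multiple of theta modulo r. In general beta is only
    theta^k omega^j times an element to which reciprocity applies. The factor
    theta is harmless, as the square of its symbol is that of -3; the powers of
    omega cancel by a congruence modulo 9 that the condition on P provides when
    3 does not divide r (cubic_jacobi_norm_value, chi_symbol_transition). If 3
    divides r, one passes through a third form (chi_symbol_class).

    Reciprocity is only used between a rational integer and an element
    congruent to 1 or -1 modulo 3 (cubic_reciprocity). For a prime pi of prime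
    norm p, the cube of the cubic Gauss sum over F_p is p pi; raising that sum
    to the power N(lambda) in a field where the prime lambda vanishes gives
    (p pi / lambda) (N(lambda) / pi) = 1 (cubic_reciprocity_gauss), and
    collecting the primes lambda over a rational prime q gives
    (q / pi) = (pi / q).

    Multiplicativity is read off two forms (a1, 2b, a2 c) and (a2, 2b, a1 c),
    whose composite is (a1 a2, 2b, c). The set G(P, D) is the kernel, so its
    index is 3 once some value differs from 1.

    Index. The cubic D x^3 - Q x - 2 Q has discriminant D (2 P Q)^2. If it has
    no root modulo p0, Frobenius permutes its roots cyclically and fixes the
    square root of the discriminant, so that D = b^2 modulo p0
    (square_of_no_root) and there is a form (p0, 2b, c). If the character were 1
    at this form, Cardano's formula would produce a root modulo p0
    (cubic_root_of_symbol). *)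

(** * Arithmetic of the Eisenstein integers *)

Lemma eis_ext (x y : eis) : ea x = ea y -> eb x = eb y -> x = y.
Proof. by case: x y => [a b] [c d] /= -> ->. Qed.

Lemma eis_intr (m : int) : m%:~R = Eis m 0.
Proof.
have nE (n : nat) : n%:R = Eis n 0 :> eis.
  elim: n => // n IH; rewrite -addn1 natrD IH.
  by congr Eis; rewrite //= -natz; lia.
case: m => n; first exact: nE.
by rewrite NegzE mulrNz -pmulrn nE; congr Eis.
Qed.

Lemma ea0 : ea 0 = 0. Proof. by []. Qed.
Lemma eb0 : eb 0 = 0. Proof. by []. Qed.
Lemma ea1 : ea 1 = 1. Proof. by []. Qed.
Lemma eb1 : eb 1 = 0. Proof. by []. Qed.
Lemma eaD x y : ea (x + y) = ea x + ea y. Proof. by []. Qed.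
Lemma ebD x y : eb (x + y) = eb x + eb y. Proof. by []. Qed.
Lemma eaN x : ea (- x) = - ea x. Proof. by []. Qed.
Lemma ebN x : eb (- x) = - eb x. Proof. by []. Qed.
Lemma eaM x y : ea (x * y) = ea x * ea y - eb x * eb y. Proof. by []. Qed.
Lemma ebM x y : eb (x * y) = ea x * eb y + eb x * ea y - eb x * eb y.
Proof. by []. Qed.
Lemma ea_int m : ea m%:~R = m. Proof. by rewrite eis_intr. Qed.
Lemma eb_int m : eb m%:~R = 0. Proof. by rewrite eis_intr. Qed.
Lemma ea_nat (n : nat) : ea n%:R = n. Proof. by rewrite pmulrn ea_int. Qed.
Lemma eb_nat (n : nat) : eb n%:R = 0. Proof. by rewrite pmulrn eb_int. Qed.
Lemma ea_omega : ea omega = 0. Proof. by []. Qed.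
Lemma eb_omega : eb omega = 1. Proof. by []. Qed.
Definition eisS := (ea_int, eb_int, ea_nat, eb_nat, ea_omega, eb_omega,
  ea1, eb1, ea0, eb0, eaD, ebD, eaN, ebN, eaM, ebM).

Lemma omega3 : omega ^+ 3 = 1. Proof. by []. Qed.

Lemma omegaX_mod (n m : nat) : n = m %[mod 3] -> omega ^+ n = omega ^+ m.
Proof.
move=> e; rewrite (divn_eq n 3) (divn_eq m 3) !exprD ![(_ * 3)%N]mulnC.
by rewrite !exprM omega3 !expr1n e.
Qed.

Definition sqrtm3 : eis := 1 + 2 * omega.

Lemma sqrtm3_sqr : sqrtm3 ^+ 2 = -3. Proof. by []. Qed.

Definition eis_conj (x : eis) : eis := Eis (ea x - eb x) (- eb x).

Lemma eis_conj_zmod : zmod_morphism eis_conj.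
Proof. by move=> x y; apply: eis_ext; rewrite /= ?eisS; ring. Qed.
Lemma eis_conj_monoid : monoid_morphism eis_conj.
Proof. by split=> // x y; apply: eis_ext; rewrite /= ?eisS; ring. Qed.
HB.instance Definition _ := GRing.isZmodMorphism.Build eis eis eis_conj eis_conj_zmod.
HB.instance Definition _ :=
  GRing.isMonoidMorphism.Build eis eis eis_conj eis_conj_monoid.

Lemma eis_conjK : involutive eis_conj.
Proof. by move=> x; apply: eis_ext => /=; ring. Qed.

Lemma eis_conj_sqrtm3 : eis_conj sqrtm3 = - sqrtm3. Proof. by []. Qed.

Lemma eis_norm_conj x : x * eis_conj x = (eis_norm x)%:~R.
Proof. by rewrite eis_intr /eis_norm; apply: eis_ext; rewrite !eisS /=; ring. Qed.

Lemma eis_normM x y : eis_norm (x * y) = eis_norm x * eis_norm y.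
Proof. by rewrite /eis_norm !eisS; ring. Qed.

Lemma eis_normJ x : eis_norm (eis_conj x) = eis_norm x.
Proof. by rewrite /eis_norm /=; ring. Qed.

Lemma eis_norm_int m : eis_norm m%:~R = m ^+ 2.
Proof. by rewrite /eis_norm eis_intr /=; ring. Qed.

Lemma eis_norm4 x : 4 * eis_norm x = (2 * ea x - eb x) ^+ 2 + 3 * eb x ^+ 2.
Proof. by rewrite /eis_norm; ring. Qed.

Lemma eis_norm_ge0 x : 0 <= eis_norm x.
Proof.
have := sqr_ge0 (2 * ea x - eb x); have := sqr_ge0 (eb x).
have := eis_norm4 x; lia.
Qed.

Lemma eis_norm_eq0 x : (eis_norm x == 0) = (x == 0).
Proof.
apply/eqP/eqP => [e|->//].
have := eis_norm4 x; rewrite e => e4.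
have h1 := sqr_ge0 (2 * ea x - eb x); have h2 := sqr_ge0 (eb x).
have /eqP : eb x ^+ 2 = 0 by lia.
have /eqP : (2 * ea x - eb x) ^+ 2 = 0 by lia.
by rewrite !sqrf_eq0 => /eqP e1 /eqP e2; apply: eis_ext; rewrite !eisS; lia.
Qed.

Lemma eis_norm_gt0 x : (0 < eis_norm x) = (x != 0).
Proof. by rewrite lt_neqAle eis_norm_ge0 andbT eq_sym eis_norm_eq0. Qed.

Definition eis_unitb : pred eis := fun x => eis_norm x == 1.
Definition eis_inv (x : eis) : eis := if eis_unitb x then eis_conj x else x.

Lemma eis_mulVx : {in eis_unitb, left_inverse 1 eis_inv *%R}.
Proof.
move=> x; rewrite /in_mem /= => ux; rewrite /eis_inv ux mulrC eis_norm_conj.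
by rewrite (eqP ux).
Qed.

Lemma eis_unitPl x y : y * x = 1 -> eis_unitb x.
Proof.
move/(congr1 eis_norm); rewrite eis_normM (_ : eis_norm 1 = 1) // => e.
have := eis_norm_ge0 x; have := eis_norm_ge0 y.
rewrite /eis_unitb; move: (eis_norm x) (eis_norm y) e => a b e b0 a0.
apply/eqP; have [|[|]] : a = 0 \/ a = 1 \/ 2 <= a by lia.
- by move=> a1; move: e; rewrite a1 mulr0.
- by [].
- move=> a2; have a2' : 0 <= a - 2 by lia.
  by have := mulr_ge0 b0 a2'; rewrite mulrBr e; lia.
Qed.

Lemma eis_inv_out : {in [predC eis_unitb], eis_inv =1 id}.
Proof. by move=> x; rewrite /in_mem /= /in_mem /= /eis_inv => /negbTE->. Qed.

HB.instance Definition _ := GRing.ComNzRing_hasMulInverse.Build eis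
  eis_mulVx eis_unitPl eis_inv_out.

Lemma eis_idomain : GRing.integral_domain_axiom eis.
Proof.
move=> x y /eqP; rewrite -eis_norm_eq0 eis_normM mulf_eq0.
by rewrite !eis_norm_eq0.
Qed.
HB.instance Definition _ := GRing.ComUnitRing_isIntegral.Build eis eis_idomain.

Lemma eis_unitE x : eis_unit x <-> eis_norm x = 1.
Proof.
split=> [[y xy]|/eqP nx]; last by exists (eis_conj x); rewrite eis_norm_conj (eqP nx).
by apply/eqP/(@eis_unitPl _ y); rewrite mulrC.
Qed.

Lemma eis_dvd_refl x : eis_dvd x x. Proof. by exists 1; rewrite mul1r. Qed.
Lemma eis_dvd_trans y x z : eis_dvd x y -> eis_dvd y z -> eis_dvd x z.
Proof. by move=> [u ->] [v ->]; exists (v * u); rewrite mulrA. Qed.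
Lemma eis_dvdMl x y z : eis_dvd x z -> eis_dvd x (y * z).
Proof. by move=> [u ->]; exists (y * u); rewrite mulrA. Qed.
Lemma eis_dvdMr x y z : eis_dvd x y -> eis_dvd x (y * z).
Proof. by rewrite mulrC; apply: eis_dvdMl. Qed.
Lemma eis_dvdD x y z : eis_dvd x y -> eis_dvd x z -> eis_dvd x (y + z).
Proof. by move=> [u ->] [v ->]; exists (u + v); rewrite mulrDl. Qed.
Lemma eis_dvdN x y : eis_dvd x y -> eis_dvd x (- y).
Proof. by move=> [u ->]; exists (- u); rewrite mulNr. Qed.
Lemma eis_dvd0 x : eis_dvd x 0. Proof. by exists 0; rewrite mul0r. Qed.
Lemma eis_dvd_norm x : eis_dvd x (eis_norm x)%:~R.
Proof. by exists (eis_conj x); rewrite mulrC eis_norm_conj. Qed.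
Lemma eis_dvd_conj x y : eis_dvd x y -> eis_dvd (eis_conj x) (eis_conj y).
Proof. by move=> [z ->]; exists (eis_conj z); rewrite rmorphM. Qed.

Lemma eis_dvd_int (m n : int) : eis_dvd m%:~R n%:~R <-> (m %| n)%Z.
Proof.
split=> [[z]|/dvdzP[k ->]]; last by exists k%:~R; rewrite -intrM.
move/(congr1 ea); rewrite !eisS mulr0 subr0 => ->.
by rewrite dvdz_mull.
Qed.

(** Rounding both coordinates of x / y to the nearest integer leaves an error
    of norm at most 3/4. *)
Lemma eis_euclid x y : y != 0 -> exists q, eis_norm (x - q * y) < eis_norm y.
Proof.
rewrite -eis_norm_gt0; set n := eis_norm y => n0.
have near (A : int) : exists q, - n <= 2 * (A - n * q) <= n.
  exists ((2 * A + n) %/ (2 * n))%Z.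
  have e := divz_eq (2 * A + n) (2 * n); have n2 : 0 < 2 * n by lia.
  have l := ltz_pmod (2 * A + n) n2.
  have g := modz_ge0 (2 * A + n) (lt0r_neq0 n2).
  move: (_ %/ _)%Z (_ %% _)%Z e l g => q r e l g.
  rewrite mulrBr (_ : 2 * A = q * (2 * n) + r - n); last by rewrite -e; ring.
  rewrite (_ : _ - _ = r - n); last by ring.
  lia.
have [qa hqa] := near (ea (x * eis_conj y)).
have [qb hqb] := near (eb (x * eis_conj y)).
exists (Eis qa qb); rewrite -(ltr_pM2r n0) -[X in _ * X]eis_normJ -eis_normM.
rewrite mulrBl -mulrA eis_norm_conj -/n; set z := x * _ in hqa hqb *.
have -> : z - Eis qa qb * n%:~R = Eis (ea z - n * qa) (eb z - n * qb).
  by apply: eis_ext; rewrite !eisS /=; ring.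
rewrite /eis_norm /=; move: (_ - _) (_ - _) hqa hqb => r s hr hs.
have r2 : 0 <= (n - 2 * r) * (n + 2 * r) by apply: mulr_ge0; lia.
have s2 : 0 <= (n - 2 * s) * (n + 2 * s) by apply: mulr_ge0; lia.
have := sqr_ge0 (r + s); rewrite !expr2 in r2 s2 *; nia.
Qed.

Lemma ltn_descent (a b : int) (n : nat) :
  0 <= a -> a < b -> (`|b| < n.+1)%N -> (`|a| < n)%N.
Proof. lia. Qed.

Lemma eis_bezout x y : exists g u v,
  [/\ g = u * x + v * y, eis_dvd g x & eis_dvd g y].
Proof.
have [n] := ubnP `|eis_norm y|%N; elim: n x y => // n IH x y hn.
have [->|y0] := eqVneq y 0.
  by exists x, 1, 0; split; [ring|exact: eis_dvd_refl|exact: eis_dvd0].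
have [q hq] := eis_euclid x y0.
have [|g [u [v [e gy gr]]]] := IH y (x - q * y).
  by apply: ltn_descent hn; rewrite ?eis_norm_ge0.
exists g, v, (u - v * q); split=> //; first by rewrite e; ring.
by rewrite -[x](subrK (q * y)); apply: eis_dvdD => //; apply: eis_dvdMl.
Qed.

Definition eis_coprime (x y : eis) : Prop := exists u v, u * x + v * y = 1.

Lemma eis_coprime_sym x y : eis_coprime x y -> eis_coprime y x.
Proof. by move=> [u [v e]]; exists v, u; rewrite addrC. Qed.

Lemma eis_coprimeMr x y z :
  eis_coprime x y -> eis_coprime x z -> eis_coprime x (y * z).
Proof.
move=> [u [v e]] [s [t f]].
exists (u * s * x + u * t * z + v * y * s), (v * t).
by rewrite -[RHS]mulr1 -{1}e -f; ring.
Qed.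

Lemma eis_coprime_dvdr x y z : eis_dvd z y -> eis_coprime x y -> eis_coprime x z.
Proof. by move=> [w ->] [u [v e]]; exists u, (v * w); rewrite -e; ring. Qed.

Lemma eis_coprime_dvdl x y z : eis_dvd z x -> eis_coprime x y -> eis_coprime z y.
Proof. by move=> h /eis_coprime_sym/(eis_coprime_dvdr h)/eis_coprime_sym. Qed.

Lemma eis_coprimeX x y n : eis_coprime x y -> eis_coprime x (y ^+ n).
Proof.
move=> h; elim: n => [|n IH]; first by exists 0, 1; rewrite expr0; ring.
by rewrite exprS; apply: eis_coprimeMr.
Qed.

Lemma eis_coprime_mod x y z :
  eis_dvd x (y - z) -> eis_coprime x y -> eis_coprime x z.
Proof.
move=> [w e] [u [v f]]; exists (u + v * w), v; rewrite -f.
by rewrite -[y](subrK z) e; ring.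
Qed.

Lemma eis_coprimeN x y : eis_coprime x y -> eis_coprime x (- y).
Proof. by move=> [u [v e]]; exists u, (- v); rewrite mulrNN. Qed.

Lemma eis_coprime_int (m n : int) : coprimez m n -> eis_coprime m%:~R n%:~R.
Proof.
by move=> /coprimezP[[u v] /= e]; exists u%:~R, v%:~R; rewrite -!intrM -intrD e.
Qed.

Lemma eis_prime_neq0 p : eis_prime p -> p != 0.
Proof. by case=> /eqP. Qed.

Lemma eis_prime_coprime p x : eis_prime p -> ~ eis_dvd p x -> eis_coprime p x.
Proof.
move=> [p0 pu pM] px; have [g [u [v [e [w pg] [z xg]]]]] := eis_bezout p x.
have /pM[pw|[t gt]] : eis_dvd p (w * g) by rewrite -pg; apply: eis_dvd_refl.
  suff [h gh] : eis_unit g.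
    by exists (u * h), (v * h); rewrite -gh e; ring.
  case: pw => t wt; exists t; apply: (mulfI (introN eqP p0)).
  by rewrite mulr1 [in RHS]pg wt; ring.
by case: px; rewrite xg gt; apply: eis_dvdMl; apply: eis_dvdMl; apply: eis_dvd_refl.
Qed.

Lemma eis_coprime_ndvd p x : eis_prime p -> eis_coprime p x -> ~ eis_dvd p x.
Proof.
move=> [_ pu _] [u [v e]] [w xw]; apply: pu; exists (u + v * w).
by rewrite -e xw; ring.
Qed.

Lemma eis_prime_divisor x : x != 0 -> ~ eis_unit x ->
  exists2 p, eis_prime p & eis_dvd p x.
Proof.
have [n] := ubnP `|eis_norm x|%N; elim: n x => // n IH x hn x0 xu.
case: (pselect (exists y z, [/\ x = y * z, ~ eis_unit y & ~ eis_unit z])).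
  move=> [y [z [e yu zu]]].
  have [y0 z0] : y != 0 /\ z != 0.
    by move: x0; rewrite e mulf_eq0 negb_or => /andP.
  have [||//|p pp py] := IH y => //.
    move: hn yu zu; rewrite e eis_normM !eis_unitE abszM.
    by rewrite -eis_norm_gt0 in y0; rewrite -eis_norm_gt0 in z0; nia.
  by exists p => //; rewrite e; apply: eis_dvdMr.
move=> irr; exists x; last exact: eis_dvd_refl.
split=> // [|y z xyz]; first exact/eqP.
have [g [u [v [e [w xg] gy]]]] := eis_bezout x y.
have [[h gh]|gu] := pselect (eis_unit g).
  right; have -> : z = h * (u * z * x + v * (y * z)).
    by rewrite -[LHS]mul1r -gh e; ring.
  by apply/eis_dvdMl/eis_dvdD; apply: eis_dvdMl => //; exact: eis_dvd_refl.
have [[h wh]|wu] := pselect (eis_unit w); last by case: irr; exists w, g.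
left; apply: eis_dvd_trans gy; exists h.
by rewrite xg mulrA [h * w]mulrC wh mul1r.
Qed.

(** * Factorization into primary primes *)

(** Congruence to 1 or -1 modulo 3. These are the elements, primary up to sign,
    that occur as bottom arguments of the cubic Jacobi symbol. *)
Definition eis_pm1 (y : eis) : bool := ~~ (3 %| ea y)%Z && (3 %| eb y)%Z.

Lemma eis_pm1M x y : eis_pm1 x -> eis_pm1 (x * y) = eis_pm1 y.
Proof.
move=> /andP[xa xb]; rewrite /eis_pm1 !eisS.
have M (a b : int) : ~~ (3 %| a)%Z -> (3 %| a * b)%Z = (3 %| b)%Z.
  by move=> ha; rewrite Gauss_dvdzr // coprimezE /= prime_coprime.
have -> : (3 %| ea x * ea y - eb x * eb y)%Z = (3 %| ea y)%Z.
  by rewrite dvdz_addr ?M // rpredN dvdz_mulr.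
have -> // : (3 %| ea x * eb y + eb x * ea y - eb x * eb y)%Z = (3 %| eb y)%Z.
by rewrite -addrA dvdz_addr ?M // rpredB // dvdz_mulr.
Qed.

Lemma eis_pm1N x : eis_pm1 (- x) = eis_pm1 x.
Proof. by rewrite /eis_pm1 !eisS !rpredN. Qed.

Lemma eis_pm1J x : eis_pm1 (eis_conj x) = eis_pm1 x.
Proof.
rewrite /eis_pm1 /= rpredN; have [h|] := boolP (3 %| eb x)%Z; last by rewrite !andbF.
by rewrite dvdz_addr ?rpredN.
Qed.

Lemma eis_pm1_int (m : int) : eis_pm1 m%:~R = ~~ (3 %| m)%Z.
Proof. by rewrite /eis_pm1 !eisS dvdz0 andbT. Qed.

Lemma eis_pm1_neq0 x : eis_pm1 x -> x != 0.
Proof. by apply: contraTneq => ->. Qed.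

Lemma eis_primary_pm1 p : eis_primary p -> eis_pm1 p.
Proof. by move=> [pa pb]; rewrite /eis_pm1 pb andbT; lia. Qed.

Lemma eis_pm1_primary x : eis_pm1 x -> eis_primary x \/ eis_primary (- x).
Proof. by rewrite /eis_pm1 /eis_primary !eisS => /andP[]; lia. Qed.

Lemma eis_primaryJ x : eis_primary x -> eis_primary (eis_conj x).
Proof. by rewrite /eis_primary /=; lia. Qed.

Lemma eis_norm3 x : (3 %| eis_norm x)%Z = (3 %| ea x + eb x)%Z.
Proof.
have -> : eis_norm x = (ea x + eb x) ^+ 2 + 3 * - (ea x * eb x).
  by rewrite /eis_norm; ring.
have d3 : (3 %| 3 * - (ea x * eb x))%Z by apply: dvdz_mulr.
by rewrite (dvdz_addr _ d3) !dvdzE abszX Euclid_dvdX // andbT.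
Qed.

Lemma eis_norm1mod3 x : ~~ (3 %| eis_norm x)%Z -> exists k : nat,
  eis_norm x = (3 * k + 1)%N.
Proof.
have := eis_norm_ge0 x; rewrite eis_norm3 => n0 s3.
have [k sk] : exists k, ea x + eb x = 3 * k + 1 \/ ea x + eb x = 3 * k - 1.
  exists ((ea x + eb x + 1) %/ 3)%Z; lia.
have [j ej] : exists j, eis_norm x = 3 * j + 1.
  exists (3 * k ^+ 2 + (if ea x + eb x == 3 * k + 1 then 2 else - 2) * k
          - ea x * eb x).
  have -> : eis_norm x = (ea x + eb x) ^+ 2 - 3 * (ea x * eb x).
    by rewrite /eis_norm; ring.
  case: sk => ->; [rewrite eqxx|rewrite (_ : _ == _ = false); last by lia]; ring.
exists `|j|%N; lia.
Qed.

Lemma eis_norm_pm1 x : eis_pm1 x -> ~~ (3 %| eis_norm x)%Z.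
Proof. by move=> /andP[xa xb]; rewrite eis_norm3 dvdz_addr. Qed.

Lemma eis_unit_norm_pm1 i : eis_norm (omega ^+ i) = 1.
Proof. by elim: i => // i IH; rewrite exprS eis_normM IH. Qed.

(** Modulo 3 the six units represent all classes prime to 3. *)
Lemma eis_pm1_associate x : ~~ (3 %| eis_norm x)%Z ->
  exists i, eis_pm1 (omega ^+ i * x).
Proof.
rewrite eis_norm3 => s3; have [b0|b0] := boolP (3 %| eb x)%Z.
  by exists 0%N; rewrite mul1r /eis_pm1 b0 andbT; lia.
have [a0|a0] := boolP (3 %| ea x)%Z.
  by exists 2%N; rewrite /eis_pm1 expr2 ?eisS /= ?eisS; lia.
by exists 1%N; rewrite /eis_pm1 expr1 ?eisS /= ?eisS; lia.
Qed.

(** The prime sqrt(-3) over 3 is stripped off first; a unit then makes the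
    remaining factor congruent to 1 or -1 modulo 3. *)
Lemma eis_decompose z : z != 0 ->
  exists k j d, eis_pm1 d /\ z = sqrtm3 ^+ k * omega ^+ j * d.
Proof.
have [n] := ubnP `|eis_norm z|%N; elim: n z => // n IH z hn z0.
have [n3|n3] := boolP (3 %| eis_norm z)%Z; last first.
  have [i hi] := eis_pm1_associate n3.
  exists 0%N, (2 * i)%N, (omega ^+ i * z); split=> //.
  by rewrite expr0 mul1r mulrA -exprD -mulSnr exprM omega3 expr1n mul1r.
have [y zy] : exists y, z = sqrtm3 * y.
  move: n3; rewrite eis_norm3 => n3.
  exists (Eis ((2 * eb z - ea z) %/ 3)%Z ((eb z - 2 * ea z) %/ 3)%Z).
  by apply: eis_ext; rewrite /sqrtm3 ?eisS /= ?eisS; lia.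
have y0 : y != 0 by apply: contra_neq z0; rewrite zy => ->; rewrite mulr0.
have [|//|k [j [d [hd yd]]]] := IH y.
  move: hn; rewrite zy eis_normM (_ : eis_norm sqrtm3 = 3) //.
  by rewrite -eis_norm_gt0 in y0; lia.
by exists k.+1, j, d; split=> //; rewrite exprS zy yd !mulrA.
Qed.

Lemma eis_unit_pm1 e : eis_unit e -> eis_pm1 e -> e = 1 \/ e = -1.
Proof.
rewrite eis_unitE => ne /andP[ea3 eb3]; have := eis_norm4 e; rewrite ne => e4.
have [b0|b0] := eqVneq (eb e) 0.
  have [h|h] : ea e = 1 \/ ea e = -1 by move: e4; rewrite b0; nia.
    by left; apply: eis_ext; rewrite ?eisS.
  by right; apply: eis_ext; rewrite ?eisS.
have := sqr_ge0 (2 * ea e - eb e); move: eb3 => /dvdzP[c ec].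
have : 9 <= eb e ^+ 2 by rewrite ec; rewrite ec in b0; nia.
lia.
Qed.

(** Associate primary primes differ by a unit that is 1 or -1 modulo 3, hence
    by a sign, and -1 times a primary element is not primary. *)
Lemma eis_primary_assoc p r : eis_primary p -> eis_primary r ->
  eis_prime r -> ~ eis_unit p -> eis_dvd p r -> p = r.
Proof.
move=> hp hr rr pu [e rep].
have eu : eis_unit e.
  have [_ _] := rr => /(_ e p); rewrite -rep => /(_ (eis_dvd_refl _)).
  case=> [[w ew]|[w pw]]; last first.
    exists w; apply: (mulfI (eis_pm1_neq0 (eis_primary_pm1 hp))).
    by rewrite mulr1 [RHS]pw rep; ring.
  case: pu; exists w; apply: (mulfI (eis_prime_neq0 rr)).
  by rewrite mulr1 [in RHS]rep ew; ring.
have epm : eis_pm1 e.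
  by rewrite -(eis_pm1M _ (eis_primary_pm1 hp)) mulrC -rep; apply: eis_primary_pm1.
have [e1|e1] := eis_unit_pm1 eu epm; first by rewrite rep e1 mul1r.
move: hp hr; rewrite rep e1 /eis_primary ?eisS; lia.
Qed.

Lemma eis_prime_dvd_prod p (s : seq eis) : eis_prime p ->
  eis_dvd p (\prod_(x <- s) x) -> exists2 x, x \in s & eis_dvd p x.
Proof.
move=> pp; elim: s => [|x s IH].
  by rewrite big_nil => -[w e]; case: pp => _ [] //; exists w; rewrite mulrC.
rewrite big_cons => h; have [_ _ /(_ _ _ h)] := pp.
case=> [px|/IH[y ys py]]; first by exists x; rewrite ?mem_head.
by exists y; rewrite // in_cons ys orbT.
Qed.

Lemma primary_factorizationM y z s t : primary_factorization y s ->
  primary_factorization z t -> primary_factorization (y * z) (s ++ t).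
Proof.
move=> [sp ys] [tp zt]; split=> [p|].
  by rewrite mem_cat => /orP[/sp|/tp].
rewrite big_cat /=.
case: ys zt => -> [] ->; rewrite ?mulrNN ?mulrN ?mulNr; tauto.
Qed.

Lemma primary_factorizationN y s :
  primary_factorization y s -> primary_factorization (- y) s.
Proof. by move=> [sp [] ->]; split; rewrite ?opprK //; [right|left]. Qed.

Lemma primary_factorization1 : primary_factorization 1 [::].
Proof. by split=> //; rewrite big_nil; left. Qed.

Lemma primary_factorization_prime p : eis_prime p -> eis_primary p ->
  primary_factorization p [:: p].
Proof.
by move=> pp p2; split; [move=> r; rewrite inE => /eqP->|left; rewrite big_seq1].
Qed.

Lemma eis_primeN p : eis_prime p -> eis_prime (- p).
Proof.
move=> [p0 pu pM]; split.
- by move=> /eqP; rewrite oppr_eq0 => /eqP.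
- by move=> [w e]; apply: pu; exists (- w); rewrite mulrN -mulNr.
have dN x : eis_dvd (- p) x <-> eis_dvd p x.
  by split=> -[w ->]; exists (- w); rewrite ?mulrNN ?mulrN ?mulNr.
by move=> x y; rewrite !dN; apply: pM.
Qed.

Lemma eis_primeJ p : eis_prime p -> eis_prime (eis_conj p).
Proof.
move=> [p0 pu pM]; split.
- by move=> /(congr1 eis_conj); rewrite eis_conjK rmorph0.
- by rewrite !eis_unitE eis_normJ in pu *.
move=> x y /eis_dvd_conj; rewrite eis_conjK rmorphM => /pM.
by case=> /eis_dvd_conj; rewrite eis_conjK; [left|right].
Qed.

Lemma eis_pm1_factor y : eis_pm1 y -> exists s, primary_factorization y s.
Proof.
have [n] := ubnP `|eis_norm y|%N; elim: n y => // n IH y hn y3.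
have [yu|yu] := pselect (eis_unit y).
  have [->|->] := eis_unit_pm1 yu y3; exists [::]; first exact: primary_factorization1.
  exact/primary_factorizationN/primary_factorization1.
have [p0 pp0 py0] := eis_prime_divisor (eis_pm1_neq0 y3) yu.
have [p [pp p2 [z yz]]] : exists p, [/\ eis_prime p, eis_primary p & eis_dvd p y].
  have n3 : ~~ (3 %| eis_norm p0)%Z.
    case: py0 => w yw; apply: contra (eis_norm_pm1 y3).
    by rewrite yw eis_normM; apply: dvdz_mull.
  have [i hi] := eis_pm1_associate n3; set e := omega ^+ i in hi.
  have eK : omega ^+ (2 * i) * e = 1.
    by rewrite /e -exprD -mulSnr exprM omega3 expr1n.
  have pe : eis_prime (e * p0).
    have [p00 pu pM] := pp0; split.
    - by move=> h; apply: p00; rewrite -[p0]mul1r -eK -mulrA h mulr0.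
    - by rewrite !eis_unitE eis_normM eis_unit_norm_pm1 mul1r in pu *.
    have dE x : eis_dvd (e * p0) x <-> eis_dvd p0 x.
      split=> [[w ->]|[w ->]]; first by exists (w * e); rewrite mulrA.
      exists (w * omega ^+ (2 * i)); rewrite mulrA -[_ * _ * e]mulrA eK; ring.
    by move=> a b; rewrite !dE; apply: pM.
  have pey : eis_dvd (e * p0) y.
    case: py0 => w ->; exists (w * omega ^+ (2 * i)).
    by rewrite mulrA -[_ * _ * e]mulrA eK; ring.
  case: (eis_pm1_primary hi) => h; first by exists (e * p0).
  exists (- (e * p0)); split=> //; first exact: eis_primeN.
  by case: pey => w ->; exists (- w); rewrite mulrNN.
have [||t zt] := IH z.
- have z0 : z != 0 by apply: contra_neq (eis_pm1_neq0 y3); rewrite yz => ->; rewrite mul0r.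
  have [_ pu _] := pp; rewrite eis_unitE in pu; have := eis_norm_ge0 p.
  have := eis_prime_neq0 pp; rewrite -eis_norm_gt0 => np _.
  rewrite -eis_norm_gt0 in z0; move: hn; rewrite yz eis_normM abszM; nia.
- by rewrite -(eis_pm1M _ (eis_primary_pm1 p2)) mulrC -yz.
exists (t ++ [:: p]); rewrite yz; apply: primary_factorizationM => //.
exact: primary_factorization_prime.
Qed.

Lemma eis_dvd_unit_prod e x y : e * e = 1 -> eis_dvd x (e * y) -> eis_dvd x y.
Proof. by move=> ee [w h]; exists (e * w); rewrite -mulrA -h mulrA ee mul1r. Qed.

(** The sign e allows the induction to cover factorizations up to sign. *)
Lemma primary_prod_perm (s t : seq eis) e : e * e = 1 ->
  (forall p, p \in s -> eis_prime p /\ eis_primary p) ->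
  (forall p, p \in t -> eis_prime p /\ eis_primary p) ->
  \prod_(p <- s) p = e * \prod_(p <- t) p -> perm_eq s t.
Proof.
move=> ee; elim: s t => [|p s IH] t sp tp.
  rewrite big_nil; case: t tp => // r t tp; rewrite big_cons => e1.
  have [[_ []]] := tp r (mem_head _ _).
  by exists (e * \prod_(p <- t) p); rewrite [RHS]e1; ring.
rewrite big_cons => est; have [pp p2] := sp p (mem_head _ _).
have /(eis_prime_dvd_prod pp)[r rt pr] : eis_dvd p (\prod_(x <- t) x).
  by apply: (eis_dvd_unit_prod ee); rewrite -est; apply/eis_dvdMr/eis_dvd_refl.
have [rr r2] := tp r rt; have epr : p = r by apply: eis_primary_assoc => //; case: pp.
rewrite -{r pr rr r2}epr in rt; rewrite perm_sym (permPl (perm_to_rem rt)) perm_cons.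
rewrite perm_sym; apply: IH => [r rs|r /mem_rem/tp//|].
  by apply: sp; rewrite in_cons rs orbT.
apply: (mulfI (eis_prime_neq0 pp)); rewrite est (perm_big _ (perm_to_rem rt)).
by rewrite big_cons /=; ring.
Qed.

Lemma primary_factorization_unique y s t :
  primary_factorization y s -> primary_factorization y t -> perm_eq s t.
Proof.
move=> [sp ys] [tp yt].
case: ys yt => -> [] e.
- by apply: (@primary_prod_perm _ _ 1); rewrite ?mul1r.
- by apply: (@primary_prod_perm _ _ (-1)); rewrite ?mulrNN ?mulN1r ?mul1r.
- by apply: (@primary_prod_perm _ _ (-1)); rewrite ?mulrNN ?mulN1r ?mul1r // -e opprK.
- by apply: (@primary_prod_perm _ _ 1); rewrite ?mul1r //; exact: oppr_inj.
Qed.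

(** By uniqueness the factorization chosen in the definition is immaterial. *)
Lemma cubic_jacobiE x y s : primary_factorization y s ->
  cubic_jacobi x y = \prod_(p <- s) cubic_residue_symbol x p.
Proof.
move=> ys; rewrite /cubic_jacobi; case: xgetP => [t _ yt|/(_ s)//].
exact/perm_big/(primary_factorization_unique yt ys).
Qed.

Lemma cubic_jacobi_prime x p : eis_prime p -> eis_primary p ->
  cubic_jacobi x p = cubic_residue_symbol x p.
Proof.
by move=> pp p2; rewrite (cubic_jacobiE _ (primary_factorization_prime pp p2)) big_seq1.
Qed.

Lemma cubic_jacobi1r x : cubic_jacobi x 1 = 1.
Proof. by rewrite (cubic_jacobiE _ primary_factorization1) big_nil. Qed.

Lemma cubic_jacobiMr x y z : eis_pm1 y -> eis_pm1 z ->
  cubic_jacobi x (y * z) = cubic_jacobi x y * cubic_jacobi x z.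
Proof.
move=> /eis_pm1_factor[s ys] /eis_pm1_factor[t zt].
rewrite (cubic_jacobiE _ ys) (cubic_jacobiE _ zt).
by rewrite (cubic_jacobiE _ (primary_factorizationM ys zt)) big_cat.
Qed.

Lemma cubic_jacobiNr x y : eis_pm1 y -> cubic_jacobi x (- y) = cubic_jacobi x y.
Proof.
move=> /eis_pm1_factor[s ys].
by rewrite (cubic_jacobiE _ ys) (cubic_jacobiE _ (primary_factorizationN ys)).
Qed.

(** Multiplicative statements about bottom arguments reduce to primary primes. *)
Lemma eis_pm1_ind (R : eis -> Prop) : R 1 ->
  (forall y, eis_pm1 y -> R y -> R (- y)) ->
  (forall p y, eis_prime p -> eis_primary p -> eis_pm1 y -> R y -> R (p * y)) ->
  forall y, eis_pm1 y -> R y.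
Proof.
move=> R1 RN RM y /eis_pm1_factor[s [sp ys]].
have {ys} : y = \prod_(p <- s) p \/ - y = \prod_(p <- s) p.
  by case: ys => ->; rewrite ?opprK; [left|right].
have h : eis_pm1 (\prod_(p <- s) p) /\ R (\prod_(p <- s) p).
  elim: s sp => [|p s IH] sp; first by rewrite big_nil.
  rewrite big_cons; have [pp p2] := sp p (mem_head _ _).
  have [|? ?] := IH; first by move=> r rs; apply: sp; rewrite in_cons rs orbT.
  by rewrite (eis_pm1M _ (eis_primary_pm1 p2)); split=> //; apply: RM.
case=> e; first by rewrite e; case: h.
by rewrite -[y]opprK e; apply: RN; case: h.
Qed.

(** * Residue fields *)

Lemma closed_field_of_pchar (q : nat) : prime q ->
  exists K : closedFieldType, q \in [pchar K].
Proof.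
move=> qp; have [K [f _]] := countable_algebraic_closure 'F_q.
by exists K; apply: (rmorph_pchar f); apply: pchar_Fp.
Qed.

(** Evaluation at a root w of X^2 + X + 1; the proof is an argument so that the
    ring morphism structure can be attached to the function. *)
Definition eis_ev (K : fieldType) (w : K) (hw : w ^+ 2 + w + 1 = 0) (x : eis) : K :=
  (ea x)%:~R + (eb x)%:~R * w.

Section EisEv.
Variables (K : fieldType) (w : K) (hw : w ^+ 2 + w + 1 = 0).

Lemma eis_ev_zmod : zmod_morphism (eis_ev hw).
Proof. by move=> x y; rewrite /eis_ev !eisS; ring. Qed.
Lemma eis_ev_monoid : monoid_morphism (eis_ev hw).
Proof.
have hw2 : w ^+ 2 = - w - 1 by rewrite -[LHS](addrK (w + 1)) addrA hw; ring.
by split=> [|x y]; rewrite /eis_ev !eisS; ring: hw2.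
Qed.
HB.instance Definition _ := GRing.isZmodMorphism.Build eis K (eis_ev hw) eis_ev_zmod.
HB.instance Definition _ :=
  GRing.isMonoidMorphism.Build eis K (eis_ev hw) eis_ev_monoid.
End EisEv.

Lemma eis_rmorph_exists (K : closedFieldType) : exists phi : {rmorphism eis -> K}, True.
Proof.
have [|w hw] := closed_rootP ('X^2 + 'X + 1 : {poly K}) _.
  rewrite -addrA size_polyDl size_polyXn // -[X in 'X + X]opprK -polyC1 -polyCN.
  by rewrite size_XsubC.
suff hw' : w ^+ 2 + w + 1 = 0 by exists (eis_ev hw').
by move: hw; rewrite /root !hornerE => /eqP.
Qed.

(** The norm is a multiple of the prime, and a product of prime numbers. *)
Lemma eis_prime_over p : eis_prime p -> exists2 q : nat, prime q & eis_dvd p q%:R.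
Proof.
move=> pp; have [_ pu pM] := pp.
have : eis_dvd p (`|eis_norm p|%N)%:R.
  by rewrite pmulrn gez0_abs ?eis_norm_ge0 //; apply: eis_dvd_norm.
have : (0 < `|eis_norm p|)%N by rewrite absz_gt0 eis_norm_eq0 (eis_prime_neq0 pp).
have [n] := ubnP `|eis_norm p|%N; move: (`|_|)%N => m.
elim: n m => // n IH m mn m0 pm.
have [m1|m1] := leqP m 1.
  have e : m = 1%N by lia.
  by case: pu; case: pm => z; rewrite e => ez; exists z; rewrite mulrC.
move: pm; rewrite -(divnK (pdiv_dvd m)) natrM => /pM[h|h]; last first.
  by exists (pdiv m) => //; apply: pdiv_prime.
apply: IH h; last by rewrite divn_gt0 ?pdiv_gt0 // pdiv_leq.
by apply: leq_trans (ltn_Pdiv _ _) _; rewrite // prime_gt1 // pdiv_prime.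
Qed.

(** The norm divides that of q, which is q^2, and is not 1. *)
Lemma eis_prime_norm p (q : nat) : prime q -> eis_prime p -> eis_dvd p q%:R ->
  eis_norm p = q \/ eis_norm p = (q ^ 2)%N.
Proof.
move=> qp [_ pu _] [z e]; rewrite eis_unitE in pu.
have := congr1 eis_norm e; rewrite pmulrn eis_norm_int eis_normM => en.
have /(dvdn_pfactor _ _ qp)[m m2 nm] : (`|eis_norm p| %| q ^ 2)%N.
  by have := congr1 absz en; rewrite abszX /= abszM => ->; apply: dvdn_mull.
have := eis_norm_ge0 p; case: m m2 nm => [|[|[|//]]] _ nm n0.
- by case: pu; move: nm; rewrite expn0; lia.
- by left; move: nm; rewrite expn1; lia.
- by right; rewrite -nm gez0_abs.
Qed.

Lemma eis_over_neq3 p (q : nat) : prime q -> eis_prime p -> eis_pm1 p ->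
  eis_dvd p q%:R -> q != 3%N.
Proof.
move=> qp pp p3 pq; apply: contra (eis_norm_pm1 p3) => /eqP q3.
by case: (eis_prime_norm qp pp pq) => ->; rewrite q3.
Qed.

Section Residue.
Variables (K : fieldType) (phi : {rmorphism eis -> K}).

Lemma rmorph_eisE x : phi x = (ea x)%:~R + (eb x)%:~R * phi omega.
Proof. by rewrite {1}(eisE x) rmorphD rmorphM !rmorph_int. Qed.

Lemma rmorph_omega : phi omega ^+ 2 + phi omega + 1 = 0.
Proof. by rewrite -rmorphXn -rmorphD -[1](rmorph1 phi) -rmorphD omega_root rmorph0. Qed.

Lemma rmorph_omega3 : phi omega ^+ 3 = 1.
Proof. by rewrite -rmorphXn omega3 rmorph1. Qed.

Lemma rmorph_eis_pchar p (q : nat) : prime q -> phi p = 0 -> eis_dvd p q%:R ->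
  q \in [pchar K].
Proof.
move=> qp p0 [z e]; rewrite inE qp /=.
by rewrite -(rmorph_nat phi) e rmorphM p0 mulr0.
Qed.

(** The kernel of a morphism to a field that kills a prime p is generated by p:
    an element prime to p satisfies a Bezout relation with p. *)
Lemma rmorph_eis_eq0 p x : eis_prime p -> phi p = 0 -> (phi x = 0 <-> eis_dvd p x).
Proof.
move=> pp p0; split=> [x0|[z ->]]; last by rewrite rmorphM p0 mulr0.
apply: contrapT => /(eis_prime_coprime pp)[u [v /(congr1 phi)/eqP]].
by rewrite rmorphD !rmorphM x0 p0 !mulr0 addr0 rmorph1 eq_sym oner_eq0.
Qed.

Lemma rmorph_eis_frob (q k : nat) x : q \in [pchar K] ->
  phi x ^+ (q ^ k) = (ea x)%:~R + (eb x)%:~R * phi omega ^+ (q ^ k).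
Proof.
move=> qK; rewrite rmorph_eisE; elim: k => [|k IH]; first by rewrite expr1.
rewrite expnSr exprM IH -(pFrobenius_autE qK) rmorphD rmorphM /= !rmorph_int.
by rewrite pFrobenius_autE -exprM.
Qed.

(** For a prime over q, the residue field has q or q^2 elements, and q = 1
    modulo 3 in the first case; so the N(p)-th power fixes omega. *)
Lemma rmorph_eis_norm p x : eis_prime p -> eis_pm1 p -> phi p = 0 ->
  phi x ^+ `|eis_norm p| = phi x.
Proof.
move=> pp p3 p0; have [q qp pq] := eis_prime_over pp.
have qK := rmorph_eis_pchar qp p0 pq.
have [k nk] : exists k, `|eis_norm p|%N = (q ^ k)%N.
  by case: (eis_prime_norm qp pp pq) => ->; [exists 1%N|exists 2%N].
have [j nj] := eis_norm1mod3 (eis_norm_pm1 p3).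
have nj' : `|eis_norm p|%N = (3 * j + 1)%N by rewrite nj.
rewrite nk rmorph_eis_frob // -nk nj' exprD exprM rmorph_omega3 expr1n mul1r.
by rewrite [RHS]rmorph_eisE.
Qed.

Lemma rmorph_eis_3 p : eis_prime p -> eis_pm1 p -> phi p = 0 -> 3 != 0 :> K.
Proof.
move=> pp p3 p0; have [q qp pq] := eis_prime_over pp.
have qK := rmorph_eis_pchar qp p0 pq.
rewrite -(dvdn_pcharf qK) dvdn_prime2 //; exact: eis_over_neq3 pq.
Qed.

End Residue.

(** The possible values of a cubic symbol. *)
Definition cubic_value (s : eis) : Prop := s = 0 \/ exists i, s = omega ^+ i.

Lemma cubic_value0 : cubic_value 0. Proof. by left. Qed.
Lemma cubic_valueX i : cubic_value (omega ^+ i). Proof. by right; exists i. Qed.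
Lemma cubic_value1 : cubic_value 1. Proof. by right; exists 0%N. Qed.
Lemma cubic_valueM s t : cubic_value s -> cubic_value t -> cubic_value (s * t).
Proof.
move=> [->|[i ->]]; first by rewrite mul0r; left.
by move=> [->|[j ->]]; [rewrite mulr0; left|rewrite -exprD; apply: cubic_valueX].
Qed.
Lemma cubic_valueJ s : cubic_value s -> cubic_value (eis_conj s).
Proof.
move=> [->|[i ->]]; first by rewrite rmorph0; left.
by right; exists (2 * i)%N; rewrite rmorphXn exprM.
Qed.

Lemma cubic_value_conj s : cubic_value s -> s != 0 -> s * eis_conj s = 1.
Proof.
move=> [->|[i -> _]]; first by rewrite eqxx.
by rewrite eis_norm_conj eis_unit_norm_pm1.
Qed.

Lemma cubic_value3 s : cubic_value s -> s != 0 -> s ^+ 3 = 1.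
Proof.
move=> [->|[i -> _]]; first by rewrite eqxx.
by rewrite -exprM mulnC exprM omega3 expr1n.
Qed.

Lemma cubic_value_cases s : cubic_value s -> [\/ s = 0, s = 1, s = omega | s = omega ^+ 2].
Proof.
move=> [->|[i ->]]; first by constructor 1.
have : (i %% 3 < 3)%N by rewrite ltn_mod.
rewrite -(@omegaX_mod (i %% 3) i) ?modn_mod //.
by case: (_ %% _)%N => [|[|[|//]]] _; [constructor 2|constructor 3|constructor 4].
Qed.

Lemma cubic_value_inj (K : fieldType) (phi : {rmorphism eis -> K}) s t :
  3 != 0 :> K -> cubic_value s -> cubic_value t -> phi s = phi t -> s = t.
Proof.
move=> K3 hs ht; have w := rmorph_omega phi; have w3 := rmorph_omega3 phi.
have w1 : phi omega != 1.
  by apply: contra_neq K3 => w1; rewrite -w w1; ring.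
have w0 : phi omega != 0.
  by apply: contra_eq_neq w3 => ->; rewrite expr0n eq_sym oner_eq0.
have w2 : phi omega ^+ 2 != 1.
  by apply: contra_neq w1 => e; rewrite -w3 exprS e mulr1.
have w21 : phi omega ^+ 2 != phi omega.
  by apply: contra_neq w1 => e; apply: (mulfI w0); rewrite mulr1 -expr2.
have w20 : phi omega ^+ 2 != 0 by rewrite expf_eq0.
have o1 := oner_neq0 K.
case: (cubic_value_cases hs) => ->; case: (cubic_value_cases ht) => -> //;
  rewrite ?rmorphXn ?rmorph0 ?rmorph1 => /eqP; rewrite 1?eq_sym ?(negbTE w1)
  ?(negbTE w0) ?(negbTE w2) ?(negbTE w21) ?(negbTE w20) ?(negbTE o1) //;
  rewrite 1?eq_sym ?(negbTE w1)
  ?(negbTE w0) ?(negbTE w2) ?(negbTE w21) ?(negbTE w20) ?(negbTE o1) //.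
Qed.

(** The exponent in the criterion that defines the symbol at a prime. *)
Definition cubic_exp (p : eis) : nat := ((`|eis_norm p|%N - 1) %/ 3)%N.

Lemma cubic_expE p : eis_pm1 p -> `|eis_norm p|%N = (3 * cubic_exp p + 1)%N.
Proof.
move=> p3; have [j nj] := eis_norm1mod3 (eis_norm_pm1 p3).
by rewrite /cubic_exp nj /=; lia.
Qed.

Lemma cubic_exp_gt0 p : eis_prime p -> eis_pm1 p -> (0 < cubic_exp p)%N.
Proof.
move=> [_ pu _] /cubic_expE; rewrite eis_unitE in pu.
by case: cubic_exp => // e; case: pu; have := eis_norm_ge0 p; lia.
Qed.

(** The image of the cubic symbol in any residue field is given by Euler's
    formula; as residue maps are injective on {0, 1, omega, omega^2}, this
    determines the symbol. *)
Lemma cubic_residue_symbolP (K : fieldType) (phi : {rmorphism eis -> K}) x p :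
  eis_prime p -> eis_primary p -> phi p = 0 ->
  cubic_value (cubic_residue_symbol x p) /\
  phi (cubic_residue_symbol x p) = phi x ^+ cubic_exp p.
Proof.
move=> pp /eis_primary_pm1 p3 p0; rewrite /cubic_residue_symbol.
have e0 := cubic_exp_gt0 pp p3.
case: asboolP => [px|px].
  split; first exact: cubic_value0.
  by rewrite rmorph0 (_ : phi x = 0) ?expr0n ?gtn_eqF //; apply/(rmorph_eis_eq0 _ pp p0).
have x0 : phi x != 0 by apply/eqP => /(rmorph_eis_eq0 _ pp p0).
have eqmodE a b : eis_eqmod p a b <-> phi a = phi b.
  rewrite /eis_eqmod -(rmorph_eis_eq0 _ pp p0) rmorphB.
  by split=> [/subr0_eq|->]; rewrite ?subrr.
case: pickP => [i /asboolP/eqmodE|none].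
  by rewrite rmorphXn => e; split; [apply: cubic_valueX|].
suff [i ei] : exists i : 'I_3, phi x ^+ cubic_exp p = phi (omega ^+ i).
  by have /asboolP[] := none i; apply/eqmodE; rewrite rmorphXn.
have y3 : (phi x ^+ cubic_exp p) ^+ 3 = 1.
  apply: (mulIf x0); rewrite mul1r -exprM -exprSr mulnC -addn1 -cubic_expE //.
  exact: rmorph_eis_norm.
move: (phi x ^+ cubic_exp p) y3 => y y3; have w := rmorph_omega phi.
have : (y - 1) * ((y - phi omega) * (y - phi omega ^+ 2)) = 0.
  have w2 : phi omega ^+ 2 = - phi omega - 1.
    by rewrite -[LHS](addrK (phi omega + 1)) addrA w; ring.
  by ring: w2 y3.
move/eqP; rewrite !mulf_eq0 !subr_eq0.
case/or3P => /eqP->; [exists ord0|exists (inord 1)|exists (inord 2)].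
- by rewrite rmorph1.
- by rewrite inordK.
- by rewrite inordK // rmorphXn.
Qed.

(** If phi kills the rational prime under p but not p, then it kills the
    conjugate of p, and phi composed with conjugation kills p. *)
Lemma residue_exists p : eis_prime p ->
  exists (K : closedFieldType) (phi : {rmorphism eis -> K}), phi p = 0.
Proof.
move=> pp; have [q qp pq] := eis_prime_over pp.
have [K qK] := closed_field_of_pchar qp; exists K.
have [phi _] := eis_rmorph_exists K.
have : phi p * phi (eis_conj p) = 0.
  rewrite -rmorphM eis_norm_conj rmorph_int.
  case: (eis_prime_norm qp pp pq) => ->; first exact: pcharf0.
  by rewrite -pmulrn natrX (pcharf0 qK) expr0n.
move/eqP; rewrite mulf_eq0 => /orP[]/eqP h; first by exists phi.
by exists (phi \o eis_conj).
Qed.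

(** * The cubic Jacobi symbol *)

Section PrimeSymbol.
Variable p : eis.
Hypotheses (pp : eis_prime p) (p2 : eis_primary p).
Let p3 := eis_primary_pm1 p2.

Lemma cubic_residue_symbol_eqP (K : fieldType) (phi : {rmorphism eis -> K}) x s :
  phi p = 0 -> cubic_value s ->
  (cubic_residue_symbol x p = s <-> phi x ^+ cubic_exp p = phi s).
Proof.
move=> p0 hs; have [hx ex] := cubic_residue_symbolP x pp p2 p0.
split=> [<-|e]; first by rewrite ex.
by apply: (cubic_value_inj (rmorph_eis_3 pp p3 p0) hx hs (phi := phi)); rewrite ex.
Qed.

Lemma cubic_residue_symbol_value x : cubic_value (cubic_residue_symbol x p).
Proof.
have [K [phi p0]] := residue_exists pp.
by have [] := cubic_residue_symbolP x pp p2 p0.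
Qed.

Lemma cubic_residue_symbolM x y : cubic_residue_symbol (x * y) p =
  cubic_residue_symbol x p * cubic_residue_symbol y p.
Proof.
have [K [phi p0]] := residue_exists pp; apply/(cubic_residue_symbol_eqP _ p0).
  by apply: cubic_valueM; apply: cubic_residue_symbol_value.
have [_ ex] := cubic_residue_symbolP x pp p2 p0.
have [_ ey] := cubic_residue_symbolP y pp p2 p0.
by rewrite !rmorphM ex ey exprMn.
Qed.

Lemma cubic_residue_symbol_mod x y : eis_dvd p (x - y) ->
  cubic_residue_symbol x p = cubic_residue_symbol y p.
Proof.
have [K [phi p0]] := residue_exists pp.
move=> /(rmorph_eis_eq0 _ pp p0); rewrite rmorphB => /subr0_eq e.
apply/(cubic_residue_symbol_eqP _ p0); first exact: cubic_residue_symbol_value.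
by rewrite e; have [_ ->] := cubic_residue_symbolP y pp p2 p0.
Qed.

Lemma cubic_residue_symbol_neq0 x : eis_coprime p x -> cubic_residue_symbol x p != 0.
Proof.
move=> px; have [K [phi p0]] := residue_exists pp.
apply/eqP => /(cubic_residue_symbol_eqP _ p0 cubic_value0)/eqP.
rewrite rmorph0 expf_eq0 => /andP[_ /eqP/(rmorph_eis_eq0 _ pp p0)].
exact: eis_coprime_ndvd.
Qed.

(** Composing a residue map at p with conjugation gives one at the conjugate of
    p, with the same exponent. *)
Lemma cubic_residue_symbolJ x :
  cubic_residue_symbol (eis_conj x) (eis_conj p) = eis_conj (cubic_residue_symbol x p).
Proof.
have [K [phi p0]] := residue_exists pp; have [hx ex] := cubic_residue_symbolP x pp p2 p0.
have pJ : phi (eis_conj (eis_conj p)) = 0 by rewrite eis_conjK.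
have [hJ eJ] := @cubic_residue_symbolP _ (phi \o eis_conj) (eis_conj x) _
  (eis_primeJ pp) (eis_primaryJ p2) pJ.
have K3 := rmorph_eis_3 pp p3 p0.
apply: (cubic_value_inj K3 hJ (cubic_valueJ hx) (phi := phi \o eis_conj)).
by rewrite eJ /= !eis_conjK ex /cubic_exp eis_normJ.
Qed.

Lemma cubic_residue_symbol_omega : cubic_residue_symbol omega p = omega ^+ cubic_exp p.
Proof.
have [K [phi p0]] := residue_exists pp.
by apply/(cubic_residue_symbol_eqP _ p0); [apply: cubic_valueX|rewrite rmorphXn].
Qed.

End PrimeSymbol.

Section Jacobi.
Variable y : eis.
Hypothesis y3 : eis_pm1 y.

Lemma cubic_jacobi_primeMr x p z : eis_prime p -> eis_primary p -> eis_pm1 z ->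
  cubic_jacobi x (p * z) = cubic_residue_symbol x p * cubic_jacobi x z.
Proof.
move=> pp p2 z3.
by rewrite (cubic_jacobiMr _ (eis_primary_pm1 p2) z3) cubic_jacobi_prime.
Qed.

Lemma cubic_jacobi_value x : cubic_value (cubic_jacobi x y).
Proof.
move: y y3; apply: eis_pm1_ind.
- by rewrite cubic_jacobi1r; apply: cubic_value1.
- by move=> z z3; rewrite cubic_jacobiNr.
move=> p z pp p2 z3 hz; rewrite cubic_jacobi_primeMr //.
by apply: cubic_valueM => //; apply: cubic_residue_symbol_value.
Qed.

Lemma cubic_jacobiMl x x' :
  cubic_jacobi (x * x') y = cubic_jacobi x y * cubic_jacobi x' y.
Proof.
move: y y3; apply: eis_pm1_ind.
- by rewrite !cubic_jacobi1r mulr1.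
- by move=> z z3; rewrite !cubic_jacobiNr.
move=> p z pp p2 z3 hz; rewrite !cubic_jacobi_primeMr //.
by rewrite cubic_residue_symbolM // hz mulrACA.
Qed.

Lemma cubic_jacobi_mod x x' :
  eis_dvd y (x - x') -> cubic_jacobi x y = cubic_jacobi x' y.
Proof.
move: y y3; apply: eis_pm1_ind.
- by rewrite !cubic_jacobi1r.
- move=> z z3 hz [w e]; rewrite !cubic_jacobiNr //; apply: hz.
  by exists (- w); rewrite e mulrN mulNr.
move=> p z pp p2 z3 hz [w e]; rewrite !cubic_jacobi_primeMr //.
rewrite hz ?(cubic_residue_symbol_mod pp p2 (y := x')) //.
  by rewrite e mulrCA; apply/eis_dvdMr/eis_dvd_refl.
by rewrite e mulrA; apply/eis_dvdMl/eis_dvd_refl.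
Qed.

Lemma cubic_jacobi_neq0 x : eis_coprime y x -> cubic_jacobi x y != 0.
Proof.
move: y y3; apply: eis_pm1_ind.
- by rewrite cubic_jacobi1r oner_eq0.
- move=> z z3 hz co; rewrite cubic_jacobiNr //; apply: hz.
  by case: co => u [v e]; exists (- u), v; rewrite -e mulrN mulNr.
move=> p z pp p2 z3 hz co; rewrite cubic_jacobi_primeMr // mulf_neq0 //.
  apply: cubic_residue_symbol_neq0 => //.
  by apply: eis_coprime_dvdl co; apply/eis_dvdMr/eis_dvd_refl.
by apply: hz; apply: eis_coprime_dvdl co; apply/eis_dvdMl/eis_dvd_refl.
Qed.

Lemma cubic_jacobi_coprime3 x : eis_coprime y x -> cubic_jacobi x y ^+ 3 = 1.
Proof. by move=> /cubic_jacobi_neq0; apply: cubic_value3; apply: cubic_jacobi_value. Qed.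

Lemma cubic_jacobiJ x :
  cubic_jacobi (eis_conj x) (eis_conj y) = eis_conj (cubic_jacobi x y).
Proof.
move: y y3; apply: eis_pm1_ind.
- by rewrite rmorph1 !cubic_jacobi1r rmorph1.
- by move=> z z3; rewrite rmorphN !cubic_jacobiNr // eis_pm1J.
move=> p z pp p2 z3 hz; rewrite rmorphM !cubic_jacobi_primeMr ?eis_pm1J //.
- by rewrite cubic_residue_symbolJ // hz rmorphM.
- exact: eis_primeJ.
- exact: eis_primaryJ.
Qed.

Lemma cubic_jacobi1l : cubic_jacobi 1 y = 1.
Proof.
have h : cubic_jacobi 1 y != 0.
  by apply: cubic_jacobi_neq0; exists 0, 1; ring.
by apply: (mulfI h); rewrite -cubic_jacobiMl !mulr1.
Qed.

Lemma cubic_jacobiXl x n : cubic_jacobi (x ^+ n) y = cubic_jacobi x y ^+ n.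
Proof. by elim: n => [|n IH]; rewrite ?cubic_jacobi1l // !exprS cubic_jacobiMl IH. Qed.

Lemma cubic_jacobi_cube x : eis_coprime y x -> cubic_jacobi (x ^+ 3) y = 1.
Proof. by move=> yx; rewrite cubic_jacobiXl cubic_jacobi_coprime3. Qed.

Lemma cubic_jacobiNl x : cubic_jacobi (- x) y = cubic_jacobi x y.
Proof.
rewrite -mulN1r cubic_jacobiMl (_ : -1 = (-1) ^+ 3); last by ring.
by rewrite cubic_jacobi_cube ?mul1r //; exists 0, (-1); ring.
Qed.

(** Both sides are multiplicative: for N = 3 a + 1 and N' = 3 b + 1 one has
    (N N' - 1) / 3 = a + b modulo 3. *)
Lemma cubic_jacobi_omega : cubic_jacobi omega y = omega ^+ cubic_exp y.
Proof.
move: y y3; apply: eis_pm1_ind.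
- by rewrite cubic_jacobi1r.
- move=> z z3; rewrite cubic_jacobiNr // => ->; congr (_ ^+ _).
  by rewrite /cubic_exp -[in RHS]mulN1r eis_normM mul1r.
move=> p z pp p2 z3 hz; rewrite cubic_jacobi_primeMr // hz.
rewrite cubic_residue_symbol_omega // -exprD; apply: omegaX_mod.
have p3 := eis_primary_pm1 p2.
have := cubic_expE (etrans (eis_pm1M z p3) z3).
rewrite eis_normM abszM (cubic_expE p3) (cubic_expE z3).
move: (cubic_exp (p * z)) (cubic_exp p) (cubic_exp z) => a b c e.
have -> : a = (b + c + b * c * 3)%N by nia.
by rewrite [in RHS]addnC modnMDl.
Qed.

End Jacobi.

Section RationalBottom.
Variable n : int.
Hypothesis n3 : ~~ (3 %| n)%Z.
Let n_pm1 : eis_pm1 n%:~R. Proof. by rewrite eis_pm1_int. Qed.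

Lemma cubic_jacobi_conj x :
  cubic_jacobi (eis_conj x) n%:~R = eis_conj (cubic_jacobi x n%:~R).
Proof. by rewrite -cubic_jacobiJ // rmorph_int. Qed.

(** The symbol of two rational integers is invariant under conjugation, and 1
    is the only real cube root of unity. *)
Lemma cubic_jacobi_int (m : int) : coprimez m n -> cubic_jacobi m%:~R n%:~R = 1.
Proof.
move=> mn; have s0 : cubic_jacobi m%:~R n%:~R != 0.
  by apply: cubic_jacobi_neq0 => //; apply/eis_coprime_int; rewrite coprimez_sym.
have hs := cubic_jacobi_value n_pm1 m%:~R; have := cubic_jacobi_conj m%:~R.
rewrite rmorph_int; move: s0 hs; move: (cubic_jacobi _ _) => s s0 hs.
by case: (cubic_value_cases hs) s0 => -> // _ [].
Qed.

(** The square of this symbol is the symbol of the rational integer -3, and its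
    cube is 1 as well. *)
Lemma cubic_jacobi_sqrtm3 : cubic_jacobi sqrtm3 n%:~R = 1.
Proof.
have n3' : coprimez (-3) n by rewrite coprimezE /= prime_coprime.
have s2 : cubic_jacobi sqrtm3 n%:~R ^+ 2 = 1.
  rewrite -cubic_jacobiXl // sqrtm3_sqr (_ : -3 = (-3)%:~R) //.
  exact: cubic_jacobi_int.
have /cubic_jacobi_coprime3 : eis_coprime n%:~R sqrtm3.
  apply: (@eis_coprime_dvdr _ (-3)%:~R); last first.
    by apply: eis_coprime_int; rewrite coprimez_sym.
  by exists sqrtm3.
by rewrite exprS s2 mulr1; apply.
Qed.

(** By the supplementary law the symbol of omega at n is
    omega^((n^2 - 1) / 3), which depends on n^2 modulo 9. *)
Lemma cubic_jacobi_omega_int (m : int) : ~~ (3 %| m)%Z ->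
  (9 %| n ^+ 2 - m ^+ 2)%Z ->
  cubic_jacobi omega n%:~R = cubic_jacobi omega m%:~R.
Proof.
move=> m3 mn; have m_pm1 : eis_pm1 m%:~R by rewrite eis_pm1_int.
rewrite !cubic_jacobi_omega //; apply: omegaX_mod.
have := cubic_expE n_pm1; have := cubic_expE m_pm1.
have := sqr_ge0 m; have := sqr_ge0 n; rewrite !eis_norm_int.
by move: (cubic_exp _) (cubic_exp _) (n ^+ 2) (m ^+ 2) mn => a b c d; lia.
Qed.

End RationalBottom.

(** * Gauss and Jacobi sums of cubic characters *)

Section Characters.
Variables (F : finFieldType) (K : idomainType).

Definition cubic_character (chi : F -> K) : Prop :=
  [/\ chi 0 = 0, {morph chi : x y / x * y}, forall t, t != 0 -> chi t ^+ 3 = 1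
    & exists2 t, t != 0 & chi t != 1].

Definition additive_character (e : F -> K) : Prop :=
  [/\ e 0 = 1, forall x y, e (x + y) = e x * e y & exists t, e t != 1].

Definition gauss_sum (chi e : F -> K) : K := \sum_t chi t * e t.
Definition jacobi_sum (chi : F -> K) : K := \sum_t chi t * chi (1 - t).

Variable chi : F -> K.
Hypothesis hchi : cubic_character chi.

Lemma cubic_character0 : chi 0 = 0. Proof. by case: hchi. Qed.
Lemma cubic_characterM x y : chi (x * y) = chi x * chi y. Proof. by case: hchi. Qed.

Lemma cubic_character_neq0 t : t != 0 -> chi t != 0.
Proof.
case: hchi => _ _ h _ /h; apply: contra_eq_neq => ->.
by rewrite expr0n eq_sym oner_eq0.
Qed.

Lemma cubic_character3 t : t != 0 -> chi t ^+ 3 = 1.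
Proof. by case: hchi => _ _ h _ /h. Qed.

Lemma cubic_character1 : chi 1 = 1.
Proof.
by apply: (mulfI (cubic_character_neq0 (oner_neq0 F))); rewrite -cubic_characterM !mulr1.
Qed.

Lemma cubic_characterN1 : chi (-1) = 1.
Proof.
have n1 : (-1 : F) != 0 by rewrite oppr_eq0 oner_eq0.
rewrite -[RHS](cubic_character3 n1) exprS expr2 -cubic_characterM mulrNN mulr1.
by rewrite cubic_character1 mulr1.
Qed.

Lemma cubic_character_sqr : cubic_character (fun t => chi t ^+ 2).
Proof.
case: hchi => c0 cM c3 [t t0 t1]; split.
- by rewrite c0 expr0n.
- by move=> x y; rewrite cM exprMn.
- by move=> x x0; rewrite -exprM mulnC exprM c3 // expr1n.
- by exists t => //; apply: contra_neq t1 => t2; rewrite -(c3 t t0) exprS t2 mulr1.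
Qed.

Lemma sum_cubic_character : \sum_t chi t = 0.
Proof.
case: hchi => c0 cM c3 [t t0 t1]; apply/eqP.
rewrite -(mulIr_eq0 _ (mulIf (_ : chi t - 1 != 0))).
  rewrite mulrBr mulr1 subr_eq0 mulr_suml; apply/eqP.
  rewrite [RHS](reindex_inj (mulIf t0)); apply: eq_bigr => s _.
  by rewrite cM.
by rewrite subr_eq0.
Qed.

End Characters.

Section GaussSum.
Variables (F : finFieldType) (K : idomainType) (chi e : F -> K).
Hypotheses (hchi : cubic_character chi) (he : additive_character e).

Lemma sum_additive_character a : \sum_t e (a * t) = if a == 0 then #|F|%:R else 0.
Proof.
case: he => e0 eD [t t1]; case: eqVneq => [->|a0].
  under eq_bigr do rewrite mul0r e0; by rewrite sumr_const.
apply/eqP; rewrite -(mulIr_eq0 _ (mulIf (_ : e t - 1 != 0))); last by rewrite subr_eq0.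
rewrite mulrBr mulr1 subr_eq0 mulr_suml; apply/eqP.
rewrite [RHS](reindex_inj (addIr (t / a))); apply: eq_bigr => s _.
by rewrite mulrDr mulrCA mulfV // mulr1 eD.
Qed.

(** As chi^2 is the inverse of chi on nonzero elements, replacing s by s t
    leaves the sum of chi(s) e((s + 1) t) over s and t != 0. The sum over t is
    the order of F minus 1 for s = -1, and -1 otherwise; and chi sums to 0. *)
Lemma gauss_sumM : gauss_sum chi e * gauss_sum (fun t => chi t ^+ 2) e = #|F|%:R.
Proof.
case: he => e0 eD _.
transitivity (\sum_t \sum_s chi s * (e ((s + 1) * t) - (t == 0)%:R)).
  rewrite mulr_sumr; apply: eq_bigr => t _; rewrite mulr_suml.
  have [->|t0] := eqVneq t 0.
    by rewrite !big1 // => s _; rewrite ?(cubic_character0 hchi) ?mulr0 ?e0 ?subrr ?mulr0 //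
       expr0n mul0r mulr0.
  rewrite (reindex_inj (mulIf t0)); apply: eq_bigr => s _.
  rewrite subr0 mulrDl mul1r eD (cubic_characterM hchi).
  by rewrite -[RHS]mul1r -(cubic_character3 hchi t0); ring.
rewrite exchange_big /=; under eq_bigr do rewrite -mulr_sumr sumrB sum_additive_character.
have -> : \sum_t (t == 0 :> F)%:R = 1 :> K.
  by rewrite (bigD1 0) //= eqxx big1 ?addr0 // => t /negbTE->.
under eq_bigr do rewrite mulrBr mulr1.
rewrite sumrB (sum_cubic_character hchi) subr0 (bigD1 (-1)) //= addNr eqxx.
rewrite big1 ?addr0; first by rewrite (cubic_characterN1 hchi) mul1r.
by move=> t t1; rewrite addr_eq0 (negbTE t1) mulr0.
Qed.

(** Collecting the terms with s + t = r: for r != 0, scaling t by r leaves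
    chi(r)^2 times the Jacobi sum, and for r = 0 the sum of chi^2 vanishes. *)
Lemma gauss_sum_sqr :
  gauss_sum chi e ^+ 2 = jacobi_sum chi * gauss_sum (fun t => chi t ^+ 2) e.
Proof.
case: he => e0 eD _; rewrite expr2 mulr_sumr.
transitivity (\sum_t \sum_r chi (r - t) * chi t * e r).
  apply: eq_bigr => t _; rewrite mulr_suml [RHS](reindex_inj (addIr t)).
  by apply: eq_bigr => s _; rewrite addrK eD; ring.
rewrite exchange_big mulr_sumr; apply: eq_bigr => r _; rewrite -mulr_suml mulrA.
congr (_ * _); have [->|r0] := eqVneq r 0.
  rewrite (cubic_character0 hchi) expr0n mulr0.
  rewrite -[RHS](sum_cubic_character (cubic_character_sqr hchi)).
  apply: eq_bigr => t _; rewrite sub0r -mulN1r !(cubic_characterM hchi).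
  by rewrite (cubic_characterN1 hchi) mul1r.
rewrite (reindex_inj (mulfI r0)) /jacobi_sum mulr_suml; apply: eq_bigr => t _.
rewrite -{1}[r]mulr1 -mulrBr !(cubic_characterM hchi); ring.
Qed.

Lemma gauss_sum_cube : gauss_sum chi e ^+ 3 = #|F|%:R * jacobi_sum chi.
Proof.
by rewrite exprS gauss_sum_sqr mulrCA gauss_sumM mulrC.
Qed.

End GaussSum.

(** * The Jacobi sum of the residue character *)

(** For i > 0 some nonzero g has g^i != 1, and scaling by g multiplies the sum
    by g^i. *)
Lemma sum_expr_Fp (p i : nat) : prime p -> (i < p.-1)%N -> \sum_(t : 'F_p) t ^+ i = 0.
Proof.
move=> pp; case: i => [|i] ip.
  under eq_bigr do rewrite expr0.
  by rewrite sumr_const card_Fp // pchar_Fp_0.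
have [h|] := pselect (forall t : 'F_p, t != 0 -> t ^+ i.+1 = 1).
  have := @max_unity_roots _ i.+1 (enum (predC1 (0 : 'F_p))) isT.
  rewrite -cardE cardC1 card_Fp // leqNgt ip enum_uniq => allu.
  suff /allu/(_ isT) : all i.+1.-unity_root (enum (predC1 (0 : 'F_p))) by [].
  by apply/seq.allP => t; rewrite mem_enum inE => /h/unity_rootP.
move=> /existsNP[g /not_implyP[g0 /eqP g1]].
apply/eqP; rewrite -(mulIr_eq0 _ (mulIf (_ : g ^+ i.+1 - 1 != 0))); last first.
  by rewrite subr_eq0.
rewrite mulrBr mulr1 subr_eq0 mulr_suml; apply/eqP.
by rewrite [RHS](reindex_inj (mulIf g0)); apply: eq_bigr => t _; rewrite exprMn.
Qed.

Lemma sum_poly_Fp (p : nat) (f : {poly 'F_p}) : prime p -> (size f <= p.-1)%N ->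
  \sum_(t : 'F_p) f.[t] = 0.
Proof.
move=> pp fp; under eq_bigr do rewrite horner_coef.
rewrite exchange_big big1 // => i _; rewrite -mulr_sumr sum_expr_Fp ?mulr0 //.
exact: leq_trans fp.
Qed.

Lemma Fp_natr p (t : 'F_p) : t = (t : nat)%:R.
Proof. by rewrite [RHS]natr_Zp. Qed.

(** A root z of 1 + X + ... + X^(p-1) is a p-th root of unity, and differs from
    1 because p is nonzero in K. *)
Lemma additive_character_exists (K : closedFieldType) (p : nat) : prime p ->
  p%:R != 0 :> K -> exists e : 'F_p -> K, additive_character e.
Proof.
move=> pp pK; have p1 := prime_gt1 pp.
have [|z] := closed_rootP (\poly_(i < p) (1 : K)) _.
  by rewrite size_poly_eq ?oner_eq0 // gtn_eqF.
rewrite rootE horner_poly => hz.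
have z1 : z ^+ p = 1.
  apply/eqP; rewrite -subr_eq0 subrX1; move: hz.
  by under eq_bigr do rewrite mul1r; move=> /eqP->; rewrite mulr0.
exists (fun t : 'F_p => z ^+ t); split.
- by [].
- by move=> x y; rewrite {1}[x]Fp_natr {1}[y]Fp_natr -natrD val_Fp_nat // expr_mod ?exprD.
- exists 1; apply: contra_eq_neq (eqP hz) => e1.
  rewrite (eq_bigr (fun=> 1)) ?sumr_const ?card_ord // => i _.
  by rewrite mul1r -[z]expr1 e1 expr1n.
Qed.

(** The embedding of F_p onto the prime field of K. *)
Definition Fp_ev (K : fieldType) (p : nat) (pK : p \in [pchar K]) (t : 'F_p) : K :=
  (t : nat)%:R.

Section FpEv.
Variables (K : fieldType) (p : nat) (pK : p \in [pchar K]).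
Let pp : prime p := pcharf_prime pK.

Lemma Fp_ev_nat n : Fp_ev pK n%:R = n%:R.
Proof. by rewrite /Fp_ev val_Fp_nat // (GRing.natr_mod_pchar pK). Qed.

Lemma Fp_ev_nmod : nmod_morphism (Fp_ev pK).
Proof.
split=> [|x y]; first exact: (Fp_ev_nat 0).
by rewrite [x]Fp_natr [y]Fp_natr -natrD !Fp_ev_nat natrD.
Qed.
Lemma Fp_ev_monoid : monoid_morphism (Fp_ev pK).
Proof.
split=> [|x y]; first exact: (Fp_ev_nat 1).
by rewrite [x]Fp_natr [y]Fp_natr -natrM !Fp_ev_nat natrM.
Qed.
HB.instance Definition _ := GRing.isNmodMorphism.Build 'F_p K (Fp_ev pK) Fp_ev_nmod.
HB.instance Definition _ :=
  GRing.isMonoidMorphism.Build 'F_p K (Fp_ev pK) Fp_ev_monoid.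
End FpEv.

Section ResidueCharacter.
Variables (pi : eis) (p : nat).
Hypotheses (pip : eis_prime pi) (pi2 : eis_primary pi).
Hypotheses (pp : prime p) (npi : eis_norm pi = p).
Let pi3 := eis_primary_pm1 pi2.

Definition residue_character (t : 'F_p) : eis := cubic_residue_symbol (t : nat)%:R pi.

Lemma prime_dvd_norm : eis_dvd pi p%:R.
Proof. by rewrite pmulrn -npi; apply: eis_dvd_norm. Qed.

Lemma prime_norm_exp : p = (3 * cubic_exp pi + 1)%N.
Proof. by have := cubic_expE pi3; rewrite npi. Qed.

Lemma residue_character_nat n : residue_character n%:R = cubic_residue_symbol n%:R pi.
Proof.
apply: cubic_residue_symbol_mod => //; rewrite val_Fp_nat //.
rewrite {2}(divn_eq n p) natrD opprD addrCA subrr addr0 natrM.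
exact/eis_dvdN/eis_dvdMl/prime_dvd_norm.
Qed.

Lemma residue_character_value t : cubic_value (residue_character t).
Proof. exact: cubic_residue_symbol_value. Qed.

Lemma residue_characterM : {morph residue_character : x y / x * y}.
Proof.
move=> x y; rewrite {1}[x]Fp_natr {1}[y]Fp_natr -natrM residue_character_nat.
by rewrite natrM cubic_residue_symbolM.
Qed.

Lemma residue_character0 : residue_character 0 = 0.
Proof.
rewrite /residue_character /cubic_residue_symbol asboolT //; exact: eis_dvd0.
Qed.

Lemma residue_character_neq0 t : t != 0 -> residue_character t != 0.
Proof.
move=> t0; apply: cubic_residue_symbol_neq0 => //.
have : coprime p t.
  rewrite prime_coprime // gtnNdvd ?lt0n //.
  by rewrite -[X in (_ < X)%N](Fp_cast pp) ltn_ord.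
rewrite -[coprime _ _]/(coprimez p t) => /eis_coprime_int.
by apply: eis_coprime_dvdl; apply: prime_dvd_norm.
Qed.

Lemma residue_character1 : residue_character 1 = 1.
Proof.
apply: (mulfI (residue_character_neq0 (oner_neq0 _))).
by rewrite -residue_characterM !mulr1.
Qed.

Section AtPi.
Variables (K : fieldType) (phi : {rmorphism eis -> K}) (phi_pi : phi pi = 0).
Variable pK : p \in [pchar K].

Lemma residue_character_ev t :
  phi (residue_character t) = Fp_ev pK (t ^+ cubic_exp pi).
Proof.
have [_ ->] := cubic_residue_symbolP (t : nat)%:R pip pi2 phi_pi.
by rewrite rmorph_nat rmorphXn.
Qed.
End AtPi.

(** In a residue field the character is t^((p - 1) / 3), whose values sum to 0;
    the trivial character would sum to p - 1. *)
Lemma residue_character_nontrivial : exists2 t, t != 0 & residue_character t != 1.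
Proof.
apply: contrapT => triv; have [K [phi phi_pi]] := residue_exists pip.
have pK := rmorph_eis_pchar pp phi_pi prime_dvd_norm.
have e0 := cubic_exp_gt0 pip pi3.
have : \sum_t phi (residue_character t) = 0.
  under eq_bigr do rewrite (residue_character_ev phi_pi pK).
  rewrite -rmorph_sum sum_expr_Fp ?rmorph0 // [X in X.-1]prime_norm_exp; lia.
rewrite (bigD1 0) //= residue_character0 rmorph0 add0r.
rewrite (eq_bigr (fun=> 1)); last first.
  move=> t t0; have -> : residue_character t = 1; last by rewrite rmorph1.
  by apply/eqP; apply: contra_notT triv => t1; exists t.
rewrite sumr_const cardC1 card_Fp // => h.
have : p%:R = 1 :> K by rewrite -{1}(prednK (prime_gt0 pp)) -natr1 h add0r.
by rewrite pcharf0 // => /eqP; rewrite eq_sym oner_eq0.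
Qed.

Lemma cubic_residue_character : cubic_character residue_character.
Proof.
split; [exact: residue_character0|exact: residue_characterM| |].
  move=> t t0; apply: cubic_value3; last exact: residue_character_neq0.
  exact: residue_character_value.
exact: residue_character_nontrivial.
Qed.

Lemma cubic_residue_character_rmorph (K : fieldType) (phi : {rmorphism eis -> K}) :
  3 != 0 :> K -> cubic_character (fun t => phi (residue_character t)).
Proof.
move=> K3; have [c0 cM c3 [t t0 t1]] := cubic_residue_character; split.
- by rewrite c0 rmorph0.
- by move=> x y; rewrite cM rmorphM.
- by move=> u u0; rewrite -rmorphXn c3 ?rmorph1.
exists t => //; apply: contra_neq t1 => e.
apply: (cubic_value_inj K3 (residue_character_value t) cubic_value1 (phi := phi)).
by rewrite e rmorph1.
Qed.

Lemma int_rmorph_inj (phi : {rmorphism eis -> algC}) (m n : int) :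
  phi m%:~R = phi n%:~R -> m = n.
Proof. by rewrite !rmorph_int => /intr_inj. Qed.

Definition residue_jacobi_sum : eis :=
  \sum_t residue_character t * residue_character (1 - t).

Lemma rmorph_jacobi_sum (K : fieldType) (phi : {rmorphism eis -> K}) :
  jacobi_sum (fun t => phi (residue_character t)) = phi residue_jacobi_sum.
Proof.
rewrite /jacobi_sum rmorph_sum; apply: eq_bigr => t _; by rewrite rmorphM.
Qed.

Lemma cubic_value_sqr_conj s : cubic_value s -> eis_conj s = s ^+ 2.
Proof.
move=> hs; have [->|s0] := eqVneq s 0; first by rewrite rmorph0 expr0n.
by apply: (mulfI s0); rewrite cubic_value_conj // -exprS cubic_value3.
Qed.

(** In the complex algebraic numbers the Gauss sums g and g' of chi and of its
    conjugate satisfy g^3 = p J, g'^3 = p J' and g g' = p, where J' is the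
    conjugate of J. *)
Lemma residue_jacobi_sum_norm : eis_norm residue_jacobi_sum = p.
Proof.
have [phi _] := eis_rmorph_exists algC.
have p0 : p%:R != 0 :> algC by rewrite pnatr_eq0 -lt0n prime_gt0.
have K3 : 3 != 0 :> algC by rewrite pnatr_eq0.
have [e he] := additive_character_exists pp p0.
have hchi := cubic_residue_character_rmorph phi K3.
have g3 := gauss_sum_cube hchi he.
have g3' := gauss_sum_cube (cubic_character_sqr hchi) he.
have gg := gauss_sumM hchi he.
have eJ : jacobi_sum (fun t => phi (residue_character t) ^+ 2) =
    phi (eis_conj residue_jacobi_sum).
  rewrite /jacobi_sum !rmorph_sum; apply: eq_bigr => t _.
  by rewrite !rmorphM /= !(cubic_value_sqr_conj (residue_character_value _)) !rmorphXn.
apply: (@int_rmorph_inj phi); rewrite -eis_norm_conj rmorphM.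
rewrite rmorph_jacobi_sum in g3; rewrite eJ in g3'; rewrite card_Fp // in g3 g3' gg.
have p20 : (p%:R : algC) ^+ 2 != 0 by rewrite expf_eq0.
apply: (mulfI p20); rewrite -pmulrn rmorph_nat -exprSr -{2}gg exprMn g3 g3'; ring.
Qed.

(** Each product (chi(t) - 1) (chi(1 - t) - 1) is a multiple of 3: it is 0 for
    t = 0 and t = 1, and otherwise both factors are multiples of sqrt(-3). The
    sum of these products is J + p, because chi sums to 0, and p = 1 modulo 3. *)
Lemma residue_jacobi_sum_primary : eis_primary residue_jacobi_sum.
Proof.
have c3 s t : cubic_value s -> cubic_value t -> s != 0 -> t != 0 ->
    eis_dvd 3 ((s - 1) * (t - 1)).
  move=> hs ht; case: (cubic_value_cases hs) => ->; case: (cubic_value_cases ht) => ->;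
    rewrite ?eqxx // => _ _; rewrite ?subrr ?mul0r ?mulr0; try exact: eis_dvd0.
  - by exists (Eis 0 (-1)).
  - by exists (Eis 1 0).
  - by exists (Eis 1 0).
  - by exists (Eis 1 1).
have [z] : eis_dvd 3 (residue_jacobi_sum + p%:R).
  have -> : residue_jacobi_sum + p%:R =
      \sum_t (residue_character t - 1) * (residue_character (1 - t) - 1).
    have s0 := sum_cubic_character cubic_residue_character.
    have s1 : \sum_t residue_character (1 - t) = 0.
      rewrite -[RHS]s0 [RHS](reindex_inj (subrI 1)).
      by apply: eq_bigr => t _.
    transitivity (\sum_t (residue_character t * residue_character (1 - t)
        - residue_character t - residue_character (1 - t) + 1)); last first.
      by apply: eq_bigr => t _; ring.
    rewrite big_split !sumrB s0 s1 !subr0 sumr_const card_Fp //.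
  apply: big_ind => [|x y|t _]; [exact: eis_dvd0|exact: eis_dvdD|].
  have [->|t0] := eqVneq t 0.
    by rewrite subr0 residue_character1 subrr mulr0; apply: eis_dvd0.
  have [->|t1] := eqVneq t 1.
    by rewrite residue_character1 subrr mul0r; apply: eis_dvd0.
  apply: c3; try exact: residue_character_value.
    exact: residue_character_neq0.
  by apply: residue_character_neq0; rewrite subr_eq0 eq_sym.
have := prime_norm_exp => ep e.
have := congr1 ea e; have := congr1 eb e.
rewrite !eisS /eis_primary.
lia.
Qed.

End ResidueCharacter.

(** * Cubic reciprocity *)

(** Modulo pi the Jacobi sum is the sum of t^k (1 - t)^k with 3 k = p - 1, a
    polynomial of degree less than p - 1. *)
Lemma residue_jacobi_sum_dvd (pi : eis) (p : nat) :
  eis_prime pi -> eis_primary pi -> prime p -> eis_norm pi = p ->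
  eis_dvd pi (residue_jacobi_sum pi p).
Proof.
move=> pip pi2 pp npi; have pi3 := eis_primary_pm1 pi2.
have [K [phi phi_pi]] := residue_exists pip.
have pK := rmorph_eis_pchar pp phi_pi (prime_dvd_norm npi).
apply/(rmorph_eis_eq0 _ pip phi_pi); set k := cubic_exp pi.
have ep : p = (3 * k + 1)%N := prime_norm_exp pi2 npi.
have k0 : (0 < k)%N := cubic_exp_gt0 pip pi3.
pose f : {poly 'F_p} := 'X^k * (1 - 'X) ^+ k.
have sf : (size f <= p.-1)%N.
  rewrite size_monicM ?monicXn //; last first.
    by rewrite expf_eq0 k0 -size_poly_eq0 -opprB size_polyN size_XsubC.
  have : (size ((1 - 'X) ^+ k : {poly 'F_p}) <= k.+1)%N.
    apply: leq_trans (size_poly_exp_leq _ _) _.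
    by rewrite -opprB size_polyN size_XsubC mul1n.
  by rewrite size_polyXn; move: ep; lia.
rewrite -[RHS](rmorph0 (Fp_ev pK)) -(sum_poly_Fp pp sf) !rmorph_sum.
apply: eq_bigr => t _; rewrite rmorphM !(residue_character_ev pip pi2 phi_pi pK).
by rewrite -rmorphM /f !hornerE.
Qed.

(** Both are primary of norm p, and one divides the other. *)
Lemma residue_jacobi_sumE (pi : eis) (p : nat) :
  eis_prime pi -> eis_primary pi -> prime p -> eis_norm pi = p ->
  residue_jacobi_sum pi p = pi.
Proof.
move=> pip pi2 pp npi; have pi3 := eis_primary_pm1 pi2.
have [z ez] := residue_jacobi_sum_dvd pip pi2 pp npi.
have J2 := residue_jacobi_sum_primary pip pi2 pp npi.
have zu : eis_unit z.
  apply/eis_unitE; have := residue_jacobi_sum_norm pip pi2 pp npi.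
  rewrite ez eis_normM -npi -[RHS]mul1r; apply: mulIf.
  by rewrite eis_norm_eq0 eis_prime_neq0.
have z3 : eis_pm1 z by rewrite -(eis_pm1M _ pi3) mulrC -ez; apply: eis_primary_pm1.
have [z1|z1] := eis_unit_pm1 zu z3; first by rewrite ez z1 mul1r.
by move: J2 pi2; rewrite ez z1 /eis_primary !eisS; lia.
Qed.

(** Raising the Gauss sum of pi, whose cube is p pi, to the power N(lambda) in
    a field where lambda vanishes. *)
Lemma cubic_reciprocity_gauss (pi lam : eis) (p : nat) :
  eis_prime pi -> eis_primary pi -> prime p -> eis_norm pi = p ->
  eis_prime lam -> eis_primary lam -> eis_coprime lam p%:R ->
  cubic_residue_symbol (p%:R * pi) lam *
  cubic_residue_symbol (eis_norm lam)%:~R pi = 1.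
Proof.
move=> pip pi2 pp npi lp l2 lcop; have l3 := eis_primary_pm1 l2.
have [K [phi phi_l]] := residue_exists lp.
have K3 : 3 != 0 :> K := rmorph_eis_3 lp l3 phi_l.
have p0 : p%:R != 0 :> K.
  rewrite -(rmorph_nat phi); apply/eqP => /(rmorph_eis_eq0 _ lp phi_l).
  exact: eis_coprime_ndvd.
have [e he] := additive_character_exists pp p0.
have hchi := cubic_residue_character_rmorph pip pi2 pp npi phi K3.
have := gauss_sum_cube hchi he; set g := gauss_sum _ _.
rewrite rmorph_jacobi_sum residue_jacobi_sumE // card_Fp // => g3.
have g0 : g != 0.
  have: g ^+ 3 != 0.
    rewrite g3 mulf_neq0 //; apply: contraNneq p0 => pi0.
    by rewrite -(rmorph_nat phi) pmulrn -npi -eis_norm_conj rmorphM pi0 mul0r.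
  by rewrite expf_eq0.
have [n nE] : exists n : nat, eis_norm lam = n.
  by exists `|eis_norm lam|%N; have := eis_norm_ge0 lam; lia.
have [q qp lq] := eis_prime_over lp.
have qK := rmorph_eis_pchar qp phi_l lq.
have nnat : [pchar K].-nat n.
  have nq : [pchar K].-nat q by rewrite pnatE.
  by move: nE; case: (eis_prime_norm qp lp lq) => -> [<-] //; rewrite pnatX nq.
have nF : (n%:R : 'F_p) != 0.
  rewrite -(dvdn_pcharf (pchar_Fp pp)); apply/negP => pn.
  have pq : p = q.
    apply/eqP; rewrite -dvdn_prime2 //; move: nE pn.
    case: (eis_prime_norm qp lp lq) => -> [<-] //.
    by rewrite Euclid_dvdX // andbT.
  by move: lcop; rewrite pq => /(eis_coprime_ndvd lp).
have eN t : e t ^+ n = e (n%:R * t).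
  case: he => e0 eD _; elim: (n) => [|m IH]; first by rewrite mul0r e0.
  by rewrite exprS IH -eD -{1}[t]mul1r -mulrDl addrC natr1.
have gn : phi (residue_character pi (n%:R : 'F_p)) * g ^+ n = g.
  have gE : g ^+ n = \sum_t phi (residue_character pi t) * e (n%:R * t).
    rewrite /g /gauss_sum; elim/big_rec2: _ => [|t x y _ <-].
      by rewrite expr0n gtn_eqF //; case/andP: nnat.
    rewrite exprDn_pchar // exprMn eN; congr (_ * _ + _).
    have := rmorph_eis_norm (residue_character pi t) lp l3 phi_l.
    by rewrite nE.
  rewrite gE mulr_sumr [RHS](reindex_inj (mulfI nF)); apply: eq_bigr => t _.
  by rewrite mulrA -rmorphM -residue_characterM.
have n3k : n = (3 * cubic_exp lam + 1)%N by have := cubic_expE l3; rewrite nE.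
have [hx ex] := cubic_residue_symbolP (p%:R * pi) lp l2 phi_l.
have hn := cubic_residue_symbol_value pip pi2 (eis_norm lam)%:~R.
apply: (cubic_value_inj K3 (cubic_valueM hx hn) cubic_value1 (phi := phi)).
rewrite rmorph1 rmorphM ex; apply: (mulIf g0); rewrite mul1r -[RHS]gn.
have gX : g ^+ n = (p%:R * phi pi) ^+ cubic_exp lam * g.
  by rewrite n3k exprD expr1 exprM g3.
rewrite gX residue_character_nat // nE -pmulrn.
by rewrite rmorphM rmorph_nat; ring.
Qed.

Lemma Posz_sqr (n : nat) : (n ^ 2)%N = (n : int) ^+ 2 :> int.
Proof. by rewrite expr2 -PoszM. Qed.

Lemma cubic_jacobi_nat (m n : nat) : ~~ (3 %| n)%N -> coprime m n ->
  cubic_jacobi m%:R n%:R = 1.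
Proof. by move=> n3 mn; rewrite !pmulrn cubic_jacobi_int. Qed.

Lemma primary_prime_over (q : nat) : prime q -> q != 3%N ->
  exists l, [/\ eis_prime l, eis_primary l & eis_dvd l q%:R].
Proof.
move=> qp q3; have q_pm1 : eis_pm1 q%:R.
  by rewrite pmulrn eis_pm1_int dvdzE /= dvdn_prime2 // eq_sym.
have [[|l s] [sp qs]] := eis_pm1_factor q_pm1.
  have : eis_norm q%:R = 1 by case: qs => ->; rewrite big_nil.
  rewrite pmulrn eis_norm_int => /eqP; rewrite -[_ ^+ 2]/(q%:Z ^+ 2).
  have := prime_gt1 qp; nia.
have [lp l2] := sp l (mem_head _ _); exists l; split=> //.
case: qs => ->; rewrite big_cons; last apply: eis_dvdN.
  exact/eis_dvdMr/eis_dvd_refl.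
exact/eis_dvdMr/eis_dvd_refl.
Qed.

(** The symbol at a rational prime q in terms of one prime l over q, in the
    split case q = l l' and in the inert case q = l or q = - l. *)
Lemma cubic_jacobi_over (q : nat) l : prime q -> q != 3%N ->
  eis_prime l -> eis_primary l -> eis_dvd l q%:R ->
  [/\ eis_norm l = q & forall x, cubic_jacobi x q%:R =
       cubic_residue_symbol x l * eis_conj (cubic_residue_symbol (eis_conj x) l)] \/
  [/\ eis_norm l = (q ^ 2)%N, eis_dvd q%:R l
    & forall x, cubic_jacobi x q%:R = cubic_residue_symbol x l].
Proof.
move=> qp q3 lp l2 lq; have l3 := eis_primary_pm1 l2.
have q_pm1 : eis_pm1 q%:R by rewrite pmulrn eis_pm1_int dvdzE /= dvdn_prime2 // eq_sym.
have [zq ezq] := lq; case: (eis_prime_norm qp lp lq) => nl; [left|right].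
  split=> // x; have qE : q%:R = l * eis_conj l by rewrite eis_norm_conj nl.
  have lp' := eis_primeJ lp; have l2' := eis_primaryJ l2.
  rewrite qE cubic_jacobiMr ?(eis_primary_pm1 l2') // !cubic_jacobi_prime //.
  by rewrite -cubic_residue_symbolJ // eis_conjK.
have zu : eis_unit zq.
  have := congr1 eis_norm ezq; rewrite pmulrn eis_norm_int eis_normM nl eis_unitE.
  rewrite Posz_sqr -[X in X = _ -> _]mul1r => /mulIf<- //.
  by rewrite expf_eq0 /= gt_eqF //= ltz_nat prime_gt0.
have z3 : eis_pm1 zq by rewrite -(eis_pm1M _ l3) mulrC -ezq.
split=> // [|x].
  by case: zu => z ez; exists z; rewrite ezq mulrA [z * _]mulrC ez mul1r.
rewrite -(cubic_jacobi_prime x lp l2) ezq.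
by have [->|->] := eis_unit_pm1 zu z3; rewrite ?mul1r // mulN1r cubic_jacobiNr.
Qed.

(** The symbols of pi at the primes over q are read off Gauss's formula, both
    when q splits (norm q) and when q is inert (norm q^2). *)
Lemma cubic_reciprocity_split (pi : eis) (p q : nat) :
  eis_prime pi -> eis_primary pi -> prime p -> eis_norm pi = p ->
  prime q -> q != 3%N -> p != q ->
  cubic_residue_symbol q%:R pi = cubic_jacobi pi q%:R.
Proof.
move=> pip pi2 pp npi qp q3 pq.
have cpq : coprime p q by rewrite prime_coprime // dvdn_prime2.
have [l [lp l2 lq]] := primary_prime_over qp q3.
have lcop : eis_coprime l p%:R.
  apply: eis_coprime_dvdl lq _; apply: (@eis_coprime_int q p).
  by rewrite coprimezE /= coprime_sym.
have := cubic_reciprocity_gauss pip pi2 pp npi lp l2 lcop.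
have pic : eis_coprime pi q%:R.
  apply: eis_coprime_dvdl (prime_dvd_norm npi) _; exact: (@eis_coprime_int p q).
have s3 : cubic_residue_symbol q%:R pi ^+ 3 = 1.
  apply: cubic_value3; first exact: cubic_residue_symbol_value.
  exact: cubic_residue_symbol_neq0.
have q_pm1 : eis_pm1 q%:R by rewrite pmulrn eis_pm1_int dvdzE /= dvdn_prime2 // eq_sym.
have [[nl jE]|[nl _ jE]] := cubic_jacobi_over qp q3 lp l2 lq; rewrite nl; last first.
  rewrite -jE cubic_jacobiMl // cubic_jacobi_nat ?dvdn_prime2 1?eq_sym // mul1r.
  rewrite -pmulrn natrX expr2 cubic_residue_symbolM //.
  move: (cubic_residue_symbol _ pi) s3 (cubic_jacobi pi _) => s s3 b e.
  by rewrite -[LHS]mul1r -{1}e -[RHS]mulr1 -s3; ring.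
rewrite jE -pmulrn (_ : p%:R = pi * eis_conj pi); last by rewrite eis_norm_conj npi.
rewrite !cubic_residue_symbolM //.
have ha := cubic_residue_symbol_value lp l2 pi.
have hb := cubic_residue_symbol_value lp l2 (eis_conj pi).
move: (cubic_residue_symbol pi l) (cubic_residue_symbol (eis_conj pi) l) ha hb => a b ha hb.
move: (cubic_residue_symbol _ pi) s3 => s s3 e.
have a0 : a != 0 by apply: contra_eq_neq e => ->; rewrite !mul0r eq_sym oner_eq0.
have b0 : b != 0 by apply: contra_eq_neq e => ->; rewrite !(mul0r, mulr0) eq_sym oner_eq0.
have a3 := cubic_value3 ha a0; have bb := cubic_value_conj hb b0.
rewrite -[RHS]mul1r -{1}e -[LHS]mulr1 -[X in _ * X]bb -[LHS]mulr1 -{1}a3; ring.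
Qed.

Lemma cubic_reciprocity_prime (pi : eis) (q : nat) :
  eis_prime pi -> eis_primary pi -> prime q -> q != 3%N -> eis_coprime pi q%:R ->
  cubic_residue_symbol q%:R pi = cubic_jacobi pi q%:R.
Proof.
move=> pip pi2 qp q3 co; have pi3 := eis_primary_pm1 pi2.
have q3' : ~~ (3 %| q%:Z)%Z by rewrite dvdzE /= dvdn_prime2 // eq_sym.
have [p pp pip'] := eis_prime_over pip.
have pq : p != q by apply/eqP => pq; apply: (eis_coprime_ndvd pip co); rewrite -pq.
have [np|np] := eis_prime_norm pp pip pip'; first exact: cubic_reciprocity_split np _ _ _.
have [z ez] := pip'.
have zu : eis_unit z.
  have := congr1 eis_norm ez; rewrite pmulrn eis_norm_int eis_normM np eis_unitE.
  rewrite Posz_sqr -[X in X = _ -> _]mul1r => /mulIf<- //.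
  by rewrite expf_eq0 /= gt_eqF //= ltz_nat prime_gt0.
have p3 := eis_over_neq3 pp pip pi3 pip'.
have p3' : ~~ (3 %| p%:Z)%Z by rewrite dvdzE /= dvdn_prime2 // eq_sym.
have cpq : coprimez p q by rewrite coprimezE /= prime_coprime // dvdn_prime2.
have z3 : eis_pm1 z.
  by rewrite -(eis_pm1M _ pi3) mulrC -ez pmulrn eis_pm1_int.
rewrite -cubic_jacobi_prime //.
have [m [pim m3 cm]] : exists m : int, [/\ pi = m%:~R, ~~ (3 %| m)%Z & coprimez m q].
  have [z1|z1] := eis_unit_pm1 zu z3; rewrite z1 in ez.
    by exists p; rewrite -pmulrn ez mul1r.
  exists (- p%:Z); rewrite rpredN coprimezE abszN -coprimezE; split=> //.
  by rewrite rmorphN /= -pmulrn ez mulN1r opprK.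
rewrite pim !pmulrn !cubic_jacobi_int //; first by rewrite coprimez_sym.
Qed.

(** Both sides are multiplicative in n and in d, and signs are cubes; this
    leaves a prime number and a primary prime. *)
Lemma cubic_reciprocity (n : int) (d : eis) :
  ~~ (3 %| n)%Z -> eis_pm1 d -> eis_coprime d n%:~R ->
  cubic_jacobi n%:~R d = cubic_jacobi d n%:~R.
Proof.
move=> n3 d3; have n_pm1 : eis_pm1 n%:~R by rewrite eis_pm1_int.
move: d d3; apply: eis_pm1_ind => [_|d d3 IH co|pi d pip pi2 d3 IH co].
- by rewrite cubic_jacobi1r cubic_jacobi1l.
- rewrite cubic_jacobiNr // cubic_jacobiNl // IH //.
  by apply: eis_coprime_dvdl co; exists (-1); ring.
rewrite cubic_jacobi_primeMr // cubic_jacobiMl // IH; last first.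
  by apply: eis_coprime_dvdl co; apply/eis_dvdMl/eis_dvd_refl.
congr (_ * _).
have {IH d d3}co : eis_coprime pi n%:~R.
  by apply: eis_coprime_dvdl co; apply/eis_dvdMr/eis_dvd_refl.
rewrite -cubic_jacobi_prime //; have pi3 := eis_primary_pm1 pi2.
have main (m : nat) : ~~ (3 %| m)%N -> eis_coprime pi m%:R ->
    cubic_jacobi m%:R pi = cubic_jacobi pi m%:R.
  have [k] := ubnP m; elim: k m => // k IH m mk m3 com.
  have m0 : (0 < m)%N by case: (m) m3.
  have [m1|m1] := leqP m 1.
    by rewrite (_ : m = 1%N) ?cubic_jacobi1l ?cubic_jacobi1r //; lia.
  have qp := pdiv_prime m1; move: (pdiv m) (pdiv_dvd m) qp => q /dvdnP[j em] qp.
  have j3 : ~~ (3 %| j)%N by apply: contra m3 => h; rewrite em dvdn_mulr.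
  have q3 : ~~ (3 %| q)%N by apply: contra m3 => h; rewrite em dvdn_mull.
  have jk : (j < k)%N.
    have j0 : (0 < j)%N by case: (j) j3.
    by apply: leq_trans (ltn_Pmulr (prime_gt1 qp) j0) _; rewrite -em.
  rewrite em natrM in com *; rewrite cubic_jacobiMl // cubic_jacobiMr; first last.
  - by rewrite pmulrn eis_pm1_int.
  - by rewrite pmulrn eis_pm1_int.
  congr (_ * _).
    by apply: IH => //; apply: eis_coprime_dvdr com; apply/eis_dvdMr/eis_dvd_refl.
  rewrite cubic_jacobi_prime // cubic_reciprocity_prime //.
    by move: q3; rewrite dvdn_prime2 // eq_sym.
  by apply: eis_coprime_dvdr com; apply/eis_dvdMl/eis_dvd_refl.
case: n n3 n_pm1 co => m m3 m_pm1 co; first by rewrite -pmulrn main.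
have eN : (Negz m)%:~R = - (m.+1)%:R :> eis by rewrite NegzE rmorphN.
have m3' : ~~ (3 %| m.+1)%N by rewrite dvdzE in m3.
have {}co : eis_coprime pi m.+1%:R.
  by rewrite -[_%:R]opprK -eN; apply: eis_coprimeN.
rewrite eN eis_pm1N in m_pm1.
by rewrite eN cubic_jacobiNl // cubic_jacobiNr // main.
Qed.

(** * The symbol on equivalent forms *)

Lemma dvdz3_sixth (q : int) : ~~ (3 %| q)%Z -> (9 %| q ^+ 6 - 1)%Z.
Proof.
move=> q3; have [t [->|->]] : exists t, q = 3 * t + 1 \/ q = 3 * t - 1.
    by exists ((q + 1) %/ 3)%Z; lia.
- apply/dvdzP.
  exists ((3 * t ^+ 3 + 3 * t ^+ 2 + t) * (27 * t ^+ 3 + 27 * t ^+ 2 + 9 * t + 2)).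
  by ring.
- apply/dvdzP.
  exists ((3 * t ^+ 3 - 3 * t ^+ 2 + t) * (27 * t ^+ 3 - 27 * t ^+ 2 + 9 * t - 2)).
  by ring.
Qed.

(** Elements of norm Q y^2 + 27 (u^2 - D y^2); for y = 1 and u = b this is the
    top argument of the symbol of the form (a, 2b, c). *)
Definition norm_form_elt (P y u : int) : eis := (P * y)%:~R - 3 * u%:~R * sqrtm3.

Lemma norm_form_eltE P y u : norm_form_elt P y u = Eis (P * y - 3 * u) (- 6 * u).
Proof.
by rewrite /norm_form_elt /sqrtm3; apply: eis_ext; rewrite !eisS /=; ring.
Qed.

Lemma norm_form_elt_norm P y u :
  eis_norm (norm_form_elt P y u) = P ^+ 2 * y ^+ 2 + 27 * u ^+ 2.
Proof. by rewrite norm_form_eltE /eis_norm /=; ring. Qed.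

Section NormForm.
Variables (P Q q0 n y u : int) (q1 : nat).
Hypotheses (hQq : Q = 2 ^+ q1 * q0 ^+ 3).
Hypotheses (hn : P ^+ 2 * y ^+ 2 + 27 * u ^+ 2 = Q * y ^+ 2 + 27 * n).
Hypotheses (uy : coprimez u y) (nQ : coprimez n Q) (ny : coprimez n y).
Hypotheses (n3 : ~~ (3 %| n)%Z) (y3 : ~~ (3 %| y)%Z).
Hypothesis even_ok : (0 < q1)%N -> coprimez (P * y + u) 2.
Let beta := norm_form_elt P y u.

Lemma norm_form_elt_coprime : eis_coprime n%:~R (eis_norm beta)%:~R.
Proof.
apply: (@eis_coprime_mod _ (Q * y ^+ 2)%:~R).
  exists (- 27); rewrite norm_form_elt_norm hn -rmorphB /= -[- 27]/((- 27)%:~R) -intrM.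
  by congr _%:~R; ring.
by apply: eis_coprime_int; rewrite coprimezMr nQ coprimezXr.
Qed.

(** By reciprocity (n / delta) = (Q y^2 / delta), because 27 n + Q y^2 is the
    norm of beta; flipping 2 and y back, their symbols at beta are trivial,
    so that only the powers of omega split off from beta remain. *)
Lemma cubic_jacobi_norm_form (k j : nat) (d : eis) :
  eis_pm1 d -> beta = sqrtm3 ^+ k * omega ^+ j * d ->
  j = 0%N \/ (9 %| n ^+ 2 - (2 ^+ q1 * y ^+ 2) ^+ 2)%Z ->
  cubic_jacobi beta n%:~R = 1.
Proof.
move=> d3 eb hj.
have jE (m : int) : ~~ (3 %| m)%Z -> cubic_jacobi beta m%:~R =
    cubic_jacobi omega m%:~R ^+ j * cubic_jacobi d m%:~R.
  move=> m3; have m_pm1 : eis_pm1 m%:~R by rewrite eis_pm1_int.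
  by rewrite eb !cubic_jacobiMl // !cubic_jacobiXl // cubic_jacobi_sqrtm3 // expr1n mul1r.
have dN : eis_dvd d (eis_norm beta)%:~R.
  apply: eis_dvd_trans (eis_dvd_norm _); rewrite eb; exact/eis_dvdMl/eis_dvd_refl.
have dn : eis_coprime d n%:~R.
  exact/eis_coprime_sym/(eis_coprime_dvdr dN)/norm_form_elt_coprime.
have d3' : eis_coprime d 3.
  apply: eis_coprime_dvdl (eis_dvd_norm d) _; apply: (@eis_coprime_int _ 3).
  rewrite coprimez_sym coprimezE prime_coprime //.
  by have := eis_norm_pm1 d3; rewrite dvdzE.
have mod_d : eis_dvd d ((- (27 * n))%:~R - (Q * y ^+ 2)%:~R).
  have -> : (- (27 * n))%:~R - (Q * y ^+ 2)%:~R = - (eis_norm beta)%:~R :> eis.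
    by rewrite -rmorphB -rmorphN norm_form_elt_norm hn; congr _%:~R; ring.
  exact: eis_dvdN.
have e27 : 27%:~R = 3 ^+ 3 :> eis by [].
have dQ : eis_coprime d (Q * y ^+ 2)%:~R.
  apply: (eis_coprime_mod mod_d); rewrite rmorphN /= intrM; apply: eis_coprimeN.
  by apply: eis_coprimeMr => //; rewrite e27; apply: eis_coprimeX.
have dvdQ (m : int) : (m %| Q * y ^+ 2)%Z -> eis_coprime d m%:~R.
  by move=> /eis_dvd_int/eis_coprime_dvdr; apply.
have dy : eis_coprime d y%:~R by apply: dvdQ; rewrite expr2 !dvdz_mull.
have dq : eis_coprime d q0%:~R.
  by apply: dvdQ; rewrite hQq exprSr dvdz_mulr // !dvdz_mull.
have y_pm1 : eis_pm1 y%:~R by rewrite eis_pm1_int.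
have nE : cubic_jacobi n%:~R d = cubic_jacobi d 2%:~R ^+ q1 * cubic_jacobi d y%:~R ^+ 2.
  have -> : cubic_jacobi n%:~R d = cubic_jacobi (- (27 * n))%:~R d.
    rewrite rmorphN /= cubic_jacobiNl // intrM cubic_jacobiMl //.
    by rewrite e27 cubic_jacobi_cube // mul1r.
  have eQ : (Q * y ^+ 2)%:~R = 2%:~R ^+ q1 * q0%:~R ^+ 3 * y%:~R ^+ 2 :> eis.
    by rewrite hQq !intrM !rmorphXn.
  rewrite (cubic_jacobi_mod d3 mod_d) eQ.
  rewrite (cubic_jacobiMl d3 (_ * _)) (cubic_jacobiMl d3 (_ ^+ q1)).
  rewrite !(cubic_jacobiXl d3) (cubic_jacobi_coprime3 d3 dq) // mulr1.
  rewrite (cubic_reciprocity y3 d3 dy); congr (_ * _).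
  case: (posnP q1) => [->//|q1p]; congr (_ ^+ _); apply: (@cubic_reciprocity 2) => //.
  apply: dvdQ; rewrite hQq -(prednK q1p) exprS -!mulrA dvdz_mulr //.
have bY : cubic_jacobi beta y%:~R = 1.
  have -> : cubic_jacobi beta y%:~R = cubic_jacobi ((- 3 * u)%:~R * sqrtm3) y%:~R.
    apply: cubic_jacobi_mod => //; exists P%:~R.
    by rewrite /beta /norm_form_elt !intrM -[(-3)%:~R]/(-3); ring.
  rewrite cubic_jacobiMl // cubic_jacobi_sqrtm3 // mulr1 cubic_jacobi_int //.
  by rewrite coprimezMl uy andbT coprimezE /= prime_coprime.
have b2 : (0 < q1)%N -> cubic_jacobi beta 2%:~R = 1.
  move=> q1p; have -> : cubic_jacobi beta 2%:~R = cubic_jacobi (P * y + u)%:~R 2%:~R.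
    apply: cubic_jacobi_mod => //; exists (Eis (- 2 * u) (- 3 * u)).
    by rewrite /beta norm_form_eltE; apply: eis_ext; rewrite !eisS /=; ring.
  by rewrite cubic_jacobi_int // even_ok.
have wE : cubic_jacobi omega n%:~R ^+ j =
    (cubic_jacobi omega 2%:~R ^+ q1 * cubic_jacobi omega y%:~R ^+ 2) ^+ j.
  case: hj => [->//|h9]; congr (_ ^+ _).
  have m3 : ~~ (3 %| 2 ^+ q1 * y ^+ 2)%Z.
    by move: y3; rewrite !dvdzE abszM !abszX /= Euclid_dvdM // !Euclid_dvdX // andbT.
  rewrite (cubic_jacobi_omega_int n3 m3 h9) intrM.
  rewrite [(2 ^+ q1)%:~R]rmorphXn [(y ^+ 2)%:~R]rmorphXn /=.
  have pm2 : eis_pm1 (2%:~R ^+ q1).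
    elim: (q1) => [|i IH] //; by rewrite exprS eis_pm1M.
  rewrite cubic_jacobiMr //; last by rewrite expr2 eis_pm1M.
  congr (_ * _).
    elim: (q1) => [|i IH]; first by rewrite cubic_jacobi1r.
    by rewrite !exprS cubic_jacobiMr ?IH //; elim: (i) => // m hm; rewrite exprS eis_pm1M.
  by rewrite !expr2 cubic_jacobiMr.
rewrite (jE n n3) -(cubic_reciprocity n3 d3 dn) nE wE.
have y1 : cubic_jacobi omega y%:~R ^+ j * cubic_jacobi d y%:~R = 1 by rewrite -jE.
have -> : forall a b c e : eis, (a ^+ q1 * b ^+ 2) ^+ j * (c ^+ q1 * e ^+ 2) =
    (a ^+ j * c) ^+ q1 * (b ^+ j * e) ^+ 2.
  move=> a b c e; rewrite (exprMn _ (a ^+ q1)) (exprMn _ (a ^+ j)) (exprMn _ (b ^+ j)).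
  by rewrite (exprAC a) (exprAC b) mulrACA.
rewrite y1 expr1n mulr1; case: (posnP q1) => [->//|q1p].
by rewrite -jE // b2 // expr1n.
Qed.

End NormForm.

Section Invariance.
Variables (P D Q q0 : int) (q1 : nat).
Hypotheses (hP : ~~ (3 %| P)%Z \/ (27 %| P)%Z).
Hypotheses (hQ : Q = P ^+ 2 + 27 * D) (hQq : Q = 2 ^+ q1 * q0 ^+ 3).

(** With D0 = Q / 27, here 3 divides q0, so D0 is 2^q1 times a cube t^3; and n
    is - D0 y^2 modulo 9, while t^6 = 1 modulo 9 because 3 does not divide t. *)
Lemma norm_form_mod9 (P' n y u : int) : P = 27 * P' -> n = u ^+ 2 - D * y ^+ 2 ->
  ~~ (3 %| n)%Z -> (3 %| u)%Z -> (9 %| n ^+ 2 - (2 ^+ q1 * y ^+ 2) ^+ 2)%Z.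
Proof.
move=> eP en n3 /dvdzP[u' eu].
have [t et] : exists t, q0 = 3 * t.
  have : (3 %| 2 ^+ q1 * q0 ^+ 3)%Z.
    by apply/dvdzP; exists (9 * 27 * P' ^+ 2 + 9 * D); rewrite -hQq hQ eP; ring.
  rewrite dvdzE abszM !abszX Euclid_dvdM // !Euclid_dvdX // andbT /=.
  move=> h; have /dvdzP[t ->] : (3 %| q0)%Z by rewrite dvdzE.
  by exists t; rewrite mulrC.
have D0 : 27 * P' ^+ 2 + D = 2 ^+ q1 * t ^+ 3.
  apply: (@mulfI _ 27) => //; transitivity Q; first by rewrite hQ eP; ring.
  by rewrite hQq et; ring.
have t3 : ~~ (3 %| t)%Z.
  apply: contra n3 => /dvdzP[s es]; rewrite en (_ : D = 2 ^+ q1 * t ^+ 3 - 27 * P' ^+ 2).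
    apply/dvdzP; exists (3 * u' ^+ 2 - (2 ^+ q1 * 9 * s ^+ 3 - 9 * P' ^+ 2) * y ^+ 2).
    by rewrite es eu; ring.
  by rewrite -D0; ring.
have /dvdzP[s es] := dvdz3_sixth t3.
have -> : n = 9 * (u' ^+ 2 + 3 * P' ^+ 2 * y ^+ 2) - 2 ^+ q1 * t ^+ 3 * y ^+ 2.
  by rewrite -D0 en eu; ring.
set w := 2 ^+ q1; set v := u' ^+ 2 + _.
apply/dvdzP; exists (9 * v ^+ 2 - 2 * v * (w * t ^+ 3 * y ^+ 2) + s * (w * y ^+ 2) ^+ 2).
have -> : (9 * v - w * t ^+ 3 * y ^+ 2) ^+ 2 - (w * y ^+ 2) ^+ 2 =
  81 * v ^+ 2 - 18 * v * (w * t ^+ 3 * y ^+ 2) + (t ^+ 6 - 1) * (w * y ^+ 2) ^+ 2 by ring.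
by rewrite es; ring.
Qed.

(** If 3 does not divide P, then beta is itself 1 or -1 modulo 3. If P = 27 P',
    then beta is sqrt(-3)^3 times u + 3 P' y sqrt(-3), which is 1 or -1 modulo
    3 unless 3 divides u; in that last case n is known modulo 9. *)
Lemma cubic_jacobi_norm_value (n y u : int) : n = u ^+ 2 - D * y ^+ 2 ->
  coprimez u y -> coprimez n Q -> ~~ (3 %| n)%Z -> ~~ (3 %| y)%Z ->
  cubic_jacobi (norm_form_elt P y u) n%:~R = 1.
Proof.
move=> en uy nQ n3 y3; have n_pm1 : eis_pm1 n%:~R by rewrite eis_pm1_int.
have hn : P ^+ 2 * y ^+ 2 + 27 * u ^+ 2 = Q * y ^+ 2 + 27 * n.
  by rewrite hQ en; ring.
have ny : coprimez n y.
  rewrite en coprimez_sym /coprimez (_ : u ^+ 2 - _ = (- D * y) * y + u ^+ 2); last by ring.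
  by rewrite gcdzMDl -/(coprimez _ _) coprimezXr // coprimez_sym.
have even_ok : (0 < q1)%N -> coprimez (P * y + u) 2.
  move=> q1p; rewrite coprimez_sym coprimezE /= prime_coprime //.
  apply/negP; rewrite -[(2 %| _)%N]/(2 %| P * y + u)%Z => /dvdzP[s es].
  have [Q' eQ] : exists Q', Q = 2 * Q'.
    by exists (2 ^+ q1.-1 * q0 ^+ 3); rewrite hQq -{1}(prednK q1p) exprS mulrA.
  have : (2 %| gcdz n Q)%Z.
    rewrite dvdz_gcd eQ dvdz_mulr // andbT; apply/dvdzP.
    exists (2 * s ^+ 2 - 2 * s * P * y + (Q' - 14 * D) * y ^+ 2).
    rewrite en (_ : u = 2 * s - P * y); last by rewrite mulrC -es; ring.
    have -> : (2 * s - P * y) ^+ 2 - D * y ^+ 2 =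
      4 * s ^+ 2 - 4 * s * P * y + (P ^+ 2 + 27 * D - 28 * D) * y ^+ 2 by ring.
    by rewrite -hQ eQ; ring.
  by rewrite (eqP nQ).
have main := cubic_jacobi_norm_form hQq hn uy nQ ny n3 y3 even_ok.
have [P3|P27] := hP.
  have b3 : eis_pm1 (norm_form_elt P y u).
    have : ~~ (3 %| P * y)%Z.
      by rewrite dvdzE abszM Euclid_dvdM // negb_or; apply/andP.
    by rewrite norm_form_eltE /eis_pm1 /=; move: (P * y) => v; lia.
  by apply: (main 0%N 0%N _ b3); [rewrite !mul1r|left].
have [P' eP] : exists P', P = 27 * P' by case/dvdzP: P27 => P' ->; exists P'; rewrite mulrC.
have [u3|u3] := boolP (3 %| u)%Z; last first.
  apply: (main 3%N 0%N (Eis (u + 3 * P' * y) (6 * P' * y))); last by left.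
    by rewrite /eis_pm1 /= -!mulrA; move: (P' * y) => v; lia.
  rewrite mulr1 norm_form_eltE (_ : sqrtm3 ^+ 3 = Eis (-3) (-6)) //.
  by apply: eis_ext; rewrite !eisS /= ?eP; ring.
(* A zero element has norm 0, which is prime to n only if n = 1 or n = -1. *)
have [b0|b0] := eqVneq (norm_form_elt P y u) 0; last first.
  have [k [j [d [d3 ed]]]] := eis_decompose b0.
  by apply: (main k j d d3 ed); right; exact: norm_form_mod9 eP en n3 u3.
have := norm_form_elt_coprime hn nQ ny; rewrite b0 => -[v [w]].
rewrite mulr0 addr0 => vn.
have nu : eis_unit n%:~R by exists v; rewrite mulrC.
by have [->|->] := eis_unit_pm1 nu n_pm1; rewrite ?cubic_jacobiNr ?cubic_jacobi1r.
Qed.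

Lemma chi_symbolE (a b : int) : chi_symbol P a b = cubic_jacobi (norm_form_elt P 1 b) a%:~R.
Proof. by rewrite /chi_symbol /norm_form_elt mulr1. Qed.

Lemma chi_symbol_mod (a b b' : int) : ~~ (3 %| a)%Z -> (a %| b - b')%Z ->
  chi_symbol P a b = chi_symbol P a b'.
Proof.
move=> a3 /dvdzP[k e]; rewrite !chi_symbolE; apply: cubic_jacobi_mod.
  by rewrite eis_pm1_int.
exists (- (3 * k%:~R * sqrtm3)).
rewrite /norm_form_elt -[b](subrK b') e intrD [(k * a)%:~R]intrM; ring.
Qed.

Lemma chi_symbolM (a a' b : int) : ~~ (3 %| a)%Z -> ~~ (3 %| a')%Z ->
  chi_symbol P (a * a') b = chi_symbol P a b * chi_symbol P a' b.
Proof. by move=> a3 a3'; rewrite /chi_symbol intrM cubic_jacobiMr // eis_pm1_int. Qed.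

Lemma chi_symbol_scale (a b y u : int) : ~~ (3 %| a)%Z -> coprimez y a ->
  (a %| b * y - u)%Z -> chi_symbol P a b = cubic_jacobi (norm_form_elt P y u) a%:~R.
Proof.
move=> a3 ya /dvdzP[k e]; have a_pm1 : eis_pm1 a%:~R by rewrite eis_pm1_int.
rewrite chi_symbolE; transitivity (cubic_jacobi (y%:~R * norm_form_elt P 1 b) a%:~R).
  by rewrite cubic_jacobiMl // cubic_jacobi_int // mul1r.
apply: cubic_jacobi_mod => //; exists (- (3 * k%:~R * sqrtm3)).
rewrite /norm_form_elt mulr1 (_ : u = b * y - k * a); last by rewrite -e; ring.
by rewrite !intrM intrB !intrM; ring.
Qed.

(** With g = gcd(r, a), the symbols at g agree because b' = b modulo g; the
    other two multiply to the symbol of an element of norm Q y^2 + 27 n at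
    n = u^2 - D y^2. *)
Lemma chi_symbol_transition (a b c p q r s : int) :
  b ^+ 2 - a * c = D -> p * s - q * r = 1 ->
  let a' := a * p ^+ 2 + 2 * b * p * r + c * r ^+ 2 in
  let b' := a * p * q + b * (p * s + q * r) + c * r * s in
  coprimez a Q -> ~~ (3 %| a)%Z -> coprimez a' Q -> ~~ (3 %| a')%Z -> ~~ (3 %| r)%Z ->
  chi_symbol P a b = chi_symbol P a' b'.
Proof.
move=> hD det a' b' aQ a3 aQ' a3' r3.
have g0 : gcdz r a != 0.
  by rewrite gcdz_eq0 negb_and; apply/orP; left; apply: contraNneq r3 => ->.
set g := gcdz r a in g0.
have [y1 er] : exists y1, r = y1 * g by apply/dvdzP; apply: dvdz_gcdl.
have [a1 ea] : exists a1, a = a1 * g by apply/dvdzP; apply: dvdz_gcdr.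
have ya : coprimez y1 a1.
  have [v [w e]] := Bezoutz r a.
  apply/coprimezP; exists (v, w); apply: (mulIf g0).
  by rewrite mul1r [RHS](esym e) [in RHS]er [in RHS]ea; ring.
pose a1' := a1 * p ^+ 2 + 2 * b * p * y1 + c * y1 * r.
have ea' : a' = a1' * g by rewrite /a' /a1' ea er; ring.
pose u := a1 * p + b * y1.
have det' : s * p + (- q * g) * y1 = 1 by rewrite -det er; ring.
have py : coprimez p y1 by apply/coprimezP; exists (s, - q * g).
have uy : coprimez u y1.
  rewrite coprimez_sym /coprimez /u addrC gcdzMDl -/(coprimez _ _).
  by rewrite coprimezMr ya coprimez_sym.
have ya' : coprimez y1 a1'.
  rewrite /coprimez (_ : a1' = (2 * b * p + c * r) * y1 + a1 * p ^+ 2); last first.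
    by rewrite /a1'; ring.
  by rewrite gcdzMDl -/(coprimez _ _) coprimezMr ya coprimezXr // coprimez_sym.
have en : a1 * a1' = u ^+ 2 - D * y1 ^+ 2.
  by rewrite -hD /a1' /u ea er; ring.
have M3 (m k : int) : ~~ (3 %| m * k)%Z -> ~~ (3 %| m)%Z /\ ~~ (3 %| k)%Z.
  move=> h; split; apply: contra h => ?; by [apply: dvdz_mulr|apply: dvdz_mull].
have [a13 g3] : ~~ (3 %| a1)%Z /\ ~~ (3 %| g)%Z by apply: M3; rewrite -ea.
have [a13' _] : ~~ (3 %| a1')%Z /\ ~~ (3 %| g)%Z by apply: M3; rewrite -ea'.
have [y3 _] : ~~ (3 %| y1)%Z /\ ~~ (3 %| g)%Z by apply: M3; rewrite -er.
have n3 : ~~ (3 %| a1 * a1')%Z by rewrite !dvdzE abszM Euclid_dvdM // negb_or; apply/andP.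
have nQ : coprimez (a1 * a1') Q.
  move: aQ aQ'; rewrite ea ea' !coprimezMl => /andP[-> _] /andP[-> _] //.
have := cubic_jacobi_norm_value en uy nQ n3 y3.
have p1 : eis_pm1 a1%:~R by rewrite eis_pm1_int.
have p1' : eis_pm1 a1'%:~R by rewrite eis_pm1_int.
rewrite intrM cubic_jacobiMr // => e.
rewrite ea' {1}ea !chi_symbolM // (@chi_symbol_mod g b b') //; last first.
  apply/dvdzP; exists (- (a1 * p * q + 2 * b * q * y1 + c * y1 * s)).
  rewrite /b' (_ : p * s = 1 + q * r); last by rewrite -det; ring.
  by rewrite er ea; ring.
congr (_ * _).
rewrite (@chi_symbol_scale a1 b y1 u) //; last first.
  by apply/dvdzP; exists (- p); rewrite /u; ring.
rewrite (@chi_symbol_scale a1' b' y1 (- u)) //; last first.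
  apply/dvdzP; exists s; apply: (mulIf g0); transitivity (b' * r + 1 * (a * p + b * r)).
    have eu : a * p + b * r = u * g by rewrite /u [in LHS]ea [in LHS]er; ring.
    by rewrite mul1r eu er; ring.
  by rewrite -det -mulrA -ea' /b' /a'; ring.
have -> : norm_form_elt P y1 (- u) = eis_conj (norm_form_elt P y1 u).
  by rewrite !norm_form_eltE; apply: eis_ext => /=; ring.
rewrite cubic_jacobi_conj //.
have hx := cubic_jacobi_value p1 (norm_form_elt P y1 u).
have hy := cubic_jacobi_value p1' (norm_form_elt P y1 u).
move: (cubic_jacobi _ a1%:~R) (cubic_jacobi _ a1'%:~R) hx hy e => z w hx hy e.
have w0 : w != 0 by apply: contra_eq_neq e => ->; rewrite mulr0 eq_sym oner_eq0.
by apply: (mulIf w0); rewrite e mulrC cubic_value_conj.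
Qed.

End Invariance.

(** Some value f(k, 1) is prime to 3, since a quadratic polynomial has at most
    two roots modulo 3. In coordinates where it is the first coefficient A, the
    form (A, 3 B, 9 C) is still primitive; a value of it prime to N is a value
    of f at a point that reduces modulo 3 to (k, 1) up to a scalar. *)
Lemma bqf_coprime_value (a b c N : int) : bqf_primitive (Bqf a (2 * b) c) ->
  ~~ (3 %| a)%Z -> (3 %| N)%Z -> N != 0 -> exists x y,
  [/\ coprimez x y, ~~ (3 %| y)%Z & coprimez (a * x ^+ 2 + 2 * b * x * y + c * y ^+ 2) N].
Proof.
move=> prim a3 N3 N0.
have [k A3] : exists k, ~~ (3 %| a * k ^+ 2 + 2 * b * k + c)%Z.
  have [c3|c3] := boolP (3 %| c)%Z; last by exists 0; move: c3; congr (~~ (_ %| _)%Z); ring.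
  have [d3|d3] := boolP (3 %| a + 2 * b + c)%Z; last first.
    by exists 1; move: d3; congr (~~ (_ %| _)%Z); ring.
  exists (-1); rewrite (_ : _ + c = a - 2 * b + c); last by ring.
  by lia.
set A := _ + c in A3; pose B := - 2 * a * k - 2 * b.
have /bqf_primitiveP/=[u [v [w uvw]]] : bqf_primitive (Bqf A B a).
  apply: bqf_equiv_primitive prim; exists k, (-1), 1, 0; split=> [|x y]; first by ring.
  by rewrite /bqf_eval /= /A /B; ring.
have /coprimezP[[s t] /= st] : coprimez A (3 ^+ 2).
  by rewrite coprimezXr // coprimez_sym coprimezE /= prime_coprime.
have prim' : bqf_primitive (Bqf A (3 * B) (9 * a)).
  apply/bqf_primitiveP; exists (s + 9 * t * u), (3 * t * v), (t * w) => /=.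
  transitivity (s * A + t * 3 ^+ 2 * (u * A + v * B + w * a)); first by ring.
  by rewrite uvw mulr1 -[t * _]/(t * 3 ^+ 2) st.
have [X [Y [XY]]] := bqf_primitive_coprime prim' N0; rewrite /bqf_eval /= => co.
have X3 : ~~ (3 %| X)%Z.
  apply/negP => /dvdzP[Z eX].
  have : (3 %| gcdz (A * X ^+ 2 + 3 * B * X * Y + 9 * a * Y ^+ 2) N)%Z.
    rewrite dvdz_gcd N3 andbT; apply/dvdzP.
    exists (3 * A * Z ^+ 2 + 3 * B * Z * Y + 3 * a * Y ^+ 2); rewrite eX; ring.
  by rewrite (eqP co).
exists (k * X - 3 * Y), X; split=> //.
  rewrite coprimez_sym /coprimez (_ : k * X - 3 * Y = k * X + (- 3) * Y); last by ring.
  rewrite gcdzMDl -/(coprimez _ _) coprimezMr XY andbT.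
  by rewrite coprimez_sym coprimezE /= prime_coprime.
by move: co; congr coprimez; rewrite /A /B; ring.
Qed.

Lemma contains_bqf_equiv D (x : class_group D) F G :
  contains x F -> contains x G -> bqf_equiv F G.
Proof. by move=> [f <- <-] [g /clsP gf <-]; apply: bqf_equiv_sym. Qed.

Section Character.
Variables (P D Q q0 : int) (q1 : nat).
Hypotheses (hP : ~~ (3 %| P)%Z \/ (27 %| P)%Z).
Hypotheses (hQ : Q = P ^+ 2 + 27 * D) (hQq : Q = 2 ^+ q1 * q0 ^+ 3).
Hypothesis (hDQ : D * Q != 0).

Lemma modulus_neq0 : 3 * D * Q != 0.
Proof. by rewrite -mulrA mulf_neq0. Qed.

Lemma coprime_modulus (a : int) : coprimez a (3 * D * Q) -> coprimez a Q /\ ~~ (3 %| a)%Z.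
Proof.
rewrite !coprimezMr => /andP[/andP[a3 _] ->]; split=> //.
by move: a3; rewrite coprimez_sym coprimezE /= prime_coprime.
Qed.

Lemma contains_disc4 (x : class_group D) (a b c : int) :
  contains x (Bqf a (2 * b) c) -> b ^+ 2 - a * c = D.
Proof.
move=> /contains_disc e; apply: (@mulfI _ 4) => //; rewrite -e; ring.
Qed.

(** When 3 divides the lower left entry r, the two forms are linked through a
    third one, reached from either of them by a matrix with r prime to 3. *)
Lemma chi_symbol_class (x : class_group D) (a b c a' b' c' : int) :
  contains x (Bqf a (2 * b) c) -> contains x (Bqf a' (2 * b') c') ->
  coprimez a (3 * D * Q) -> coprimez a' (3 * D * Q) ->
  chi_symbol P a b = chi_symbol P a' b'.
Proof.
move=> xF xF' co co'; have [aQ a3] := coprime_modulus co.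
have [aQ' a3'] := coprime_modulus co'.
have hD := contains_disc4 xF; have hD' := contains_disc4 xF'.
have [p [q [r [s [det]]]]] := bqf_equiv_coefE (contains_bqf_equiv xF xF').
rewrite /bqf_eval /= => -[ea' eb' ec'].
have {}ea' : a' = a * p ^+ 2 + 2 * b * p * r + c * r ^+ 2 by [].
have {}eb' : b' = a * p * q + b * (p * s + q * r) + c * r * s.
  by apply: (@mulfI _ 2) => //; rewrite eb'; ring.
have trans := chi_symbol_transition hP hQ hQq.
have [r3|r3] := boolP (3 %| r)%Z; last first.
  have := trans a b c p q r s hD det; rewrite /= -ea' -eb'; exact.
have prim : bqf_primitive (Bqf a (2 * b) c) by have /and3P[] := contains_in xF.
have N3 : (3 %| 3 * D * Q)%Z by rewrite -mulrA dvdz_mulr.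
have [X [Y [/coprimezP[[S T] /= det2] Y3 coX]]] :=
  bqf_coprime_value prim a3 N3 modulus_neq0.
have {}det2 : X * S - (- T) * Y = 1 by rewrite -det2; ring.
have [aQX a3X] := coprime_modulus coX.
rewrite (trans a b c X (- T) Y S hD det2 aQ a3 aQX a3X Y3).
(* The adjugate of the first matrix times the second one leads from the form
   (a', 2b', c') to the third form. *)
pose p2 := s * X - q * Y; pose q2 := s * (- T) - q * S.
pose r2 := p * Y - r * X; pose s2 := p * S - r * (- T).
have det3 : p2 * s2 - q2 * r2 = 1.
  transitivity ((p * s - q * r) * (X * S - (- T) * Y)); last by rewrite det det2.
  by rewrite /p2 /q2 /r2 /s2; ring.
have r23 : ~~ (3 %| r2)%Z.
  have rX : (3 %| - (r * X))%Z by rewrite rpredN dvdz_mulr.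
  rewrite /r2 (dvdz_addr _ rX) dvdzE abszM Euclid_dvdM // negb_or.
  apply/andP; split; last by rewrite dvdzE in Y3.
  apply/negP => p3; have : (3 %| p * s - q * r)%Z.
    by apply: rpredB; [apply: dvdz_mulr|apply: dvdz_mull].
  by rewrite det.
have eA : a * X ^+ 2 + 2 * b * X * Y + c * Y ^+ 2 =
    a' * p2 ^+ 2 + 2 * b' * p2 * r2 + c' * r2 ^+ 2.
  transitivity ((p * s - q * r) ^+ 2 * (a * X ^+ 2 + 2 * b * X * Y + c * Y ^+ 2)).
    by rewrite det expr1n mul1r.
  by rewrite ea' eb' ec' /p2 /r2; ring.
have eB : a * X * - T + b * (X * S + - T * Y) + c * Y * S =
    a' * p2 * q2 + b' * (p2 * s2 + q2 * r2) + c' * r2 * s2.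
  transitivity ((p * s - q * r) ^+ 2 *
      (a * X * - T + b * (X * S + - T * Y) + c * Y * S)).
    by rewrite det expr1n mul1r.
  by rewrite ea' eb' ec' /p2 /q2 /r2 /s2; ring.
have := trans a' b' c' p2 q2 r2 s2 hD' det3; rewrite /= -eA -eB => -> //.
Qed.

End Character.

(** * The character and its kernel *)

Lemma omegaC_root : omegaC ^+ 2 + omegaC + 1 = 0.
Proof.
have s3 : sqrtC (-3) ^+ 2 = -3 :> algC by rewrite sqrtCK.
have n2 : 2 != 0 :> algC by rewrite pnatr_eq0.
by rewrite /omegaC; field: s3.
Qed.

Definition eisC_morph : {rmorphism eis -> algC} := eis_ev omegaC_root.

Lemma eisCE x : eisC x = eisC_morph x. Proof. by []. Qed.

Lemma coprimez_gcd1 (a n : int) : gcdz a n = 1 <-> coprimez a n.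
Proof. by split=> [/eqP|/eqP]. Qed.

(** A common middle coefficient exists by the Chinese remainder theorem once the
    first coefficients are coprime. *)
Lemma contains_united_coprime D (x y : class_group D) (N : int) : N != 0 ->
  exists a1 a2 b c, [/\ contains x (Bqf a1 (2 * b) (a2 * c)),
    contains y (Bqf a2 (2 * b) (a1 * c)), coprimez a1 N & coprimez a2 N].
Proof.
move=> N0.
have [|a1 [b1 [c1 [xF]]]] := contains_coprime x (_ : 2 * N != 0).
  by rewrite mulf_neq0.
rewrite coprimezMr => /andP[co1 coN1]; have n1 := coprimez_neq0 co1.
have [|a2 [b2 [c2 [yG]]]] := contains_coprime y (_ : 2 * N * a1 != 0).
  by rewrite !mulf_neq0.
rewrite !coprimezMr => /andP[/andP[co2 coN2] co21]; have n2 := coprimez_neq0 co2.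
pose b0 := zchinese (2 * a1) a2 b1 b2.
have co12 : coprimez (2 * a1) a2 by rewrite coprimez_sym coprimezMr co2 co21.
have e1 : (2 * a1 %| b0 - b1)%Z.
  by rewrite -eqz_mod_dvd; apply/eqP; exact: zchinese_modl.
have e2 : (a2 %| b0 - b2)%Z.
  by rewrite -eqz_mod_dvd; apply/eqP; exact: zchinese_modr.
have two : (2 %| b0 - b1)%Z by apply: dvdz_trans e1; apply: dvdz_mulr.
have e2' : (2 * a2 %| b0 - b2)%Z.
  rewrite Gauss_dvdz 1?coprimez_sym // e2 andbT -(subrKA b1).
  by apply: dvdzD => //; exact: contains_parity xF yG.
have [c1' xF'] := contains_shift xF e1.
have [c2' yG'] := contains_shift yG e2'.
have d1 := contains_disc xF'; have d2 := contains_disc yG'.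
have m12 : a1 * c1' = a2 * c2'.
  apply: (mulfI (_ : 4 != 0 :> int)) => //; rewrite !mulrA.
  by apply/oppr_inj/(addrI (b0 ^+ 2)); rewrite d1 d2.
have /dvdzP[c ec] : (a2 %| c1')%Z.
  by rewrite -(@Gauss_dvdzr _ a1) // m12 dvdz_mulr.
have [b eb] := contains_even xF'.
exists a1, a2, b, c; split=> //; rewrite -eb.
  by have <- : c1' = a2 * c by rewrite mulrC.
suff <- : c2' = a1 * c by [].
by apply: (mulfI n2); rewrite -m12 ec; ring.
Qed.

Section Character.
Variables (P D Q q0 : int) (q1 : nat).
Hypotheses (hP : ~~ (3 %| P)%Z \/ (27 %| P)%Z).
Hypotheses (hQ : Q = P ^+ 2 + 27 * D) (hQq : Q = 2 ^+ q1 * q0 ^+ 3).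
Hypothesis (hDQ : D * Q != 0).
Local Open Scope classical_set_scope.

(** The character with values in the Eisenstein integers; the set is never
    empty, see contains_modulus. *)
Definition chi_value (x : class_group D) : eis := xget 0
  [set z | exists a b c, [/\ contains x (Bqf a (2 * b) c),
     coprimez a (3 * D * Q) & z = chi_symbol P a b]].

Lemma contains_modulus (x : class_group D) : exists a b c,
  contains x (Bqf a (2 * b) c) /\ coprimez a (3 * D * Q).
Proof.
have [a [b0 [c [xF co]]]] := contains_coprime x (modulus_neq0 hDQ).
by have [b eb] := contains_even xF; exists a, b, c; rewrite -eb.
Qed.

Lemma chi_valueE (x : class_group D) a b c : contains x (Bqf a (2 * b) c) ->
  coprimez a (3 * D * Q) -> chi_value x = chi_symbol P a b.
Proof.
move=> xF co; rewrite /chi_value; apply: xget_unique => [|z [a' [b' [c' [xF' co' ->]]]]].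
  by exists a, b, c.
exact: (chi_symbol_class hP hQ hQq hDQ xF' xF co' co).
Qed.

Lemma chi_value_cubic x : cubic_value (chi_value x).
Proof.
have [a [b [c [xF co]]]] := contains_modulus x; rewrite (chi_valueE xF co).
by apply: cubic_jacobi_value; rewrite eis_pm1_int; case: (coprime_modulus co).
Qed.

Lemma chi_valueM (x y : class_group D) : chi_value (x * y)%g = chi_value x * chi_value y.
Proof.
have [a1 [a2 [b [c [xF yG co1 co2]]]]] := contains_united_coprime x y (modulus_neq0 hDQ).
have [_ a13] := coprime_modulus co1; have [_ a23] := coprime_modulus co2.
rewrite (chi_valueE xF co1) (chi_valueE yG co2) -chi_symbolM //.
apply: (@chi_valueE _ _ _ c); first by rewrite class_group_mulE; apply: class_mul_united.
by rewrite coprimezMl co1.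
Qed.

Lemma chi_value1 : chi_value 1%g = 1.
Proof.
rewrite (@chi_valueE _ 1 0 (- D)).
- by rewrite /chi_symbol cubic_jacobi1r.
- by apply/contains_one; ring.
- by rewrite coprimezE coprime1n.
Qed.

Lemma chi_value_neq0 x : chi_value x != 0.
Proof.
have := chi_value1; rewrite -(mulgV x) chi_valueM; apply: contra_eq_neq => ->.
by rewrite mul0r eq_sym oner_eq0.
Qed.

Lemma chi_formula_exists : exists chi : class_group D -> algC,
  unique (chi_formula P D Q) chi /\ group_character chi.
Proof.
exists (eisC \o chi_value); split; last first.
  split=> [|x y] /=; first by rewrite chi_value1 eisCE rmorph1.
  by rewrite chi_valueM !eisCE rmorphM.
split=> [x a b c xF /coprimez_gcd1 co|chi' h].
  by rewrite /= (chi_valueE xF co).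
apply: funext => x; have [a [b [c [xF co]]]] := contains_modulus x.
by rewrite /= (chi_valueE xF co); apply/esym/(h _ _ _ _ xF)/coprimez_gcd1.
Qed.

Lemma G_setE (x : class_group D) : x \in mem (G_set P D Q) <-> chi_value x = 1.
Proof.
rewrite (in_setE (G_set P D Q)); split=> [[a [b [c [xF /coprimez_gcd1 co e]]]]|e].
  by rewrite (chi_valueE xF co).
have [a [b [c [xF co]]]] := contains_modulus x; exists a, b, c; split=> //.
  exact/coprimez_gcd1.
by rewrite -(chi_valueE xF co).
Qed.

Lemma G_set_closed : group_closed (mem (G_set P D Q)).
Proof.
split; first by apply/G_setE; apply: chi_value1.
move=> x y /G_setE x1 /G_setE y1; apply/G_setE.
by apply: (mulIf (chi_value_neq0 y)); rewrite -chi_valueM mulgVK x1 y1 mulr1.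
Qed.

Lemma left_coset_G_set (x y : class_group D) :
  left_coset (G_set P D Q) x = left_coset (G_set P D Q) y <-> chi_value x = chi_value y.
Proof.
have GE z : G_set P D Q z <-> chi_value z = 1 by rewrite -G_setE in_setE.
have lc z t : left_coset (G_set P D Q) z t <-> chi_value t = chi_value z.
  split=> [[g /GE g1 <-]|e]; first by rewrite chi_valueM g1 mulr1.
  exists (z^-1 * t)%g; last by rewrite mulVKg.
  by apply/GE; apply: (mulfI (chi_value_neq0 z)); rewrite -chi_valueM mulVKg e mulr1.
split=> [e|e]; first by apply/lc; rewrite -e; apply/lc.
by apply/seteqP; split=> t /lc h; apply/lc; rewrite h e.
Qed.

Lemma chi_valueX x n : chi_value (x ^+ n)%g = chi_value x ^+ n.
Proof. by elim: n => [|n IH]; rewrite ?chi_value1 // expgS exprS chi_valueM IH. Qed.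

Lemma omega_pow_inj i j : (i < 3)%N -> (j < 3)%N -> omega ^+ i = omega ^+ j -> i = j.
Proof. by case: i => [|[|[|//]]] _; case: j => [|[|[|//]]]. Qed.

(** The coset of x only depends on the value at x, and 1, x0, x0^2 take
    each of the three values once. *)
Lemma G_set_index (x0 : class_group D) : chi_value x0 != 1 -> has_index (G_set P D Q) 3.
Proof.
move=> x01; have hx0 := chi_value_cubic x0; have n0 := chi_value_neq0 x0.
have [k [k3 ek]] : exists k, (k = 1 \/ k = 2)%N /\ chi_value x0 = omega ^+ k.
  case: (cubic_value_cases hx0) => e; rewrite e ?eqxx // in x01 n0.
    by exists 1%N; split=> //; left.
  by exists 2%N; split=> //; right.
pose f i := left_coset (G_set P D Q) (x0 ^+ i)%g.
rewrite /has_index (_ : range _ = f @` `I_3).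
  apply: inj_card_eq => i j; rewrite !in_setE /= => i3 j3 /left_coset_G_set.
  rewrite !chi_valueX ek -!exprM.
  case: k3 => ->; first by rewrite !mul1n; apply: omega_pow_inj.
  move=> e; apply: omega_pow_inj => //; move: e.
  by case: i i3 => [|[|[|//]]] _; case: j j3 => [|[|[|//]]].
apply/seteqP; split=> [_ [x _ <-]|_ [i _ <-]]; last by exists (x0 ^+ i)%g.
have [i [i3 ei]] : exists i, (i < 3)%N /\ chi_value x = chi_value x0 ^+ i.
  rewrite ek; case: (cubic_value_cases (chi_value_cubic x)) => e.
  - by have := chi_value_neq0 x; rewrite e eqxx.
  - by exists 0%N.
  - by case: k3 => ->; [exists 1%N|exists 2%N].
  - by case: k3 => ->; [exists 2%N|exists 1%N].
by exists i => //; apply/left_coset_G_set; rewrite chi_valueX.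
Qed.

End Character.

(** * A class on which the character is nontrivial *)

Section CubicEquation.
Variables (K : closedFieldType) (p : nat) (pK : p \in [pchar K]).
Let pp : prime p := pcharf_prime pK.

Lemma pchar_intr_eq0 (m : int) : (m%:~R == 0 :> K) = (p %| m)%Z.
Proof.
case: m => n; first by rewrite -pmulrn -(dvdn_pcharf pK).
by rewrite NegzE rmorphN oppr_eq0 /= -pmulrn -(dvdn_pcharf pK) rpredN.
Qed.

(** X^p - X splits over the prime field. *)
Lemma frob_fixed (x : K) : x ^+ p = x -> exists n : int, x = n%:~R.
Proof.
move=> xp; have := finField_genPoly 'F_p; rewrite card_Fp // => e.
have /(congr1 (fun f => f.[x])) := congr1 (map_poly (Fp_ev pK)) e.
rewrite rmorphB rmorph_prod /= map_polyXn map_polyX !hornerE xp subrr.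
rewrite horner_prod => /esym/eqP; rewrite prodf_seq_eq0 => /hasP[t _ /=].
rewrite rmorphB /= map_polyX map_polyC !hornerE subr_eq0 => /eqP->.
by exists (t : nat).
Qed.

Lemma frobD (x y : K) : (x + y) ^+ p = x ^+ p + y ^+ p.
Proof. by rewrite exprDn_pchar // pnatE. Qed.
Lemma frobN (x : K) : (- x) ^+ p = - x ^+ p.
Proof. by rewrite exprNn_pchar // pnatE. Qed.
Lemma frob_int (m : int) : (m%:~R : K) ^+ p = m%:~R.
Proof. by rewrite -(pFrobenius_autE pK) pFrobenius_aut_int. Qed.

Lemma closed_cube_root (c : K) : exists x, x ^+ 3 = c.
Proof.
have [x ex] := @solve_monicpoly K 3 (fun i => if i == 0%N then c else 0) isT.
by exists x; rewrite ex !big_ord_recl big_ord0 /=; ring.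
Qed.

Variables (P D Q : int).
Hypothesis (hQ : Q = P ^+ 2 + 27 * D).
Hypotheses (p2 : p != 2%N) (pD : ~~ (p %| D)%Z) (pP : ~~ (p %| P)%Z) (pQ : ~~ (p %| Q)%Z).
Hypothesis noroot : ~ exists x : int, (p %| D * x ^+ 3 - Q * x - 2 * Q)%Z.

Let hQK : (Q%:~R : K) = P%:~R ^+ 2 + 27 * D%:~R.
Proof. by rewrite hQ rmorphD rmorphM rmorphXn. Qed.

Lemma cubic_no_fixed_root (x : K) :
  D%:~R * x ^+ 3 = Q%:~R * x + 2 * Q%:~R -> x ^+ p <> x.
Proof.
move=> hx /frob_fixed[n en]; apply: noroot; exists n; rewrite -pchar_intr_eq0.
have -> : (D * n ^+ 3 - Q * n - 2 * Q)%:~R =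
    D%:~R * n%:~R ^+ 3 - Q%:~R * n%:~R - 2 * Q%:~R :> K by rewrite !rmorphB /= !intrM.
by apply/eqP; rewrite -en hx; ring.
Qed.

(** The discriminant of D x^3 - Q x - 2 Q is D (2 P Q)^2; without a fixed
    root, Frobenius permutes the three roots cyclically and fixes its square
    root. *)
Lemma square_of_no_root : exists b : int, (p %| b ^+ 2 - D)%Z.
Proof.
have D0 : D%:~R != 0 :> K by rewrite pchar_intr_eq0.
have P0 : P%:~R != 0 :> K by rewrite pchar_intr_eq0.
have Q0 : Q%:~R != 0 :> K by rewrite pchar_intr_eq0.
have K2 : 2 != 0 :> K by rewrite -(dvdn_pcharf pK) dvdn_prime2.
have [x1 ex1] := @solve_monicpoly K 3 (fun i => if i == 0%N then 2 * Q%:~R / D%:~R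
  else if i == 1%N then Q%:~R / D%:~R else 0) isT.
have h1 : D%:~R * x1 ^+ 3 = Q%:~R * x1 + 2 * Q%:~R.
  by rewrite ex1 !big_ord_recl big_ord0 /=; field.
have [x2 ex2] := @solve_monicpoly K 2 (fun i => if i == 0%N then Q%:~R / D%:~R - x1 ^+ 2
  else - x1) isT.
have h2 : D%:~R * (x2 ^+ 2 + x1 * x2 + x1 ^+ 2) = Q%:~R.
  by rewrite ex2 !big_ord_recl big_ord0 /=; field.
pose x3 := - x1 - x2.
have factor (t : K) : D%:~R * t ^+ 3 - Q%:~R * t - 2 * Q%:~R =
    D%:~R * ((t - x1) * ((t - x2) * (t - x3))).
  have -> : 2 * Q%:~R = D%:~R * x1 ^+ 3 - Q%:~R * x1 by rewrite h1; ring.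
  by rewrite -h2 /x3; ring.
have root_cases (t : K) : D%:~R * t ^+ 3 = Q%:~R * t + 2 * Q%:~R ->
    [\/ t = x1, t = x2 | t = x3].
  move=> ht; have /eqP : D%:~R * ((t - x1) * ((t - x2) * (t - x3))) = 0.
    by rewrite -factor ht; ring.
  rewrite mulf_eq0 (negbTE D0) !mulf_eq0 !(subr_eq0 t) => /= /or3P[]/eqP.
  - by constructor 1.
  - by constructor 2.
  - by constructor 3.
have rootE (t : K) : [\/ t = x1, t = x2 | t = x3] -> D%:~R * t ^+ 3 = Q%:~R * t + 2 * Q%:~R.
  move=> ht; apply/eqP; rewrite -subr_eq0 opprD addrA factor.
  by case: ht => ->; rewrite !subrr !(mul0r, mulr0).
have frob_root (t : K) : [\/ t = x1, t = x2 | t = x3] ->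
    [\/ t ^+ p = x1, t ^+ p = x2 | t ^+ p = x3] /\ t ^+ p <> t.
  move=> /rootE ht; split; last exact: cubic_no_fixed_root.
  apply: root_cases; have := congr1 (fun z => z ^+ p) ht.
  rewrite /= frobD (exprMn p D%:~R) (exprMn p Q%:~R) (exprMn p 2) (exprAC t).
  by rewrite !frob_int -[2]/(2%:~R) frob_int.
have s3 : x3 ^+ p = - x1 ^+ p - x2 ^+ p by rewrite /x3 frobD !frobN.
pose d := (x1 - x2) * (x2 - x3) * (x3 - x1).
have dp : d ^+ p = d.
  rewrite /d !exprMn !frobD !frobN.
  have [r1 f1] := frob_root x1 (Or31 _ _ (erefl x1)).
  have [r2 f2] := frob_root x2 (Or32 _ _ (erefl x2)).
  have [r3 f3] := frob_root x3 (Or33 _ _ (erefl x3)).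
  case: r1 => e1; first by case: f1.
    case: r2 => e2; [|by case: f2|].
      by case: f3; rewrite s3 e1 e2 /x3; ring.
    by rewrite s3 e1 e2 /x3; ring.
  case: r3 => e3; [| |by case: f3].
    have e2 : x2 ^+ p = - x1 ^+ p - x3 ^+ p by rewrite s3; ring.
    by case: f2; rewrite e2 e1 e3 /x3; ring.
  have e2 : x2 ^+ p = - x1 ^+ p - x3 ^+ p by rewrite s3; ring.
  by rewrite e2 e1 e3 /x3; ring.
have disc : D%:~R * (2 * Q%:~R * P%:~R) ^+ 2 = (D%:~R ^+ 2 * d) ^+ 2 :> K.
  have eP : P%:~R ^+ 2 = Q%:~R - 27 * D%:~R :> K by rewrite hQK; ring.
  have -> : (2 * Q%:~R * P%:~R) ^+ 2 = 4 * Q%:~R ^+ 3 - 27 * D%:~R * (2 * Q%:~R) ^+ 2 :> K.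
    by rewrite exprMn eP; ring.
  have -> : 2 * Q%:~R = D%:~R * x1 ^+ 3 - Q%:~R * x1 by rewrite h1; ring.
  by rewrite -h2 /d /x3; ring.
have den0 : 2 * Q%:~R * P%:~R != 0 :> K by rewrite !mulf_neq0.
have [|b eb] := @frob_fixed (D%:~R ^+ 2 * d / (2 * Q%:~R * P%:~R)).
  rewrite expr_div_n (exprMn p (D%:~R ^+ 2)) (exprMn p (2 * Q%:~R)) (exprMn p 2) dp exprAC.
  by rewrite !frob_int -[2]/(2%:~R) frob_int.
exists b; rewrite -pchar_intr_eq0 rmorphB rmorphXn /= -eb expr_div_n -disc.
by rewrite mulfK ?subrr // expf_neq0.
Qed.

(** Cardano's formula: with e^2 = - 3 D, the root is (v - w) / e where v w = Q
    and v^3, w^3 are Q (P - 3 e) and Q (P + 3 e), whose product is Q^3. *)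
Lemma cardano (e v w : K) : e ^+ 2 = - 3 * D%:~R -> 3 != 0 :> K ->
  v ^+ 3 = Q%:~R * (P%:~R - 3 * e) -> v * w = Q%:~R ->
  D%:~R * ((v - w) / e) ^+ 3 = Q%:~R * ((v - w) / e) + 2 * Q%:~R.
Proof.
move=> ee K3 v3 vw.
have D0 : D%:~R != 0 :> K by rewrite pchar_intr_eq0.
have Q0 : Q%:~R != 0 :> K by rewrite pchar_intr_eq0.
have e0 : e != 0.
  have : e ^+ 2 != 0 by rewrite ee mulf_neq0 // oppr_eq0.
  by rewrite expf_eq0.
have QE : Q%:~R = (P%:~R - 3 * e) * (P%:~R + 3 * e).
  have -> : Q%:~R = P%:~R ^+ 2 - 9 * (- 3 * D%:~R) :> K by rewrite hQK; ring.
  by rewrite -ee; ring.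
have r0 : P%:~R - 3 * e != 0 by apply: contra_neq Q0; rewrite QE => ->; rewrite mul0r.
have w3 : w ^+ 3 = Q%:~R * (P%:~R + 3 * e).
  apply: (mulfI r0); apply: (mulfI Q0); rewrite [LHS]mulrA -v3 -exprMn vw.
  by rewrite exprS; congr (_ * _); rewrite expr2 {1}QE; ring.
have z3 : (v - w) ^+ 3 = - 6 * e * Q%:~R - 3 * Q%:~R * (v - w).
  transitivity (v ^+ 3 - w ^+ 3 - 3 * (v * w) * (v - w)); first by ring.
  by rewrite v3 w3 vw; ring.
apply: (@mulfI _ (- 3)); first by rewrite oppr_eq0.
by rewrite mulrA -ee expr_div_n z3; field.
Qed.

End CubicEquation.

Lemma nat_mod3 (n : nat) :
  exists j, n = (3 * j)%N \/ n = (3 * j + 1)%N \/ n = (3 * j + 2)%N.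
Proof. by exists (n %/ 3)%N; lia. Qed.

(** With e the image of b sqrt(-3) and alpha = P - 3 b sqrt(-3), it suffices to
    choose the cube roots v and w in Cardano's formula so that Frobenius fixes v,
    w and e (p split), or exchanges v and w and negates e (p inert). In the split
    case the symbol says that alpha and its conjugate have the same cubic
    character at l; in the inert case v = h^2 h^p where h^3 is the image of
    alpha. *)
Lemma cubic_root_of_symbol (P D Q b : int) (p : nat) : prime p -> p != 3%N ->
  Q = P ^+ 2 + 27 * D -> ~~ (p %| D)%Z -> ~~ (p %| Q)%Z ->
  (p %| b ^+ 2 - D)%Z -> chi_symbol P p b = 1 ->
  exists x : int, (p %| D * x ^+ 3 - Q * x - 2 * Q)%Z.
Proof.
move=> pp p3 hQ pD pQ pb; rewrite chi_symbolE -pmulrn => sym1.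
apply: contrapT => noroot.
have [l [lp l2 lq]] := primary_prime_over pp p3; have l3 := eis_primary_pm1 l2.
have [K [phi phi_l]] := residue_exists lp.
have pK := rmorph_eis_pchar pp phi_l lq; have K3 := rmorph_eis_3 lp l3 phi_l.
set alpha := norm_form_elt P 1 b in sym1; set k := cubic_exp l.
have [_ sa] := cubic_residue_symbolP alpha lp l2 phi_l.
have [_ sa'] := cubic_residue_symbolP (eis_conj alpha) lp l2 phi_l.
pose e := b%:~R * phi sqrtm3.
have Q0 : Q%:~R != 0 :> K by rewrite (pchar_intr_eq0 pK).
have ee : e ^+ 2 = - 3 * D%:~R.
  have -> : D%:~R = b%:~R ^+ 2 :> K.
    by apply/eqP; rewrite eq_sym -subr_eq0 -rmorphXn -rmorphB /= (pchar_intr_eq0 pK).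
  by rewrite exprMn -(rmorphXn phi) sqrtm3_sqr rmorphN rmorph_nat; ring.
have ea : phi alpha = P%:~R - 3 * e.
  by rewrite /alpha /norm_form_elt mulr1 rmorphB !rmorphM !rmorph_int rmorph_nat /e; ring.
have ea' : phi (eis_conj alpha) = P%:~R + 3 * e.
  have -> : eis_conj alpha = norm_form_elt P 1 (- b).
    by rewrite /alpha !norm_form_eltE; apply: eis_ext => /=; ring.
  rewrite /norm_form_elt mulr1 rmorphB !rmorphM !rmorph_int rmorph_nat /e rmorphN /=; ring.
have eQ : phi alpha * phi (eis_conj alpha) = Q%:~R.
  rewrite ea ea' hQ rmorphD rmorphM rmorphXn /=.
  transitivity (P%:~R ^+ 2 - 9 * e ^+ 2); first by ring.
  by rewrite ee; ring.
have contra v w : v ^+ 3 = Q%:~R * phi alpha -> v * w = Q%:~R ->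
    ((v - w) / e) ^+ p = (v - w) / e -> False.
  move=> v3 vw; rewrite ea in v3.
  exact: (cubic_no_fixed_root pK noroot (cardano pK hQ pD pQ ee K3 v3 vw)).
have a0 : phi alpha != 0 by apply: contra_neq Q0; rewrite -eQ => ->; rewrite mul0r.
have a0' : phi (eis_conj alpha) != 0.
  by apply: contra_neq Q0; rewrite -eQ => ->; rewrite mulr0.
have nk := cubic_expE l3; rewrite -/k in nk.
case: (cubic_jacobi_over pp p3 lp l2 lq) => [[nl jE]|[nl ql jE]].
  have frob x : phi x ^+ p = phi x by have := rmorph_eis_norm x lp l3 phi_l; rewrite nl.
  have pk : p = (3 * k + 1)%N by move: nk; rewrite nl.
  have ak : phi alpha ^+ k = phi (eis_conj alpha) ^+ k.
    rewrite -sa -sa'; congr (phi _); rewrite jE in sym1.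
    have hb := cubic_residue_symbol_value lp l2 (eis_conj alpha).
    have b0 : cubic_residue_symbol (eis_conj alpha) l != 0.
      by apply: contra_eq_neq sym1 => ->; rewrite rmorph0 mulr0 eq_sym oner_eq0.
    have bb := cubic_value_conj hb b0.
    by rewrite -[LHS]mulr1 -bb mulrCA sym1 mulr1.
  have a3k : phi alpha ^+ (3 * k) = 1.
    by apply: (mulIf a0); rewrite mul1r -exprSr -addn1 -pk frob.
  have [v v3] := closed_cube_root (Q%:~R * phi alpha).
  have v0 : v != 0.
    have : v ^+ 3 != 0 by rewrite v3 mulf_neq0.
    by rewrite expf_eq0.
  have vp : v ^+ p = v.
    rewrite pk exprD exprM v3 -eQ !exprMn -ak -!exprD.
    rewrite (_ : (k + k + k)%N = (3 * k)%N); last by lia.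
    by rewrite a3k mul1r.
  apply: (contra v (Q%:~R / v)) => //; first by rewrite mulrC divfK.
  have ep : e ^+ p = e by rewrite /e exprMn frob (frob_int pK).
  by rewrite expr_div_n (frobD pK) (frobN pK) expr_div_n (frob_int pK) vp ep.
have pE : (p ^ 2 = 3 * k + 1)%N by move: nk; rewrite nl.
have frob x : phi x ^+ p = phi (eis_conj x).
  have := rmorph_eis_frob phi 1 x pK; rewrite expn1 => ->.
  have := rmorph_eis_frob phi 1 omega pK; rewrite expn1 /= mul1r add0r => wp.
  have [j [pj|[pj|pj]]] := nat_mod3 p.
  - by case/negP: p3; rewrite eq_sym -(dvdn_prime2 _ pp) // pj dvdn_mulr.
  - have /(frob_fixed pK)[n en] : phi omega ^+ p = phi omega.
      by rewrite pj exprD exprM rmorph_omega3 expr1n mul1r.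
    have /(rmorph_eis_eq0 _ lp phi_l)/(eis_dvd_trans ql)[z] : phi (omega - n%:~R) = 0.
      by rewrite rmorphB rmorph_int en subrr.
    move/(congr1 eb); rewrite !eisS => e1; have := prime_gt1 pp.
    have : (p %| 1%:Z)%Z by apply/dvdzP; exists (eb z); rewrite -[LHS]subr0 e1; ring.
    by rewrite dvdzE dvdn1 => /eqP /= ->.
  rewrite pj exprD exprM rmorph_omega3 expr1n mul1r [RHS]rmorph_eisE /=.
  have w2 : phi omega ^+ 2 = - phi omega - 1.
    by rewrite -[LHS](addrK (phi omega + 1)) addrA rmorph_omega; ring.
  by rewrite w2 rmorphB rmorphN /=; ring.
have [h h3] := closed_cube_root (phi alpha).
have hpp : h ^+ p ^+ p = h.
  rewrite -exprM -[(p * p)%N]/(p ^ 2)%N pE exprD exprM h3 -sa -jE sym1 rmorph1.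
  by rewrite mul1r.
pose v := h ^+ 2 * h ^+ p.
have vp : v ^+ p = h ^+ p ^+ 2 * h by rewrite /v exprMn hpp exprAC.
have hp3 : h ^+ p ^+ 3 = phi (eis_conj alpha) by rewrite exprAC h3 frob.
apply: (contra v (v ^+ p)).
- have -> : v ^+ 3 = (h ^+ 3) ^+ 2 * h ^+ p ^+ 3 by rewrite /v; ring.
  by rewrite h3 hp3 -eQ; ring.
- have -> : v * v ^+ p = h ^+ 3 * h ^+ p ^+ 3 by rewrite vp /v; ring.
  by rewrite h3 hp3.
have ep : e ^+ p = - e.
  by rewrite /e exprMn frob eis_conj_sqrtm3 rmorphN (frob_int pK) mulrN.
have vpp : v ^+ p ^+ p = v by rewrite vp exprMn (exprAC (h ^+ p)) hpp.
by rewrite expr_div_n (frobD pK) (frobN pK) vpp ep invrN mulrN -mulNr opprB.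
Qed.

(** The form is (p, 2b, c) with b^2 = D modulo p. *)
Lemma nontrivial_class (P D Q : int) (p : nat) : Q = P ^+ 2 + 27 * D ->
  D * Q != 0 -> prime p -> odd p -> ~~ (p %| 3 * D * P * Q)%Z ->
  ~ (exists x : int, (p %| D * x ^+ 3 - Q * x - 2 * Q)%Z) ->
  exists (x : class_group D) (a b c : int), [/\ contains x (Bqf a (2 * b) c),
    coprimez a (3 * D * Q) & chi_symbol P a b != 1].
Proof.
move=> hQ hDQ pp podd; rewrite !dvdzE !abszM !Euclid_dvdM // !negb_or.
move=> /andP[/andP[/andP[p3' pD] pP] pQ] noroot.
have p2 : p != 2%N by apply: contraTneq podd => ->.
have p3 : p != 3%N by apply: contraNneq p3' => ->.
have [K pK] := closed_field_of_pchar pp.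
have [b pb] := square_of_no_root pK hQ p2 pD pP pQ noroot.
have [c ec] : exists c, b ^+ 2 - D = p%:Z * c.
  by case/dvdzP: pb => c ->; exists c; rewrite mulrC.
have F_in : bqf_in (4 * D) (Bqf p (2 * b) c).
  apply/and3P; split; last by apply/implyP => _ /=; rewrite ltz_nat prime_gt0.
    rewrite /bqf_disc /=; apply/eqP.
    transitivity (4 * (b ^+ 2 - p%:Z * c)); first by ring.
    by rewrite -ec; ring.
  have /coprimezP[[u v] /= uv] : coprimez p (2 * b).
    rewrite coprimezE /= prime_coprime // abszM Euclid_dvdM // negb_or.
    rewrite dvdn_prime2 // p2 /=; apply: contra pD => pb'.
    have : (p%:Z %| b ^+ 2 - (b ^+ 2 - D))%Z by rewrite rpredB // expr2 dvdz_mulr.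
    by rewrite opprB addrC subrK.
  by apply/bqf_primitiveP; exists u, v, 0; rewrite /= mul0r addr0.
have [x xF] := in_contains F_in; exists x, p, b, c; split=> //.
  rewrite coprimezE /= prime_coprime // !abszM !Euclid_dvdM // !negb_or.
  by rewrite p3' pD pQ.
apply/eqP => /(cubic_root_of_symbol pp p3 hQ pD pQ pb).
exact: noroot.
Qed.

Theorem theorem3p1 (P D Q q0 : int) (q1 : nat)
  (hP : ~~ (3 %| P)%Z \/ (27 %| P)%Z)
  (hD : ~ exists d : int, D = d ^+ 2)
  (hQ : Q = P ^+ 2 + 27 * D)
  (hq1 : (q1 <= 2)%N)
  (hQq : Q = 2 ^+ q1 * q0 ^+ 3)
  (hDQ : D * Q != 0) :
  [/\ exists chi : class_group D -> algC,
        unique (chi_formula P D Q) chi /\ group_character chi,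
      group_closed (mem (G_set P D Q))
    & (exists p0 : nat,
         [/\ prime p0, odd p0, ~~ (p0%:Z %| 3 * D * P * Q)%Z
           & ~ exists x : int,
               (p0%:Z %| D * x ^+ 3 - Q * x - 2 * Q)%Z]) ->
      has_index (G_set P D Q) 3].
Proof.
split; [exact: chi_formula_exists hP hQ hQq hDQ|exact: G_set_closed hP hQ hQq hDQ|].
move=> [p [pp podd pndvd noroot]].
have [x [a [b [c [xF co ne1]]]]] := nontrivial_class hQ hDQ pp podd pndvd noroot.
apply: (G_set_index hP hQ hQq hDQ (x0 := x)).
by rewrite (chi_valueE hP hQ hQq hDQ xF co).
Qed.
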